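(* Let $\alpha\in\mathbb R$ and let $p\in\mathbb C[z_1,z_2]$ be an irreducible polynomial with no zeros in the open bidisk $\mathbb D^2$. Then the following hold. (i) If $\alpha\le 1$, then $p$ is cyclic in $\mathcal D_\alpha$. (ii) If $1<\alpha\le 2$, then $p$ is cyclic in $\mathcal D_\alpha$ if and only if $\mathcal Z(p)\cap\mathbb T^2$ is empty or finite. (iii) If $\alpha>2$, then $p$ is cyclic in $\mathcal D_\alpha$ if and only if $\mathcal Z(p)\cap\mathbb T^2$ is empty.
   Context: $\mathbb D=\{z\in\mathbb C:|z|<1\}$, $\mathbb T=\{z\in\mathbb C:|z|=1\}$, and $\mathcal Z(p)=\{(z_1,z_2)\in\mathbb C^2: p(z_1,z_2)=0\}$. A nonzero polynomial $p\in\mathbb C[z_1,z_2]$ is called irreducible if $p=qr$ with $q,r\in\mathbb C[z_1,z_2]$ implies $q\in\mathbb C$ or $r\in\mathbb C$. For $\alpha\in\mathbb R$, the Dirichlet-type space $\mathcal D_\alpha$ is the space of all holomorphic functions $f(z_1,z_2)=\sum_{k,l=0}^\infty a_{kl}z_1^kz_2^l$ on $\mathbb D^2$ with $\|f\|_\alpha^2:=\sum_{k,l=0}^\infty (k+l+1)^\alpha|a_{kl}|^2<\infty$; it is a Hilbert space with the corresponding inner product. A function $f\in\mathcal D_\alpha$ is cyclic in $\mathcal D_\alpha$ if the closed linear span in $\mathcal D_\alpha$ of $\{z_1^kz_2^l f: k,l\ge 0\}$ equals $\mathcal D_\alpha$. *)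

(* Defs.v *)
From mathcomp Require Import all_boot all_order all_algebra complex.
From mathcomp Require Import all_classical all_reals all_analysis.

Set Implicit Arguments.
Unset Strict Implicit.
Unset Printing Implicit Defensive.

Import Order.TTheory GRing.Theory Num.Theory.
Import numFieldNormedType.Exports.

Local Open Scope classical_set_scope.
Local Open Scope ring_scope.
Local Open Scope complex_scope.

Section Dirichlet.
Variable R : realType.
Local Notation C := R[i].
Implicit Types (f g h : C * C -> C) (a : nat * nat -> C) (alpha : R).

Definition bidisk : set (C * C) := [set z | `|z.1| < 1 /\ `|z.2| < 1].

Definition torus2 : set (C * C) := [set z | `|z.1| = 1 /\ `|z.2| = 1].

(* C[z1, z2] is {poly {poly C}}: the inner variable is z1, the outer one z2. *)
Definition peval (p : {poly {poly C}}) (z : C * C) : C := p.[z.2%:P].[z.1].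

Definition zero_set (p : {poly {poly C}}) : set (C * C) :=
  [set z | peval p z = 0].

(* Not irreducible_poly, which ignores factors of degree 0 in the outer
   variable.  Nonzero constants count as irreducible here. *)
Definition irreducible2 (p : {poly {poly C}}) : Prop :=
  p != 0 /\
  forall q r : {poly {poly C}}, p = q * r ->
    (exists c : C, q = c%:P%:P) \/ (exists c : C, r = c%:P%:P).

Definition monomial (kl : nat * nat) (z : C * C) : C :=
  z.1 ^+ kl.1 * z.2 ^+ kl.2.

(* Functions on the bidisk are total functions on C * C whose values outside
   the bidisk are irrelevant.  The double series must converge absolutely, so
   summing over squares is the same as summing in any other order. *)
Definition taylor_expansion a f : Prop :=
  forall z, bidisk z ->
    (\esum_(kl in [set: nat * nat])
        (ComplexField.Normc.normc (a kl * monomial kl z))%:E < +oo)%E /\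
    ((fun n => \sum_(k < n) \sum_(l < n)
        a (k : nat, l : nat) * monomial (k : nat, l : nat) z) : nat -> C^o)
      @ \oo --> (f z : C^o).

Definition holomorphic f : Prop := exists a, taylor_expansion a f.

(* The coefficients of a holomorphic f are unique; the default value is used
   only when f is not holomorphic on the bidisk. *)
Definition taylor_coef f : nat * nat -> C :=
  xget (fun=> 0) [set a | taylor_expansion a f].

Definition dirichlet_norm2 alpha f : \bar R :=
  \esum_(kl in [set: nat * nat])
    ((kl.1 + kl.2 + 1)%:R `^ alpha *
     ComplexField.Normc.normc (taylor_coef f kl) ^+ 2)%:E.

Definition dirichlet_norm alpha f : \bar R := sqrte (dirichlet_norm2 alpha f).

Definition dirichlet_space alpha : set (C * C -> C) :=
  [set f | holomorphic f /\ (dirichlet_norm2 alpha f < +oo)%E].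

Definition linear_span (S : set (C * C -> C)) : set (C * C -> C) :=
  [set h | exists (n : nat) (c : 'I_n -> C) (s : 'I_n -> C * C -> C),
     (forall i, S (s i)) /\ h = (fun z => \sum_(i < n) c i * s i z)].

Definition dirichlet_closure alpha (S : set (C * C -> C)) :
    set (C * C -> C) :=
  [set g | dirichlet_space alpha g /\
     forall e : R, 0 < e ->
       exists h, [/\ S h, dirichlet_space alpha h &
                     (dirichlet_norm alpha (g \- h)%R < e%:E)%E]].

Definition monomial_multiples f : set (C * C -> C) :=
  [set h | exists kl : nat * nat, h = (fun z => monomial kl z * f z)].

Definition cyclic_in_dirichlet alpha f : Prop :=
  dirichlet_space alpha f /\
  dirichlet_closure alpha (linear_span (monomial_multiples f)) =
    dirichlet_space alpha.

End Dirichlet.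

Arguments bidisk {R}.
Arguments torus2 {R}.

(* Main.v *)
Require Import Defs.
From mathcomp Require Import all_boot all_order all_algebra complex.
From mathcomp Require Import all_classical all_reals all_analysis.
From mathcomp Require Import cyclic separable cyclotomic polyXY ring lra zify.

(** By duality, p is cyclic if and only if no nonzero bounded functional on the
    space vanishes on all multiples of p. Such a functional F is determined by
    its values on monomials, and it is bounded when the sum of
    |F(z1^k z2^l)|^2 / (k + l + 1)^alpha is finite; this is [annihilates].
    One direction is the Cauchy-Schwarz inequality
    ([not_cyclic_of_annihilator]); for the other, near-minimal residuals
    q - p g of a polynomial q that is not a limit of multiples of p have a weak
    limit ([approximable_of_annihilators], [cyclic_of_annihilators]). So only
    polynomials, finite sums and limits of functionals on polynomials occur.

    The weight depends on k + l alone. Hence the norm is a mean, over w in the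
    unit circle, of one-variable norms of the slices t |-> q(t, w t). On each
    slice p is p(0, 0) times a product of a fixed number of factors 1 - a t
    with |a| <= 1, because p has no zeros in the bidisk. Bounds that depend only
    on this number, uniformly in a, give bounds in the two-variable space. To show
    F(h) = 0 it suffices to find multiples of p that converge to h
    coefficientwise and stay bounded in norm ([annihilates_limit]).

    If alpha <= 1, take h = 1. The normalised product of the rotations p(z x),
    z^j = 1, has slices equal to products of factors 1 - a^j t^j; its mean over
    j <= N has, besides the constant term 1, O(N) coefficients of size O(1/N)
    in degrees O(N), so it is bounded for alpha = 1 ([annihilates_one]).

    For larger alpha let n and m be the degrees of p in z1 and z2, and let p* be
    the reflection of p, equal to z1^n z2^m times the conjugate of p on the
    torus. As p is irreducible, either the ideal of p and p* contains a nonzero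
    polynomial in z1 and one in z2, or p divides p* and is not constant
    ([ideal_or_dvd], [transversal_or_torus_over]).

    In the first case p has finitely many zeros on the torus, because p* vanishes
    with p there. On the slices p*^k / p is, up to a constant, a product of
    functions (t - conj a)^k / (1 - a t), whose j-th coefficients are O(j^-k)
    uniformly in |a| <= 1; thus p*^k is a weak limit of multiples of p, for k large, and
    F kills p*^k ([annihilates_reflect_pow]). It follows that F kills a power
    of each of the two one-variable polynomials. If F is nonzero, some multiple
    of F is a common eigenvector of the two multiplications, that is, a
    multiple of the evaluation at a zero (x, y) of p. Boundedness forces
    |x| <= 1 and |y| <= 1, Hurwitz' argument excludes all points except those of
    the torus, and there evaluation is unbounded when alpha <= 2. So p is cyclic
    if alpha <= 2 or if p has no zero on the torus ([transversal_cyclic]).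

    In the second case, for each x in the circle the zeros of p(x, .) are
    symmetric in the circle and none lies inside, so one of them, y(x), lies on
    it (up to exchanging the variables). So p has infinitely many zeros on the
    torus. A limit F of the means of q(x, y(x)) over the N-th roots of unity x
    annihilates p, and F(1) = 1. By Bessel's inequality the sum over k of
    |F(z1^k z2^l)|^2 is at most 1 for each l, so F is bounded as soon as
    alpha > 1 ([torus_over_functional]).

    Finally, if alpha > 2 then evaluation at any point of the torus is bounded
    ([annihilates_peval]). *)

Set Implicit Arguments.
Unset Strict Implicit.
Unset Printing Implicit Defensive.

Import Order.TTheory GRing.Theory Num.Theory.
Import numFieldNormedType.Exports.
Import ComplexField.Normc.

Local Open Scope classical_set_scope.
Local Open Scope ring_scope.
Local Open Scope complex_scope.

(** * The real-valued modulus of a complex number *)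

Section Normc_theory.
Variable R : realType.
Local Notation C := R[i].
Implicit Types x y z : C.

Lemma normE x : `|x| = (normc x)%:C.
Proof. by case: x. Qed.

Lemma normc_ge0 x : 0 <= normc x.
Proof. by rewrite -ler0c -normE. Qed.

Lemma normc_gt0 x : (0 < normc x) = (x != 0).
Proof. by rewrite -ltcR -normE normr_gt0. Qed.

Lemma normc_triangle x y : normc (x + y) <= normc x + normc y.
Proof. exact: le_normcD. Qed.

Lemma normc_opp x : normc (- x) = normc x.
Proof. exact: normcN. Qed.

Lemma normc_subr x y : normc (x - y) = normc (y - x).
Proof. by rewrite -normc_opp opprB. Qed.

Lemma normcX x n : normc (x ^+ n) = normc x ^+ n.
Proof. by elim: n => [|n IH]; rewrite ?normc1// !exprS normcM IH. Qed.

Lemma normc_conj x : normc x^*%C = normc x.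
Proof. by case: x => a b /=; rewrite sqrrN. Qed.

Lemma normc_real (a : R) : normc a%:C = `|a|.
Proof. by rewrite /= expr0n /= addr0 sqrtr_sqr. Qed.

Lemma normc_nat n : normc n%:R = n%:R :> R.
Proof. by rewrite -(rmorph_nat (real_complex R)) normc_real normr_nat. Qed.

Lemma sqr_normcE x : normc x ^+ 2 = complex.Re x ^+ 2 + complex.Im x ^+ 2.
Proof. by case: x => a b /=; rewrite sqr_sqrtr// addr_ge0 ?sqr_ge0. Qed.

Lemma sqr_normc_conj x : (normc x ^+ 2)%:C = x * x^*%C.
Proof. by rewrite -sqr_normc normE rmorphXn. Qed.

Lemma normc_sum (I : Type) (r : seq I) (P : pred I) (F : I -> C) :
  normc (\sum_(i <- r | P i) F i) <= \sum_(i <- r | P i) normc (F i).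
Proof.
elim/big_rec2: _ => [|i u v _ le_uv]; first by rewrite normc0.
by apply: (le_trans (normc_triangle _ _)); rewrite lerD2l.
Qed.

Lemma normc_prod (I : Type) (r : seq I) (P : pred I) (F : I -> C) :
  normc (\prod_(i <- r | P i) F i) = \prod_(i <- r | P i) normc (F i).
Proof. by apply: (big_morph _ (@normcM R) (@normc1 R)). Qed.

Lemma normc_lt1 x : (`|x| < 1) = (normc x < 1).
Proof. by rewrite normE -[RHS]ltcR rmorph1. Qed.

Lemma normc_eq1 x : (`|x| = 1) <-> (normc x = 1).
Proof.
rewrite normE; split => [|->]; last by rewrite rmorph1.
by rewrite -(rmorph1 (real_complex R)) => /complexI.
Qed.

Lemma normc_unit_conj x : normc x = 1 -> x^*%C = x^-1.
Proof.
move=> x1; have x0 : x != 0 by rewrite -normc_gt0 x1.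
by apply: (mulfI x0); rewrite -sqr_normc_conj x1 expr1n rmorph1 mulfV.
Qed.

Lemma normc_unit_neq0 x : normc x = 1 -> x != 0.
Proof. by move=> x1; rewrite -normc_gt0 x1. Qed.

Lemma normc_le_Re_Im x : normc x <= `|complex.Re x| + `|complex.Im x|.
Proof.
rewrite -(@ler_pXn2r _ 2) ?nnegrE ?normc_ge0 ?addr_ge0//.
rewrite sqr_normcE sqrrD !real_normK ?num_real//.
by rewrite -addrA lerD2l lerDr mulrn_wge0// mulr_ge0.
Qed.

Lemma Re_le_normc x : `|complex.Re x| <= normc x.
Proof. by rewrite -lecR -normE; exact: normc_ge_Re. Qed.

Lemma Im_le_normc x : `|complex.Im x| <= normc x.
Proof.
rewrite -(@ler_pXn2r _ 2) ?nnegrE ?normc_ge0//.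
by rewrite real_normK ?num_real// sqr_normcE lerDr sqr_ge0.
Qed.

End Normc_theory.

(** * Discrete Fourier analysis on the unit circle *)

Section Fourier.
Variable R : realType.
Local Notation C := R[i].

Lemma ex_prim_root n : (0 < n)%N -> exists z : C, n.-primitive_root z.
Proof.
move=> n_gt0; pose p : {poly C} := 'X^n - 1.
have [r Dp] := closed_field_poly_normal p.
rewrite (monicP _) ?monicXnsubC // scale1r in Dp.
have rn1 : all n.-unity_root r by apply/allP=> z; rewrite -root_prod_XsubC -Dp.
have sz_r : (n < (size r).+1)%N.
  by rewrite -(size_prod_XsubC r id) -Dp size_XnsubC.
have [|z] := hasP (has_prim_root n_gt0 rn1 _ sz_r); last by exists z.
by rewrite -separable_prod_XsubC -Dp separable_Xn_sub_1 // pnatr_eq0 -lt0n.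
Qed.

Lemma prim_root_normc n (z : C) : n.-primitive_root z -> normc z = 1.
Proof.
move=> zP; have /(congr1 (@normc R)) := prim_expr_order zP.
rewrite normcX normc1 => /eqP.
by rewrite pexpr_eq1 ?normc_ge0 ?(prim_order_gt0 zP) // => /eqP.
Qed.

Lemma sum_geom_unity (u : C) n : u ^+ n = 1 ->
  \sum_(j < n) u ^+ j = if u == 1 then n%:R else 0.
Proof.
move=> un1; case: eqP => [->|/eqP u1].
  by under eq_bigr do rewrite expr1n; rewrite sumr_const card_ord.
apply/eqP; have /eqP := subrX1 u n.
by rewrite un1 subrr eq_sym mulf_eq0 subr_eq0 (negbTE u1).
Qed.

(** By orthogonality of the characters of the group of n-th roots of unity.
    Means over these roots play the role of integrals over the circle. *)
Lemma parseval n (z : C) (q : {poly C}) :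
  n.-primitive_root z -> (size q <= n)%N ->
  \sum_(j < n) normc q.[z ^+ j] ^+ 2 = n%:R * \sum_(i < n) normc q`_i ^+ 2.
Proof.
move=> zP szq; have z1 := prim_root_normc zP.
have z0 := normc_unit_neq0 z1.
apply: (@complexI R); rewrite rmorphM rmorph_nat !rmorph_sum /= mulr_sumr.
under eq_bigr => j _.
  rewrite sqr_normc_conj (horner_coef_wide _ szq) rmorph_sum mulr_suml.
  under eq_bigr => i _.
    rewrite mulr_sumr.
    under eq_bigr => k _.
      rewrite rmorphM /= rmorphXn /= rmorphXn /= (normc_unit_conj z1).
      rewrite mulrACA -exprM -exprM !(mulnC j) !exprM -exprMn.
      over.
    over.
  over.
rewrite exchange_big; apply: eq_bigr => i _.
rewrite exchange_big (bigD1 i) //= [X in _ + X]big1 ?addr0 => [|k ki].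
  rewrite -mulr_sumr sum_geom_unity -exprMn mulfV// ?expr1n// eqxx.
  by rewrite sqr_normc_conj mulrC.
rewrite -mulr_sumr sum_geom_unity; last first.
  by rewrite exprMn -!exprM !(mulnC _ n) !exprM exprVn (prim_expr_order zP) invr1 !expr1n mulr1.
case: eqP; last by rewrite mulr0.
move=> /(congr1 ( *%R^~ (z ^+ k))); rewrite exprVn mulfVK ?expf_neq0// mul1r.
move/eqP; rewrite (eq_prim_root_expr zP) !modn_small ?ltn_ord//.
by move/eqP/val_inj => ik; rewrite ik eqxx in ki.
Qed.

(** All n-th roots of unity lie on the circle, so a bound there bounds the mean
    in Parseval's identity. *)
Lemma bessel (q : {poly C}) B :
    (forall w, normc w = 1 -> normc q.[w] <= B) ->
  forall n, \sum_(i < n) normc q`_i ^+ 2 <= B ^+ 2.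
Proof.
move=> qB n; pose m := maxn n (size q).+1.
have m0 : (0 < m)%N by rewrite /m; lia.
have [z zP] := ex_prim_root m0.
have B0 : 0 <= B by apply: le_trans (qB 1 (@normc1 R)); exact: normc_ge0.
have szq : (size q <= m)%N by rewrite /m; lia.
apply: (@le_trans _ _ (\sum_(i < m) normc q`_i ^+ 2)).
  rewrite -!(big_mkord xpredT (fun i => normc q`_i ^+ 2)).
  rewrite (big_cat_nat (leq0n n) (leq_maxl _ _ : (n <= m)%N)) /= lerDl sumr_ge0//.
  by move=> i _; rewrite sqr_ge0.
rewrite -(ler_pM2l (_ : 0 < m%:R)) ?ltr0n// -(parseval zP szq).
apply: (@le_trans _ _ (\sum_(j < m) B ^+ 2)); last first.
  by rewrite sumr_const card_ord mulr_natl.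
apply: ler_sum => j _; rewrite ler_pXn2r ?nnegrE ?normc_ge0//.
by apply: qB; rewrite normcX (prim_root_normc zP) expr1n.
Qed.

Lemma coef_le_sup (q : {poly C}) B :
    (forall w, normc w = 1 -> normc q.[w] <= B) ->
  forall i, normc q`_i <= B.
Proof.
move=> qB i; have := bessel qB i.+1; rewrite big_ord_recr /= => qi.
have B0 : 0 <= B by apply: le_trans (qB 1 (@normc1 R)); exact: normc_ge0.
rewrite -(@ler_pXn2r _ 2) ?nnegrE ?normc_ge0//; apply: le_trans qi.
by rewrite lerDr sumr_ge0// => j _; rewrite sqr_ge0.
Qed.

Lemma poly_eq_circle (q r : {poly C}) :
  (forall w, normc w = 1 -> q.[w] = r.[w]) -> q = r.
Proof.
move=> qr; apply/eqP; rewrite -subr_eq0; apply/eqP/polyP => i.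
rewrite coef0; apply: (@eq0_normc R); apply/le_anti.
rewrite normc_ge0 andbT; apply: coef_le_sup => w w1.
by rewrite !hornerE qr// subrr normc0.
Qed.

Lemma poly_eq_disk (q r : {poly C}) :
  (forall w, normc w < 1 -> q.[w] = r.[w]) -> q = r.
Proof.
move=> qr; have h0 : (2%:R^-1 : C) != 0 by rewrite invr_neq0// pnatr_eq0.
have : q \Po (2%:R^-1 *: 'X) = r \Po (2%:R^-1 *: 'X).
  apply: poly_eq_circle => w w1; rewrite !horner_comp; apply: qr.
  rewrite !hornerE normcM w1 mulr1 normcV normc_nat.
  by rewrite invf_lt1 ?ltr1n.
move=> /(congr1 (comp_poly (2%:R *: 'X))); rewrite -!comp_polyA comp_polyZ comp_polyX.
by rewrite scalerA mulVf ?pnatr_eq0// scale1r !comp_polyXr.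
Qed.

End Fourier.

(** * Polynomials of one variable without zeros in the disk *)

Section OneVariable.
Variable R : realType.
Local Notation C := R[i].

(** Normalising the roots to 1/a rather than a root w = 1/a of unbounded size
    puts all parameters in the closed disk; the degree deficit with respect to N
    is filled with a = 0. *)
Lemma factor_disk_free N (f : {poly C}) : (size f <= N.+1)%N ->
    (forall t, normc t < 1 -> f.[t] != 0) ->
  exists s : seq C, [/\ size s = N, {in s, forall a, normc a <= 1} &
    f = f.[0] *: \prod_(a <- s) (1 - a *: 'X)].
Proof.
move=> szf f0; have f00 : f.[0] != 0 by apply: f0; rewrite normc0 ltr01.
have fn0 : f != 0 by apply: contraNneq f00 => ->; rewrite horner0.
have [r Dr] := closed_field_poly_normal f.
have lc0 : lead_coef f != 0 by rewrite lead_coef_eq0.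
have r1 : {in r, forall w, 1 <= normc w}.
  move=> w wr; rewrite leNgt; apply/negP => /f0; rewrite Dr hornerZ mulf_eq0.
  by rewrite negb_or -rootE root_prod_XsubC wr andbF.
have r0 : {in r, forall w, w != 0}.
  by move=> w /r1 w1; rewrite -normc_gt0; apply: lt_le_trans w1.
have szr : (size r <= N)%N.
  by have := szf; rewrite Dr size_scale// size_prod_XsubC ltnS.
exists ([seq w^-1 | w <- r] ++ nseq (N - size r) 0); split.
- by rewrite size_cat size_map size_nseq subnKC.
- move=> a; rewrite mem_cat => /orP[/mapP[w wr ->]|].
    by rewrite normcV invf_le1 ?r1// normc_gt0 r0.
  by rewrite mem_nseq => /andP[_ /eqP ->]; rewrite normc0 ler01.
rewrite big_cat /= [X in _ *: (_ * X)]big1_seq ?mulr1; last first.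
  by move=> a /=; rewrite mem_nseq => /andP[_ /eqP ->]; rewrite scale0r subr0.
rewrite big_map [f in RHS]Dr hornerZ horner_prod -scalerA [LHS]Dr; congr (_ *: _).
rewrite -scaler_prod; rewrite big_seq [RHS]big_seq; apply: eq_bigr => w wr.
have -> : ('X - w%:P).[0] = - w by rewrite !hornerE.
rewrite scalerBr scalerA mulNr mulfV ?r0// scaleN1r opprK addrC.
by rewrite -alg_polyC scaleNr.
Qed.

(** The polynomial z^N conj(f(1 / conj z)), when f has degree at most N. *)
Definition reflect_poly N (f : {poly C}) : {poly C} :=
  \poly_(i < N.+1) (f`_(N - i))^*%C.

Lemma horner_reflect N (f : {poly C}) w : (size f <= N.+1)%N -> w != 0 ->
  (reflect_poly N f).[w] = w ^+ N * (f.[(w^*%C)^-1])^*%C.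
Proof.
move=> szf w0; rewrite horner_poly (horner_coef_wide _ szf).
rewrite rmorph_sum mulr_sumr /= (reindex_inj rev_ord_inj) /=.
apply: eq_bigr => i _; rewrite subSS subKn -1?ltnS//.
rewrite rmorphM rmorphXn /= conjc_inv conjcK mulrCA; congr (_ * _).
have iN : (i <= N)%N by rewrite -ltnS.
by rewrite exprVn -[in w ^+ N](subnK iN) exprD mulfK// expf_neq0.
Qed.

Lemma horner_reflect_unit N (f : {poly C}) w : (size f <= N.+1)%N ->
  normc w = 1 -> (reflect_poly N f).[w] = w ^+ N * (f.[w])^*%C.
Proof.
move=> szf w1; rewrite horner_reflect ?normc_unit_neq0//.
by rewrite (normc_unit_conj w1) invrK.
Qed.

Lemma reflect_prod (c : C) (s : seq C) :
  reflect_poly (size s) (c *: \prod_(a <- s) (1 - a *: 'X)) =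
  c^*%C *: \prod_(a <- s) ('X - (a^*%C)%:P).
Proof.
apply: poly_eq_circle => w w1; have w0 := normc_unit_neq0 w1.
rewrite horner_reflect_unit//; last first.
  apply: leq_trans (size_scale_leq _ _) _.
  elim: s => [|a s IH]; first by rewrite big_nil size_poly1.
  rewrite big_cons; apply: leq_trans (size_polyMleq _ _) _.
  have : (size ((1 - a *: 'X)%R : {poly C}) <= 2)%N.
    rewrite (leq_trans (size_polyD _ _))// geq_max size_poly1 size_polyN.
    by rewrite (leq_trans (size_scale_leq _ _))// size_polyX.
  by move: IH => /=; set u := size _; set v := size _; lia.
rewrite !hornerZ rmorphM /= mulrCA; congr (_ * _).
rewrite !horner_prod rmorph_prod; elim: s => [|a s IH].
  by rewrite !big_nil mulr1.
rewrite !big_cons -IH /= !hornerE rmorphB rmorph1 rmorphM /= exprS.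
rewrite [in LHS](normc_unit_conj w1) (mulrAC w); congr (_ * _ * _).
by rewrite mulrBr mulr1 mulrCA mulfV// mulr1.
Qed.

Definition wsum s n (q : {poly C}) : R :=
  \sum_(j < n) j.+1%:R ^+ s * normc q`_j.

Lemma wsum_ge0 s n q : 0 <= wsum s n q.
Proof. by apply: sumr_ge0 => j _; rewrite mulr_ge0// ?exprn_ge0 ?normc_ge0. Qed.

Lemma conv_sum_le n (A B : nat -> R) :
    (forall i, 0 <= A i) -> (forall i, 0 <= B i) ->
  \sum_(j < n) \sum_(i < j.+1) A i * B (j - i)%N <=
  (\sum_(i < n) A i) * (\sum_(i < n) B i).
Proof.
move=> A0 B0; pose P := \poly_(i < n) A i; pose Q := \poly_(i < n) B i.
have evalE (u : nat -> R) : \sum_(i < n) u i = (\poly_(i < n) u i).[1].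
  by rewrite horner_poly; apply: eq_bigr => i _; rewrite expr1n mulr1.
have szPQ : (size (P * Q)%R <= n + n)%N.
  apply: leq_trans (size_polyMleq _ _) _.
  by have := size_poly n A; have := size_poly n B; rewrite -/P -/Q; lia.
rewrite !evalE -hornerM (horner_coef_wide _ szPQ) big_split_ord /=.
apply: ler_wpDr.
  apply: sumr_ge0 => j _; rewrite expr1n mulr1 coefM; apply: sumr_ge0 => i _.
  by rewrite mulr_ge0// coef_poly; case: ifP.
apply: ler_sum => j _; rewrite expr1n mulr1 coefM le_eqVlt; apply/orP; left.
apply/eqP/eq_bigr => i _; rewrite !coef_poly.
by have := ltn_ord i; have := ltn_ord j => jn ij; rewrite !ifT//; lia.
Qed.

(** The weight is submultiplicative: i + j + 1 <= (i + 1)(j + 1). *)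
Lemma wsumM s n q r : wsum s n (q * r) <= wsum s n q * wsum s n r.
Proof.
pose A (u : {poly C}) i : R := i.+1%:R ^+ s * normc u`_i.
have A0 u i : 0 <= A u i by rewrite mulr_ge0// ?exprn_ge0 ?normc_ge0.
apply: le_trans (conv_sum_le n (A0 q) (A0 r)).
apply: ler_sum => j _; rewrite coefM.
apply: (@le_trans _ _ (j.+1%:R ^+ s * \sum_(i < j.+1) normc (q`_i * r`_(j - i)))).
  by rewrite ler_wpM2l ?exprn_ge0// normc_sum.
rewrite mulr_sumr; apply: ler_sum => i _; rewrite normcM /A mulrACA.
rewrite ler_wpM2r ?mulr_ge0 ?normc_ge0// -exprMn lerXn2r ?nnegrE ?mulr_ge0//.
by rewrite -natrM ler_nat; have := ltn_ord i; nia.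
Qed.

Lemma wsum1 s n : wsum s n 1 <= 1.
Proof.
case: n => [|n]; first by rewrite /wsum big_ord0.
rewrite /wsum big_ord_recl /= big1 ?addr0; last first.
  by move=> j _; rewrite coef1 mulr0n normc0 mulr0.
by rewrite expr1n coef1 eqxx normc1 mulr1.
Qed.

Lemma wsum_prod s n (I : eqType) (r : seq I) (F : I -> {poly C}) B :
    {in r, forall i, wsum s n (F i) <= B} ->
  wsum s n (\prod_(i <- r) F i) <= B ^+ size r.
Proof.
elim: r => [|i r IH] FB; first by rewrite big_nil wsum1.
rewrite big_cons exprS (le_trans (wsumM _ _ _ _))// ler_pM ?wsum_ge0//.
  by apply: FB; rewrite mem_head.
by apply: IH => k kr; apply: FB; rewrite in_cons kr orbT.
Qed.

Lemma coef_le_wsum s n (q : {poly C}) j : (j < n)%N ->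
  j.+1%:R ^+ s * normc q`_j <= wsum s n q.
Proof.
move=> jn; rewrite /wsum (bigD1 (Ordinal jn)) //= lerDl sumr_ge0// => i _.
by rewrite mulr_ge0// ?exprn_ge0 ?normc_ge0.
Qed.

(** The expansion of 1 / (1 - a X) to order n. *)
Definition geom_poly n (a : C) : {poly C} := \poly_(j < n) a ^+ j.

Lemma geom_polyE n a : (1 - a *: 'X) * geom_poly n a = 1 - (a ^+ n) *: 'X^n.
Proof.
apply: poly_eq_circle => w _; rewrite !hornerE horner_poly.
under eq_bigr => i _ do rewrite -exprMn.
by rewrite -[LHS]opprK -mulNr opprB -subrX1 opprB exprMn.
Qed.

(** From index k on, multiplication by X - conj a acts on a geometric sequence
    of ratio a as multiplication by 1 / a - conj a. *)
Lemma blaschke_coef n a k j : (k <= j < n)%N ->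
  (('X - (a^*%C)%:P) ^+ k * geom_poly n a)`_j =
  a ^+ (j - k) * (1 - a * a^*%C) ^+ k.
Proof.
elim: k j => [|k IH] j /andP[kj jn].
  by rewrite !expr0 mul1r mulr1 subn0 coef_poly jn.
rewrite exprS -mulrA mulrBl coefB coefXM coefCM.
rewrite -[in X in X - _](prednK (leq_ltn_trans (leq0n k) kj)) /=.
rewrite !IH; try lia.
have -> : (j - k = (j - k.+1).+1)%N by lia.
have -> : (j.-1 - k = j - k.+1)%N by lia.
by rewrite !exprS; ring.
Qed.

Lemma blaschke_coef_le n a k j : normc a <= 1 -> (j < n)%N ->
  normc (('X - (a^*%C)%:P) ^+ k * geom_poly n a)`_j <= 2 ^+ k.
Proof.
move=> a1; elim: k j => [|k IH] j jn.
  by rewrite !expr0 mul1r coef_poly jn normcX exprn_ile1 ?normc_ge0.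
rewrite !exprS -mulrA mulrBl coefB coefXM coefCM.
apply: (le_trans (normc_triangle _ _)).
rewrite normc_opp normcM normc_conj mulr2n mulrDl !mul1r lerD//.
  by case: eqP => _; rewrite ?normc0 ?exprn_ge0 ?IH//; lia.
by rewrite -[leRHS]mul1r ler_pM ?normc_ge0 ?IH.
Qed.

(** Each of the k + 1 factors 1 - x absorbs a power x^i with i close to
    m / (k + 1), as (1 - x)(i + 1) x^i <= (1 - x)(1 + x + ... + x^i) <= 1. *)
Lemma pow_decay (x : R) k m : 0 <= x <= 1 ->
  x ^+ m * (1 - x) ^+ k.+1 * m.+1%:R ^+ k.+1 <= k.+1%:R ^+ k.+1.
Proof.
move=> /andP[x0 x1]; pose i := (m %/ k.+1)%N.
have mi : (m.+1 <= i.+1 * k.+1)%N by rewrite /i; nia.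
have step : (1 - x) * (x ^+ i * i.+1%:R) <= 1.
  have : 1 - x ^+ i.+1 = (1 - x) * \sum_(j < i.+1) x ^+ j.
    by rewrite -opprB subrX1 -mulNr opprB.
  move=> E; apply: (@le_trans _ _ ((1 - x) * \sum_(j < i.+1) x ^+ j)).
    rewrite ler_wpM2l ?subr_ge0// mulr_natr -[X in _ *+ X]card_ord -sumr_const.
    by apply: ler_sum => j _; rewrite ler_wiXn2l// -ltnS.
  by rewrite -E lerBlDr lerDl exprn_ge0.
apply: (@le_trans _ _ (((1 - x) * (x ^+ i * i.+1%:R)) ^+ k.+1 * k.+1%:R ^+ k.+1)).
  rewrite !exprMn -exprM.
  have -> (u v w y : R) : u * (v * w) * y = v * u * (w * y) by ring.
  rewrite ler_pM ?mulr_ge0 ?exprn_ge0 ?subr_ge0//.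
    by rewrite ler_wpM2r ?exprn_ge0 ?subr_ge0// ler_wiXn2l// /i; exact: leq_trunc_div.
  by rewrite -exprMn lerXn2r ?nnegrE ?mulr_ge0// -natrM ler_nat.
rewrite -[leRHS]mul1r ler_wpM2r ?exprn_ge0// exprn_ile1//.
by rewrite mulr_ge0 ?subr_ge0// mulr_ge0// exprn_ge0.
Qed.

(** By comparison with a telescoping sum. *)
Lemma sum_inv_sqr n : \sum_(j < n) (j.+1%:R ^+ 2)^-1 <= 2 :> R.
Proof.
case: n => [|n]; first by rewrite big_ord0.
apply: (@le_trans _ _ (2 - (n.+1%:R)^-1)); last by rewrite lerBlDr lerDl.
elim: n => [|n IH]; first by rewrite big_ord1 expr1n invr1; lra.
rewrite big_ord_recr /=; apply: le_trans (lerD IH (lexx _)) _.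
have a0 : 0 < n.+1%:R :> R by rewrite ltr0n.
have -> : n.+2%:R = n.+1%:R + 1 :> R by rewrite -natr1.
move: (n.+1%:R : R) a0 => a a0; have a1 : 0 < a + 1 by lra.
rewrite -subr_ge0.
have -> : 2 - (a + 1)^-1 - (2 - a^-1 + ((a + 1) ^+ 2)^-1) = (a * (a + 1) ^+ 2)^-1.
  by field; rewrite ?gt_eqF.
by rewrite invr_ge0 mulr_ge0 ?exprn_ge0// ltW.
Qed.

(** The coefficient of index j is O(j^-(s + 2)) uniformly in a, both inside the
    disk and on its boundary, so that the sum of weight j^s converges. *)
Lemma wsum_blaschke s : exists B, forall n (a : C), normc a <= 1 ->
  wsum s n (('X - (a^*%C)%:P) ^+ s.+2 * geom_poly n a) <= B.
Proof.
have [k kE] : exists k, k = s.+2 by eexists.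
pose D : R := 2 ^+ k * (k%:R * k.+1%:R) ^+ k.
have D0 : 0 <= D by rewrite mulr_ge0// exprn_ge0// mulr_ge0.
exists (D * 2) => n a a1; rewrite -kE.
apply: (@le_trans _ _ (\sum_(j < n) D * (j.+1%:R ^+ 2)^-1)); last first.
  by rewrite -mulr_sumr ler_wpM2l// sum_inv_sqr.
apply: ler_sum => j _; have jn := ltn_ord j.
rewrite ler_pdivlMr ?exprn_gt0// mulrAC -exprD addn2 -kE.
have [jk|kj] := ltnP j k.
  rewrite mulrC; apply: ler_pM; rewrite ?normc_ge0 ?exprn_ge0//.
    exact: blaschke_coef_le.
  by rewrite lerXn2r ?nnegrE ?mulr_ge0// -natrM ler_nat; nia.
rewrite blaschke_coef ?kj// normcM !normcX.
have x0 := normc_ge0 a; have y0 : 0 <= 1 - normc a by lra.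
have -> : normc (1 - a * a^*%C) = (1 - normc a) * (1 + normc a).
  rewrite -sqr_normc_conj -[1](rmorph1 (real_complex R)) -rmorphB normc_real.
  by rewrite ger0_norm; nra.
have := @pow_decay (normc a) s.+1 (j - k) (introT andP (conj x0 a1)).
rewrite -kE; move: (normc a) x0 y0 a1 => x x0 y0 x1 pd.
apply: (@le_trans _ _ (((j - k).+1%:R * k.+1%:R) ^+ k *
    (x ^+ (j - k) * ((1 - x) ^+ k * 2 ^+ k)))).
  apply: ler_pM.
  - by rewrite exprn_ge0.
  - by rewrite mulr_ge0 ?exprn_ge0// mulr_ge0// addr_ge0.
  - by rewrite lerXn2r ?nnegrE ?mulr_ge0// -natrM ler_nat; nia.
  rewrite exprMn ler_wpM2l ?exprn_ge0// ler_wpM2l ?exprn_ge0//.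
  by clear -x0 y0; rewrite lerXn2r ?nnegrE; lra.
have -> : ((j - k).+1%:R * k.+1%:R) ^+ k * (x ^+ (j - k) * ((1 - x) ^+ k * 2 ^+ k))
  = (x ^+ (j - k) * (1 - x) ^+ k * (j - k).+1%:R ^+ k) * (2 ^+ k * k.+1%:R ^+ k) :> R.
  by rewrite exprMn; move: (_ ^+ k) (x ^+ _) ((1 - x) ^+ k) (2 ^+ k) (k.+1%:R ^+ k) => *; ring.
rewrite /D exprMn [leRHS]mulrCA ler_wpM2r// mulr_ge0 ?exprn_ge0//.
Qed.

End OneVariable.

Section OneVariableBounds.
Variable R : realType.
Local Notation C := R[i].
Implicit Types (f E : {poly C}) (s : seq C).

Lemma coef_mulr_mod n (u v w : {poly C}) : (forall j, (j < n)%N -> u`_j = v`_j) ->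
  forall j, (j < n)%N -> (w * u)`_j = (w * v)`_j.
Proof.
move=> uv j jn; rewrite !coefM; apply: eq_bigr => i _; rewrite uv//.
by apply: leq_ltn_trans jn; rewrite leq_subr.
Qed.

(** Division by f is triangular, since f has a nonzero constant term. *)
Lemma coef_divr_mod n f (u v : {poly C}) : f`_0 != 0 ->
    (forall j, (j < n)%N -> (f * u)`_j = (f * v)`_j) ->
  forall j, (j < n)%N -> u`_j = v`_j.
Proof.
move=> f0 fuv; elim/ltn_ind => j IH jn; have := fuv j jn.
rewrite !coefM !big_ord_recl !subn0 /= => E; apply: (mulfI f0).
move: E; rewrite [X in _ + X = _](eq_bigr (fun i : 'I_j => f`_(bump 0 i) * v`_(j - bump 0 i))).
  by move/addIr.
move=> i _; rewrite IH//; have := ltn_ord i; rewrite /bump /=; lia.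
Qed.

Lemma prod_geom_mod s n j : (j < n)%N ->
  (\prod_(a <- s) (1 - (a ^+ n) *: 'X^n))`_j = (1 : {poly C})`_j.
Proof.
move=> jn; elim: s j jn => [|a s IH] j jn; first by rewrite big_nil.
rewrite big_cons mulrC; have := @coef_mulr_mod n (1 - (a ^+ n) *: 'X^n) 1.
move=> -> //; first by rewrite mulr1 IH.
by move=> i it; rewrite coefB coefZ coefXn (ltn_eqF it) mulr0 subr0.
Qed.

Lemma wsumZ t n (c : C) f : wsum t n (c *: f) = normc c * wsum t n f.
Proof.
by rewrite /wsum mulr_sumr; apply: eq_bigr => i _; rewrite coefZ normcM mulrCA.
Qed.

Lemma eq_wsum t n f (g : {poly C}) : (forall j, (j < n)%N -> f`_j = g`_j) ->
  wsum t n f = wsum t n g.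
Proof. by move=> fg; apply: eq_bigr => j _; rewrite fg. Qed.

(** Near a point of the circle where f vanishes, the reflection of f is as
    small as f, so that a power of the reflection divided by f is smooth up to
    the boundary, with bounds depending only on the degree and on f(0). *)
Lemma wsum_reflect_div t N (c : C) : c != 0 -> exists B, forall f E n,
    (size f <= N.+1)%N -> (forall z, normc z < 1 -> f.[z] != 0) -> f.[0] = c ->
    (forall j, (j < n)%N -> (f * E)`_j = (1 : {poly C})`_j) ->
  wsum t n (reflect_poly N f ^+ t.+2 * E) <= B.
Proof.
move=> c0; have [B wB] := wsum_blaschke R t.
exists (normc ((c^*%C) ^+ t.+2 / c) * B ^+ N) => f E n szf fd fc fE.
have [s [szs s1 fs]] := factor_disk_free szf fd.
have fs' : reflect_poly N f = c^*%C *: \prod_(a <- s) ('X - (a^*%C)%:P).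
  by rewrite fs fc -szs reflect_prod.
pose P := \prod_(a <- s) (('X - (a^*%C)%:P) ^+ t.+2 * geom_poly n a).
rewrite (@eq_wsum _ _ _ ((c^*%C ^+ t.+2 / c) *: P)).
  rewrite wsumZ ler_wpM2l ?normc_ge0// -szs.
  by apply: wsum_prod => a /s1; exact: wB.
apply: (@coef_divr_mod _ f); first by rewrite -horner_coef0 fc.
move=> j jn; rewrite mulrCA (coef_mulr_mod _ fE)// mulr1.
have cd : c * (c^*%C ^+ t.+2 / c) = c^*%C ^+ t.+2 by rewrite mulrC divfK.
move: (c^*%C ^+ t.+2 / c) cd => d cd.
have -> : f * (d *: P) =
    reflect_poly N f ^+ t.+2 * \prod_(a <- s) (1 - (a ^+ n) *: 'X^n).
  rewrite fs' fs fc /P; move: t.+2 cd => k cd.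
  rewrite exprZn -!scalerAl -scalerAr scalerA cd; congr (_ *: _).
  rewrite big_split /= prodrXl mulrCA; congr (_ * _).
  by rewrite -big_split; apply: eq_bigr => a _; exact: geom_polyE.
by rewrite (coef_mulr_mod _ (@prod_geom_mod s n))// mulr1.
Qed.

Lemma coef_prod_le s : {in s, forall a, normc a <= 1} ->
  forall i, normc (\prod_(a <- s) (1 - a *: 'X))`_i <=
    2 ^+ size s * (i <= size s)%:R.
Proof.
elim: s => [|a s IH] s1 i.
  rewrite big_nil expr0 mul1r leqn0 coef1.
  by case: eqP; rewrite ?normc1 ?normc0.
have {}IH : forall i, normc (\prod_(a <- s) (1 - a *: 'X))`_i <= 2 ^+ size s * (i <= size s)%:R.
  by apply: IH => b bs; apply: s1; rewrite in_cons bs orbT.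
have a1 : normc a <= 1 by apply: s1; rewrite mem_head.
rewrite big_cons mulrBl mul1r coefB -scalerAl coefZ coefXM.
apply: (le_trans (normc_triangle _ _)).
rewrite normc_opp normcM exprS mulr2n mulrDl mul1r mulrDl lerD//.
  apply: le_trans (IH i) _; rewrite ler_wpM2l ?exprn_ge0// ler_nat.
  by case: (leqP i (size s)) => [/leqW ->|_].
case: eqP => [_|/eqP i0]; first by rewrite normc0 mulr0 mulr_ge0 ?exprn_ge0.
rewrite -(prednK (_ : 0 < i)%N) ?lt0n//=.
by rewrite ltnS -[leRHS]mul1r ler_pM ?normc_ge0.
Qed.

(** The product is a polynomial of degree at most the size of s in X^(j+1). *)
Lemma coef_prod_dilate_le s j d : {in s, forall a, normc a <= 1} ->
  normc (\prod_(a <- s) (1 - a ^+ j.+1 *: 'X^(j.+1)))`_d <=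
    2 ^+ size s * \sum_(i < (size s).+1) (d == i * j.+1)%N%:R.
Proof.
move=> s1.
have -> : \prod_(a <- s) (1 - a ^+ j.+1 *: 'X^(j.+1)) =
    (\prod_(a <- [seq a ^+ j.+1 | a <- s]) (1 - a *: 'X)) \Po 'X^(j.+1) :> {poly C}.
  rewrite rmorph_prod /= big_map; apply: eq_bigr => a _.
  by rewrite rmorphB rmorph1 /= comp_polyZ comp_polyX.
rewrite coef_comp_poly_Xn//; case: ifP => [/dvdnP[i ->]|_]; last first.
  by rewrite normc0 mulr_ge0 ?exprn_ge0// sumr_ge0.
rewrite mulnK//; apply: le_trans (coef_prod_le _ i) _.
  by move=> _ /mapP[a /s1 a1 ->]; rewrite normcX exprn_ile1 ?normc_ge0.
rewrite size_map ler_wpM2l ?exprn_ge0//; case: leqP => [is_|_]; last exact: sumr_ge0.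
by rewrite (bigD1 (inord i)) //= inordK// eqxx lerDl sumr_ge0.
Qed.

Definition dilate_mean n s : {poly C} :=
  (n%:R^-1) *: \sum_(j < n) \prod_(a <- s) (1 - a ^+ j.+1 *: 'X^(j.+1)).

Lemma dilate_mean0 n s : (0 < n)%N -> (dilate_mean n s)`_0 = 1.
Proof.
move=> n0; rewrite coefZ -horner_coef0 horner_sum.
rewrite (eq_bigr (fun=> 1)) ?sumr_const ?card_ord ?mulVf ?pnatr_eq0 -?lt0n//.
move=> j _; rewrite horner_prod big1// => a _.
by rewrite !hornerE expr0n /= mulr0 subr0.
Qed.

(** A degree d > 0 occurs in the j-th dilated product only when j divides d with
    quotient at most the size of s, hence for at most that many j. *)
Lemma coef_dilate_mean_le n s d : {in s, forall a, normc a <= 1} ->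
  (0 < d)%N ->
  normc (dilate_mean n s)`_d <= (size s)%:R * 2 ^+ size s / n%:R.
Proof.
move=> s1 d0; rewrite coefZ normcM normcV normc_nat mulrC ler_wpM2r//.
rewrite coef_sum; apply: (le_trans (normc_sum _ _ _)).
apply: (@le_trans _ _ (\sum_(j < n) 2 ^+ size s *
    \sum_(i < (size s).+1) (d == i * j.+1)%N%:R)).
  by apply: ler_sum => j _; exact: coef_prod_dilate_le.
rewrite -mulr_sumr mulrC ler_wpM2r ?exprn_ge0// exchange_big big_ord_recl /=.
rewrite big1 ?add0r; last by move=> j _; rewrite mul0n gtn_eqF.
rewrite -[X in _ <= X%:R]card_ord -sumr_const; apply: ler_sum => i _.
rewrite /bump /=; have [j jd|nj] := pickP (fun j : 'I_n => d == (1 + i) * j.+1)%N.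
  rewrite (bigD1 j) //= jd big1 ?addr0// => k kj.
  case: eqP => // dk; move/eqP: jd; rewrite dk => /eqP.
  by rewrite eqn_mul2l /= eqSS => /eqP/val_inj jk; rewrite jk eqxx in kj.
by rewrite big1 ?ler01// => k _; rewrite nj.
Qed.

Lemma coef_dilate_mean_eq0 n s d : {in s, forall a, normc a <= 1} ->
  (n * size s < d)%N -> (dilate_mean n s)`_d = 0.
Proof.
move=> s1 nd; rewrite coefZ coef_sum big1 ?mulr0// => j _.
apply: (@eq0_normc R); apply/le_anti; rewrite normc_ge0 andbT.
apply: le_trans (coef_prod_dilate_le _ _ s1) _.
rewrite big1 ?mulr0// => i _; case: eqP => // di.
have := ltn_ord i; have := ltn_ord j; nia.
Qed.

End OneVariableBounds.

(** * Sums over boxes *)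

Section BoxSums.
Variable R : realType.
Local Notation C := R[i].

(** From the nonnegativity of the sum of squares of B x - S y. *)
Lemma cauchy_schwarz (I : finType) (x y : I -> R) :
  (\sum_i x i * y i) ^+ 2 <= (\sum_i x i ^+ 2) * (\sum_i y i ^+ 2).
Proof.
set S := \sum_i x i * y i; set A := \sum_i x i ^+ 2; set B := \sum_i y i ^+ 2.
have B0 : 0 <= B by apply: sumr_ge0 => i _; rewrite sqr_ge0.
have : 0 <= \sum_i (B * x i - S * y i) ^+ 2 by apply: sumr_ge0 => i _; rewrite sqr_ge0.
have -> : \sum_i (B * x i - S * y i) ^+ 2 = B * (A * B - S ^+ 2).
  have -> : B * (A * B - S ^+ 2) = B ^+ 2 * A - 2 * B * S * S + S ^+ 2 * B by ring.
  transitivity (\sum_i (B ^+ 2 * x i ^+ 2 + (- (2 * B * S) * (x i * y i) + S ^+ 2 * y i ^+ 2))).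
    by apply: eq_bigr => i _; ring.
  by rewrite !big_split /= -!mulr_sumr -/S -/A -/B; ring.
have [B0'|Bn0] := eqVneq B 0.
  move=> _; rewrite B0' mulr0 /S big1 ?expr0n// => i _.
  have /eqP := B0'; rewrite psumr_eq0; last by move=> j _; rewrite sqr_ge0.
  by move=> /allP/(_ i (mem_index_enum _)); rewrite /= sqrf_eq0 => /eqP ->; rewrite mulr0.
by rewrite pmulr_rge0 ?lt_neqAle ?B0 1?eq_sym ?Bn0// subr_ge0.
Qed.

(** One sum over pairs rather than a double sum, so that the lemmas on sums over
    a finite type apply. *)
Definition boxsum (V : nmodType) n (F : nat -> nat -> V) : V :=
  \sum_(i : 'I_n * 'I_n) F i.1 i.2.

Lemma boxsumE (V : nmodType) n (F : nat -> nat -> V) :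
  boxsum n F = \sum_(k < n) \sum_(l < n) F k l.
Proof. by rewrite pair_bigA. Qed.

Lemma eq_boxsum (V : nmodType) n (F G : nat -> nat -> V) :
  (forall k l, (k < n)%N -> (l < n)%N -> F k l = G k l) -> boxsum n F = boxsum n G.
Proof. by move=> FG; apply: eq_bigr => i _; rewrite FG. Qed.

Lemma boxsum_widen (V : nmodType) n m (F : nat -> nat -> V) : (n <= m)%N ->
  boxsum n F = boxsum m (fun k l => if (k < n)%N && (l < n)%N then F k l else 0).
Proof.
move=> nm; rewrite !boxsumE (big_ord_widen m (fun k => \sum_(l < n) F k l))//.
rewrite big_mkcond; apply: eq_bigr => k _; case: ifP => kn /=; last first.
  by rewrite big1.
by rewrite (big_ord_widen m (F k)) // big_mkcond.
Qed.

Lemma boxsum_stable (V : nmodType) n m (F : nat -> nat -> V) : (n <= m)%N ->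
  (forall k l, (n <= k)%N || (n <= l)%N -> F k l = 0) -> boxsum m F = boxsum n F.
Proof.
move=> nm F0; rewrite (boxsum_widen F nm); apply: eq_bigr => i _.
by case: ifP => // /negbT ; rewrite negb_and -!leqNgt => /F0.
Qed.

Lemma boxsum_ge0 n (F : nat -> nat -> R) : (forall k l, 0 <= F k l) ->
  0 <= boxsum n F.
Proof. by move=> F0; apply: sumr_ge0. Qed.

Lemma le_boxsum n (F G : nat -> nat -> R) :
  (forall k l, (k < n)%N -> (l < n)%N -> F k l <= G k l) -> boxsum n F <= boxsum n G.
Proof. by move=> FG; apply: ler_sum => i _; exact: FG. Qed.

Lemma boxsum_mono n m (F : nat -> nat -> R) : (forall k l, 0 <= F k l) ->
  (n <= m)%N -> boxsum n F <= boxsum m F.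
Proof.
move=> F0 nm; rewrite (boxsum_widen F nm); apply: le_boxsum => k l _ _.
by case: ifP.
Qed.

Lemma boxsumD (V : nmodType) n (F G : nat -> nat -> V) :
  boxsum n (fun k l => F k l + G k l) = boxsum n F + boxsum n G.
Proof. exact: big_split. Qed.

Lemma boxsumZ (S : pzRingType) n (c : S) (F : nat -> nat -> S) :
  boxsum n (fun k l => c * F k l) = c * boxsum n F.
Proof. by rewrite /boxsum mulr_sumr. Qed.

Lemma term_le_boxsum n k l (F : nat -> nat -> R) : (forall k l, 0 <= F k l) ->
  (k < n)%N -> (l < n)%N -> F k l <= boxsum n F.
Proof.
move=> F0 kn ln; rewrite /boxsum (bigD1 (Ordinal kn, Ordinal ln)) //= lerDl.
exact: sumr_ge0.
Qed.

(** A box lies in the union of the first diagonals. *)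
Lemma boxsum_le_diag n (F : nat -> nat -> R) : (forall k l, 0 <= F k l) ->
  boxsum n F <= \sum_(d < n + n) \sum_(l < d.+1) F (d - l)%N l.
Proof.
move=> F0; rewrite boxsumE exchange_big /=.
have -> : \sum_(d < n + n) \sum_(l < d.+1) F (d - l)%N l =
    \sum_(l < n + n) \sum_(d < n + n) (if (l < d.+1)%N then F (d - l)%N l else 0).
  rewrite exchange_big; apply: eq_bigr => d _.
  by rewrite (big_ord_widen (n + n) (fun l => F (d - l)%N l)) ?big_mkcond.
rewrite big_split_ord /=; apply: ler_wpDr.
  by apply: sumr_ge0 => l _; apply: sumr_ge0 => d _; case: ifP.
apply: ler_sum => l _.
rewrite -(big_mkord xpredT (fun d => if (l < d.+1)%N then F (d - l)%N l else 0)).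
have ln := ltn_ord l.
rewrite (@big_cat_nat _ _ _ l) //=; last by lia.
apply: ler_wpDl; first by apply: sumr_ge0 => d _; case: ifP.
rewrite -[X in \sum_(X <= _ < _) _]add0n big_addn.
rewrite (@big_cat_nat _ _ _ n) //=; last by lia.
apply: ler_wpDr; first by apply: sumr_ge0 => d _; case: ifP.
rewrite big_mkord; apply: ler_sum => k _.
by rewrite ltnS leq_addl addnK.
Qed.

End BoxSums.

(** * Polynomials of two variables and their slices *)

Section TwoVariables.
Variable R : realType.
Local Notation C := R[i].
Local Notation P2 := {poly {poly C}}.
Implicit Types (p q : P2) (c w : C) (z : C * C).

Definition coef2 q k l : C := q`_l`_k.

Definition mono k l : P2 := ('X^k)%:P * 'X^l.

Lemma coef2_mono k l i j : coef2 (mono k l) i j = ((i == k) && (j == l))%:R.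
Proof.
rewrite /coef2 coefCM coefXn; case: eqP => _; last by rewrite mulr0 coef0 andbF.
by rewrite mulr1 coefXn andbT.
Qed.

Lemma coef2D q q' k l : coef2 (q + q') k l = coef2 q k l + coef2 q' k l.
Proof. by rewrite /coef2 !coefD. Qed.

Lemma coef2B q q' k l : coef2 (q - q') k l = coef2 q k l - coef2 q' k l.
Proof. by rewrite /coef2 !coefB. Qed.

Lemma coef2Z c q k l : coef2 (c%:P%:P * q) k l = c * coef2 q k l.
Proof. by rewrite /coef2 !coefCM. Qed.

Lemma coef2_sum (I : Type) (r : seq I) (P : pred I) (F : I -> P2) k l :
  coef2 (\sum_(i <- r | P i) F i) k l = \sum_(i <- r | P i) coef2 (F i) k l.
Proof. by rewrite /coef2 !coef_sum. Qed.

Lemma poly2P p q : (forall k l, coef2 p k l = coef2 q k l) -> p = q.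
Proof. by move=> pq; apply/polyP => l; apply/polyP => k; apply: pq. Qed.

Definition bidim q : nat := maxn (size q) (sizeY q).

Lemma coef2_bidim q k l : (bidim q <= k)%N || (bidim q <= l)%N -> coef2 q k l = 0.
Proof.
rewrite /coef2 !geq_max => /orP[/andP[_ H]|/andP[H _]].
  by rewrite nth_default// (leq_trans (max_size_coefXY _ _)).
by rewrite [q`_l]nth_default// coef0.
Qed.

Lemma poly2E q n : (bidim q <= n)%N ->
  q = boxsum n (fun k l => (coef2 q k l)%:P%:P * mono k l).
Proof.
move=> qn; apply: poly2P => i j; rewrite coef2_sum.
under eq_bigr => x _ do rewrite coef2Z coef2_mono.
have [ij|ij] := boolP ((i < n) && (j < n))%N.
  case/andP: ij => iN jN; rewrite (bigD1 (Ordinal iN, Ordinal jN)) //= !eqxx mulr1.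
  rewrite big1 ?addr0// => -[a b] /= ab; case: eqP => [ia|_]; last by rewrite mulr0.
  case: eqP => [jb|_]; last by rewrite mulr0.
  by case/eqP: ab; congr (_, _); apply: val_inj.
rewrite coef2_bidim; last first.
  by move: ij; rewrite negb_and -!leqNgt => /orP[] H; rewrite (leq_trans qn H) ?orbT.
rewrite big1// => -[[a an] [b bn]] _ /=; case: eqP => [ia|_]; last by rewrite mulr0.
case: eqP => [jb|_]; last by rewrite mulr0.
by rewrite ia jb an bn in ij.
Qed.

(** Linearity over the scalars, which enter as doubly constant polynomials. *)
Definition lin2 (F : P2 -> C) : Prop :=
  (forall q r, F (q + r) = F q + F r) /\ (forall c q, F (c%:P%:P * q) = c * F q).

Lemma lin2_0 F : lin2 F -> F 0 = 0.
Proof. by case=> _ FZ; have := FZ 0 0; rewrite mulr0 mul0r. Qed.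

Lemma lin2_sum F (I : Type) (r : seq I) (P : pred I) (G : I -> P2) : lin2 F ->
  F (\sum_(i <- r | P i) G i) = \sum_(i <- r | P i) F (G i).
Proof. by move=> Fl; apply: (big_morph F Fl.1 (lin2_0 Fl)). Qed.

Lemma lin2N F q : lin2 F -> F (- q) = - F q.
Proof.
move=> Fl; have := Fl.2 (-1) q.
by rewrite !polyCN polyC1 !mulN1r.
Qed.

Lemma lin2_box F q n : lin2 F -> (bidim q <= n)%N ->
  F q = boxsum n (fun k l => coef2 q k l * F (mono k l)).
Proof.
move=> Fl qn; rewrite {1}(poly2E qn) (lin2_sum _ _ _ Fl).
by apply: eq_bigr => i _; rewrite Fl.2.
Qed.

Lemma lin2_mul F g : lin2 F -> lin2 (fun q => F (g * q)).
Proof.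
case=> FD FZ; split=> [q r|c q]; first by rewrite mulrDr FD.
by rewrite mulrCA FZ.
Qed.

Lemma lin2_eq0 F : lin2 F -> (forall k l, F (mono k l) = 0) -> forall q, F q = 0.
Proof.
move=> Fl F0 q; rewrite (lin2_box Fl (leqnn _)) /boxsum big1// => i _.
by rewrite F0 mulr0.
Qed.

Lemma pevalD p q z : peval (p + q) z = peval p z + peval q z.
Proof. by rewrite /peval !hornerD. Qed.

Lemma pevalN p z : peval (- p) z = - peval p z.
Proof. by rewrite /peval !hornerN. Qed.

Lemma pevalM p q z : peval (p * q) z = peval p z * peval q z.
Proof. by rewrite /peval !hornerM. Qed.

Lemma pevalC c z : peval c%:P%:P z = c.
Proof. by rewrite /peval !hornerC. Qed.

Lemma peval_sum (I : Type) (r : seq I) (P : pred I) (F : I -> P2) z :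
  peval (\sum_(i <- r | P i) F i) z = \sum_(i <- r | P i) peval (F i) z.
Proof. by rewrite /peval !horner_sum. Qed.

Lemma peval_mono k l z : peval (mono k l) z = monomial (k, l) z.
Proof. by rewrite /peval /mono /monomial !(hornerE, horner_exp). Qed.

Lemma peval_outer (r : {poly C}) z : peval r%:P z = r.[z.1].
Proof. by rewrite /peval hornerC. Qed.

Lemma lin2_peval z : lin2 (fun q => peval q z).
Proof. by split=> *; rewrite ?pevalD ?pevalM ?pevalC. Qed.

Lemma peval_box p z n : (bidim p <= n)%N ->
  peval p z = boxsum n (fun k l => coef2 p k l * monomial (k, l) z).
Proof.
move=> pn; rewrite (lin2_box (lin2_peval z) pn).
by apply: eq_boxsum => k l _ _; rewrite peval_mono.
Qed.

Lemma peval_swap p z : peval (swapXY p) z = peval p (z.2, z.1).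
Proof. by rewrite /peval horner2_swapXY. Qed.

Definition fix1 p (x : C) : {poly C} := map_poly (fun r => r.[x]) p.

Lemma horner_fix1 p x y : (fix1 p x).[y] = peval p (x, y).
Proof. by rewrite /peval -(horner_swapXY p x : _ = fix1 p x) horner2_swapXY. Qed.

Lemma size_fix1 p x : (size (fix1 p x) <= size p)%N.
Proof. exact: size_poly. Qed.

(** One variable at a time: a polynomial vanishing on the circle is zero. *)
Lemma poly2_eq_torus p q :
  (forall z, torus2 z -> peval p z = peval q z) -> p = q.
Proof.
move=> pq.
have E x : normc x = 1 -> fix1 p x = fix1 q x.
  move=> x1; apply: poly_eq_circle => y y1; rewrite !horner_fix1 pq//.
  by split; apply/normc_eq1.
apply/polyP => l; apply: poly_eq_circle => x x1.
have := congr1 (fun r : {poly C} => r`_l) (E x x1).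
by rewrite /fix1 !coef_map_id0 ?horner0.
Qed.

(** q(t, w t) as a polynomial in t: the outer variable, which is the second one,
    is replaced by w times the inner one. *)
Definition slice w q : {poly C} := q.[w *: 'X].

Lemma sliceM w p q : slice w (p * q) = slice w p * slice w q.
Proof. exact: hornerM. Qed.

Lemma sliceX w p n : slice w (p ^+ n) = slice w p ^+ n.
Proof. exact: horner_exp. Qed.

Lemma sliceZ w c q : slice w (c%:P%:P * q) = c *: slice w q.
Proof. by rewrite sliceM /slice hornerC mul_polyC. Qed.

Lemma slice_sum w (I : Type) (r : seq I) (P : pred I) (F : I -> P2) :
  slice w (\sum_(i <- r | P i) F i) = \sum_(i <- r | P i) slice w (F i).
Proof. exact: horner_sum. Qed.

Lemma slice_prod w (I : Type) (r : seq I) (P : pred I) (F : I -> P2) :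
  slice w (\prod_(i <- r | P i) F i) = \prod_(i <- r | P i) slice w (F i).
Proof. exact: horner_prod. Qed.

Lemma horner_slice w q t : (slice w q).[t] = peval q (t, w * t).
Proof.
have := horner_map (horner_eval t) q (w *: 'X).
rewrite -horner_fix1 /fix1 /slice /= !horner_evalE => <-.
by rewrite !hornerE.
Qed.

Lemma coef_slice w q d :
  (slice w q)`_d = \sum_(l < d.+1) coef2 q (d - l) l * w ^+ l.
Proof.
rewrite /slice (@horner_coef_wide _ (maxn d.+1 (size q))) ?leq_maxr//.
rewrite coef_sum (big_ord_widen (maxn d.+1 (size q)) (fun l => coef2 q (d - l) l * w ^+ l)) ?leq_maxl//.
rewrite [RHS]big_mkcond; apply: eq_bigr => l _.
rewrite exprZn -scalerAr coefZ coefMXn ltnS mulrC ltnNge.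
by case: leqP => _ /=; rewrite ?mul0r.
Qed.

Lemma size_slice w q n m : (size q <= m.+1)%N -> (sizeY q <= n.+1)%N ->
  (size (slice w q) <= (n + m).+1)%N.
Proof.
move=> qm qn; apply/leq_sizeP => d nmd; rewrite coef_slice big1// => l _.
case: (ltnP m l) => [ml|lm].
  by rewrite /coef2 [q`_l]nth_default ?coef0 ?mul0r// (leq_trans qm).
rewrite /coef2 nth_default ?mul0r// (leq_trans (max_size_coefXY _ _))//.
by rewrite (leq_trans qn)//; lia.
Qed.

(** A homogeneous component of q is determined by its restriction to the lines
    through (1, w); its l2 norm is a mean over the circle. *)
Lemma diag_le_slice q d B : (forall w, normc w = 1 -> normc (slice w q)`_d <= B) ->
  \sum_(l < d.+1) normc (coef2 q (d - l) l) ^+ 2 <= B ^+ 2.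
Proof.
move=> qB; pose h : {poly C} := \poly_(l < d.+1) coef2 q (d - l) l.
have -> : \sum_(l < d.+1) normc (coef2 q (d - l) l) ^+ 2 =
          \sum_(l < d.+1) normc h`_l ^+ 2.
  by apply: eq_bigr => l _; rewrite coef_poly ltn_ord.
by apply: bessel => w /qB; rewrite horner_poly -coef_slice.
Qed.

End TwoVariables.

(** * Bounded functionals annihilating a polynomial *)

Section Annihilators.
Variable R : realType.
Local Notation C := R[i].
Local Notation P2 := {poly {poly C}}.
Implicit Types (p q g h : P2) (F : P2 -> C) (alpha : R).

Definition weight alpha d : R := d.+1%:R `^ alpha.

Lemma weight_gt0 alpha d : 0 < weight alpha d.
Proof. by rewrite powR_gt0. Qed.

Lemma weight_ge0 alpha d : 0 <= weight alpha d.
Proof. exact/ltW/weight_gt0. Qed.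

(** Both factors are monotone: d + m + 1 lies between d + 1 and
    (d + 1)(m + 1). The absolute value covers both signs of alpha. *)
Lemma weight_shift alpha d m : weight alpha (d + m) <= weight `|alpha| m * weight alpha d.
Proof.
rewrite /weight; have [a0|a0] := leP 0 alpha.
  rewrite ger0_norm// -powRM// ge0_ler_powR ?nnegrE ?mulr_ge0//.
  by rewrite -natrM ler_nat; nia.
apply: (@le_trans _ _ (d.+1%:R `^ alpha)).
  have [b b0 ->] : exists2 b, 0 <= b & alpha = - b.
    by exists (- alpha); rewrite ?opprK// oppr_ge0 ltW.
  rewrite !powRN lef_pV2 ?posrE ?powR_gt0//.
  rewrite ge0_ler_powR ?nnegrE//.
  by rewrite ler_nat; lia.
rewrite ler_peMl ?powR_ge0//; have := @ler_powR _ (m.+1%:R) _ 0 `|alpha|.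
by rewrite powRr0; apply; rewrite ?normr_ge0// ler1n.
Qed.

Lemma boxsum_cs n (W x y : nat -> nat -> R) : (forall k l, 0 < W k l) ->
  boxsum n (fun k l => x k l * y k l) ^+ 2 <=
  boxsum n (fun k l => W k l * x k l ^+ 2) * boxsum n (fun k l => y k l ^+ 2 / W k l).
Proof.
move=> W0; have W0' k l : 0 <= W k l by exact: ltW.
have S0 k l : Num.sqrt (W k l) != 0 by rewrite gt_eqF// sqrtr_gt0.
have := cauchy_schwarz (fun i : 'I_n * 'I_n => Num.sqrt (W i.1 i.2) * x i.1 i.2)
  (fun i => y i.1 i.2 / Num.sqrt (W i.1 i.2)).
congr (_ ^+ 2 <= _ * _); apply: eq_bigr => i _.
- move: (S0 i.1 i.2) (x i.1 i.2) (y i.1 i.2); move: (Num.sqrt _) => s s0 u v.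
  by field.
- by rewrite exprMn sqr_sqrtr.
- by rewrite exprMn exprVn sqr_sqrtr.
Qed.

Lemma boxsum_shift n m i j (G : nat -> nat -> R) : (forall k l, 0 <= G k l) ->
    (n + i <= m)%N -> (n + j <= m)%N ->
  boxsum n (fun k l => G (k + i)%N (l + j)%N) <= boxsum m G.
Proof.
have shift1 (H : nat -> R) a : (forall k, 0 <= H k) -> (n + a <= m)%N ->
    \sum_(k < n) H (k + a)%N <= \sum_(k < m) H k.
  move=> H0 nm; rewrite -[leRHS](big_mkord xpredT) (@big_cat_nat _ _ _ a) //=; last by lia.
  apply: ler_wpDl; first exact: sumr_ge0.
  rewrite (@big_cat_nat _ _ _ (n + a)) //=; last by lia.
  apply: ler_wpDr; first exact: sumr_ge0.
  by rewrite -[X in \sum_(X <= _ < _) _]add0n big_addn addnK big_mkord.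
move=> G0 nim njm; rewrite !boxsumE.
apply: (@le_trans _ _ (\sum_(k < n) \sum_(l < m) G (k + i)%N l)).
  by apply: ler_sum => k _; apply: (shift1 (G (k + i)%N)).
by apply: (shift1 (fun k => \sum_(l < m) G k l)) => // k; apply: sumr_ge0.
Qed.

(** The sum is the squared norm of F in the dual of the weighted space. *)
Definition dual_bounded alpha F := exists K, forall n,
  boxsum n (fun k l => normc (F (mono R k l)) ^+ 2 / weight alpha (k + l)) <= K.

Definition annihilates alpha p F :=
  [/\ lin2 F, dual_bounded alpha F & forall q, F (p * q) = 0].

Lemma monoM i j k l : mono R i j * mono R k l = mono R (k + i) (l + j).
Proof. by rewrite /mono mulrACA -polyCM -!exprD addnC (addnC j). Qed.

(** Multiplication by a monomial is bounded since the weights of degrees at a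
    fixed distance are comparable. *)
Lemma dual_bounded_mul alpha F g : lin2 F -> dual_bounded alpha F ->
  dual_bounded alpha (fun q => F (g * q)).
Proof.
move=> Fl [K FK].
have mono_case i j : dual_bounded alpha (fun q => F (mono R i j * q)).
  exists (weight `|alpha| (i + j) * K) => n.
  pose G k l := normc (F (mono R k l)) ^+ 2 / weight alpha (k + l).
  have G0 k l : 0 <= G k l by rewrite divr_ge0 ?sqr_ge0 ?weight_ge0.
  apply: (@le_trans _ _ (boxsum n (fun k l => weight `|alpha| (i + j) * G (k + i)%N (l + j)%N))).
    apply: le_boxsum => k l _ _; rewrite monoM /G mulrCA ler_wpM2l ?sqr_ge0//.
    rewrite ler_pdivlMr ?weight_gt0// mulrC ler_pdivrMr ?weight_gt0//.
    have -> : (k + i + (l + j) = k + l + (i + j))%N by lia.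
    exact: weight_shift.
  rewrite boxsumZ ler_wpM2l ?weight_ge0//.
  by apply: le_trans (FK (n + i + j)%N); apply: boxsum_shift; rewrite ?G0//; lia.
have add_case F1 F2 : dual_bounded alpha F1 -> dual_bounded alpha F2 ->
    dual_bounded alpha (fun q => F1 q + F2 q).
  move=> [K1 FK1] [K2 FK2]; exists (2 * K1 + 2 * K2) => n.
  apply: le_trans (lerD (ler_wpM2l (_ : 0 <= 2) (FK1 n)) (ler_wpM2l (_ : 0 <= 2) (FK2 n))) => //.
  rewrite -!boxsumZ -boxsumD; apply: le_boxsum => k l _ _.
  rewrite !mulrA -mulrDl ler_wpM2r ?invr_ge0 ?weight_ge0//.
  apply: (@le_trans _ _ ((normc (F1 (mono R k l)) + normc (F2 (mono R k l))) ^+ 2)).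
    by rewrite lerXn2r ?nnegrE ?addr_ge0 ?normc_ge0// normc_triangle.
  rewrite -subr_ge0; have := sqr_ge0 (normc (F1 (mono R k l)) - normc (F2 (mono R k l))).
  by congr (0 <= _); ring.
have scale_case c F1 : dual_bounded alpha F1 -> dual_bounded alpha (fun q => c * F1 q).
  move=> [K1 FK1]; exists (normc c ^+ 2 * K1) => n.
  apply: le_trans (ler_wpM2l (sqr_ge0 _) (FK1 n)); rewrite -boxsumZ.
  by apply: le_boxsum => k l _ _; rewrite normcM exprMn -mulrA.
pose D (f : P2 -> C) := dual_bounded alpha f.
rewrite (_ : (fun q => F (g * q)) = fun q =>
    boxsum (bidim g) (fun k l => coef2 g k l * F (mono R k l * q))); last first.
  apply/funext => q; rewrite {1}(poly2E (leqnn (bidim g))) /boxsum mulr_suml (lin2_sum _ _ _ Fl).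
  by apply: eq_bigr => i _; rewrite -mulrA Fl.2.
rewrite /boxsum; elim: (index_enum _) => [|x r IH].
  exists 0 => n; rewrite /boxsum big1// => i _.
  by rewrite big_nil normc0 expr0n mul0r.
rewrite (_ : (fun q => _) = fun q => coef2 g x.1 x.2 * F (mono R x.1 x.2 * q) +
  \sum_(i <- r) coef2 g i.1 i.2 * F (mono R i.1 i.2 * q)); last first.
  by apply/funext => q; rewrite big_cons.
exact: add_case (scale_case _ _ (mono_case _ _)) IH.
Qed.

Lemma annihilates_mul alpha p F g : annihilates alpha p F ->
  annihilates alpha p (fun q => F (g * q)).
Proof.
move=> [Fl Fb Fp]; split; first exact: lin2_mul.
  exact: dual_bounded_mul.
by move=> q; rewrite mulrCA Fp.
Qed.

Lemma bounded_mono_tail (S : nat -> R) K : (forall n m, (n <= m)%N -> S n <= S m) ->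
    (forall n, S n <= K) ->
  forall e, 0 < e -> exists n0, forall n m, (n0 <= n)%N -> S m <= S n + e.
Proof.
move=> Smono SK e e0; pose E := [set S n | n in [set: nat]].
have supE : has_sup E.
  by split; [exists (S 0%N), 0%N | exists K => _ [n _ <-]].
have [_ [n _ <-] nE] := sup_adherent e0 supE.
exists n => k m nk; apply: (@le_trans _ _ (sup E)).
  by apply: sup_upper_bound => //; exists m.
by rewrite -lerBlDr (le_trans (ltW nE))// Smono.
Qed.

(** On a bounded set of polynomials F is determined up to a small error by the
    coefficients in a large box: the part of F outside of the box has small
    norm. So bounded coefficientwise limits of multiples of p are killed. *)
Lemma annihilates_limit alpha p F h K : annihilates alpha p F ->
    (forall e D, 0 < e -> exists g,
      (forall n, boxsum n (fun k l =>
         weight alpha (k + l) * normc (coef2 (p * g) k l) ^+ 2) <= K) /\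
      (forall k l, (k < D)%N -> (l < D)%N ->
         normc (coef2 (p * g) k l - coef2 h k l) <= e)) ->
  F h = 0.
Proof.
move=> [Fl [K' FK'] Fp] approx.
pose f k l := normc (F (mono R k l)); have f0 k l : 0 <= f k l by exact: normc_ge0.
pose G k l := f k l ^+ 2 / weight alpha (k + l).
have G0 k l : 0 <= G k l by rewrite divr_ge0 ?sqr_ge0 ?weight_ge0.
have K0 : 0 <= K.
  have [g [gK _]] := approx 1 0%N ltr01; apply: le_trans (gK 0%N).
  by apply: boxsum_ge0 => k l; rewrite mulr_ge0 ?weight_ge0 ?sqr_ge0.
suff small e : 0 < e -> normc (F h) <= e + e.
  apply: (@eq0_normc R); apply/le_anti; rewrite normc_ge0 andbT.
  by apply/ler_addgt0Pr => e e0; rewrite add0r (splitr e); apply: small; rewrite divr_gt0.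
move=> e0.
have d0 : 0 < e ^+ 2 / (K + 1) by rewrite divr_gt0 ?exprn_gt0// ltr_wpDl.
have [D0 tailD] := bounded_mono_tail (fun n m => @boxsum_mono R n m G G0) FK' d0.
pose D := maxn D0 (bidim h).
pose M := boxsum D f; have M0 : 0 <= M by exact: boxsum_ge0.
have [|g [gK gh]] := approx (e / (M + 1)) D.
  by rewrite divr_gt0// ltr_wpDl.
pose m := maxn D (maxn (bidim (p * g)) (bidim h)).
have Dm : (D <= m)%N by rewrite leq_maxl.
have -> : F h = F h - F (p * g) by rewrite Fp subr0.
rewrite (lin2_box Fl (_ : bidim h <= m)%N) ?(lin2_box Fl (_ : bidim (p * g) <= m)%N);
  try by rewrite /m; lia.
pose inD k l := (k < D)%N && (l < D)%N.
have -> : boxsum m (fun k l => coef2 h k l * F (mono R k l)) -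
    boxsum m (fun k l => coef2 (p * g) k l * F (mono R k l)) =
  boxsum D (fun k l => (coef2 h k l - coef2 (p * g) k l) * F (mono R k l)) +
  boxsum m (fun k l => if inD k l then 0 else - (coef2 (p * g) k l * F (mono R k l))).
  rewrite (boxsum_widen _ Dm) -boxsumD /boxsum -sumrB; apply: eq_bigr => i _.
  rewrite -/(inD i.1 i.2); case: ifP => iD; first by rewrite addr0 mulrBl.
  rewrite [coef2 h _ _]coef2_bidim ?mul0r ?add0r//.
  by move/negbT: iD; rewrite /inD negb_and -!leqNgt /D !geq_max => /orP[/andP[_ ->]|/andP[_ ->]]; rewrite ?orbT.
apply: (le_trans (normc_triangle _ _)); apply: lerD.
  apply: (le_trans (normc_sum _ _ _)).
  apply: (@le_trans _ _ (e / (M + 1) * M)); last first.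
    by rewrite mulrAC ler_pdivrMr ?ltr_wpDl// ler_wpM2l ?ltW// ltrDl.
  rewrite /M -boxsumZ; apply: ler_sum => i _; rewrite normcM ler_wpM2r ?normc_ge0//.
  by rewrite normc_subr gh.
rewrite -(@ler_pXn2r _ 2) ?nnegrE ?normc_ge0 ?(ltW e0)//.
pose y k l := if inD k l then 0 else f k l.
apply: (@le_trans _ _ (boxsum m (fun k l => normc (coef2 (p * g) k l) * y k l) ^+ 2)).
  rewrite lerXn2r ?nnegrE ?normc_ge0//.
    apply: boxsum_ge0 => k l; rewrite mulr_ge0 ?normc_ge0// /y; case: ifP => //.
  apply: (le_trans (normc_sum _ _ _)); apply: ler_sum => i _; rewrite /y.
  by case: ifP; rewrite ?normc0 ?mulr0// normc_opp normcM.
have W0 k l : 0 < weight alpha (k + l) by exact: weight_gt0.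
apply: (le_trans (boxsum_cs _ _ _ W0)).
apply: (@le_trans _ _ (K * (e ^+ 2 / (K + 1)))); last first.
  by rewrite mulrCA ger_pMr ?exprn_gt0// ler_pdivrMr ?ltr_wpDl// mul1r lerDl.
apply: ler_pM; rewrite ?gK//.
- by apply: boxsum_ge0 => k l; rewrite mulr_ge0 ?weight_ge0 ?sqr_ge0.
- by apply: boxsum_ge0 => k l; rewrite divr_ge0 ?weight_ge0 ?sqr_ge0.
have := tailD D m (leq_maxl _ _); rewrite -lerBlDl; apply: le_trans.
rewrite lerBrDl (boxsum_widen _ Dm) -boxsumD; apply: le_boxsum => k l _ _.
by rewrite -/(inD k l) /y; case: ifP; rewrite ?expr0n ?mul0r ?addr0 ?add0r.
Qed.

End Annihilators.

(** * Rotation, truncation and reflection in two variables *)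

Section DilatesAndTruncations.
Variable R : realType.
Local Notation C := R[i].
Local Notation P2 := {poly {poly C}}.
Implicit Types (p q g h : P2) (alpha : R).

Lemma coef2_le_slice q k l B :
  (forall w, normc w = 1 -> normc (slice w q)`_(k + l) <= B) ->
  normc (coef2 q k l) <= B.
Proof.
move=> qB; have B0 : 0 <= B by apply: le_trans (qB 1 (@normc1 R)); exact: normc_ge0.
rewrite -(@ler_pXn2r _ 2) ?nnegrE ?normc_ge0//.
apply: le_trans (diag_le_slice qB); have lt : (l < (k + l).+1)%N by lia.
by rewrite (bigD1 (Ordinal lt)) //= addnK lerDl sumr_ge0// => i _; rewrite sqr_ge0.
Qed.

(** The weight is constant on diagonals, where the slices control the
    coefficients. *)
Lemma boxsum_le_slice alpha q (b : nat -> R) K :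
    (forall d w, normc w = 1 -> normc (slice w q)`_d <= b d) ->
    (forall n, \sum_(d < n) weight alpha d * b d ^+ 2 <= K) ->
  forall n, boxsum n (fun k l =>
    weight alpha (k + l) * normc (coef2 q k l) ^+ 2) <= K.
Proof.
move=> qb bK n.
pose G k l := weight alpha (k + l) * normc (coef2 q k l) ^+ 2.
apply: (@le_trans _ _ (\sum_(d < n + n) \sum_(l < d.+1) G (d - l)%N l)).
  by apply: boxsum_le_diag => k l; rewrite mulr_ge0 ?weight_ge0 ?sqr_ge0.
apply: le_trans (bK (n + n)%N); apply: ler_sum => d _.
under eq_bigr => l _ do rewrite /G subnK -1?ltnS//.
rewrite -mulr_sumr ler_wpM2l ?weight_ge0//.
by apply: diag_le_slice => w; exact: qb.
Qed.

Definition dilate (x : C) q : P2 :=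
  map_poly (comp_poly (x *: 'X)) q \Po (x%:P *: 'X).

Lemma slice_dilate w x q : slice w (dilate x q) = slice w q \Po (x *: 'X).
Proof.
rewrite /slice /dilate horner_comp.
have := horner_map (comp_poly (x *: 'X)) q (w *: 'X); rewrite /= => <-.
congr (_.[_]); rewrite hornerZ hornerX comp_polyZ comp_polyX.
by rewrite mul_polyC !scalerA mulrC.
Qed.

Lemma dilate1 q : dilate 1 q = q.
Proof.
rewrite /dilate polyC1 scale1r comp_polyXr.
rewrite (_ : comp_poly _ = id) ?map_poly_id//.
by apply/funext => r; rewrite ?scale1r comp_polyXr.
Qed.

Lemma prod_root_sub n (z y : C) : n.-primitive_root z ->
  \prod_(i < n) (1 - z ^+ i * y) = 1 - y ^+ n.
Proof.
move=> zP; have n0 := prim_order_gt0 zP.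
have [->|y0] := eqVneq y 0.
  rewrite expr0n gtn_eqF// subr0 big1// => i _; by rewrite mulr0 subr0.
have /(congr1 (fun r : {poly C} => r.[y^-1])) := factor_Xn_sub_1 zP.
rewrite big_mkord horner_prod hornerD hornerN hornerXn hornerC => E.
apply: (mulfI (_ : (y^-1) ^+ n != 0)); first by rewrite expf_neq0// invr_neq0.
rewrite mulrBr mulr1 -exprMn mulVf// expr1n -E.
rewrite -[X in _ ^+ X]card_ord -prodr_const -big_split /=; apply: eq_bigr => i _.
by rewrite !hornerE mulrBr mulr1 mulrCA mulVf// mulr1.
Qed.

(** The product of the n rotations of p, divided by its constant term: the
    factors 1 - z^i a t multiply to 1 - a^n t^n. The rotation by 1 is p itself. *)
Lemma ex_rotation_product p n : (0 < n)%N -> peval p (0, 0) != 0 ->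
    exists g : P2, forall w (s : seq C),
      slice w p = peval p (0, 0) *: \prod_(a <- s) (1 - a *: 'X) ->
    slice w (p * g) = \prod_(a <- s) (1 - a ^+ n *: 'X^n).
Proof.
move=> n0; set c := peval p (0, 0) => c0; have [z zP] := ex_prim_root R n0.
exists (((c ^+ n)^-1)%:P%:P * \prod_(i < n | (i : nat) != 0%N) dilate (z ^+ i) p).
move=> w s ps; rewrite mulrCA sliceZ.
have -> : p * \prod_(i < n | (i : nat) != 0%N) dilate (z ^+ i) p =
    \prod_(i < n) dilate (z ^+ i) p.
  by rewrite [RHS](bigD1 (Ordinal n0)) //= expr0 dilate1.
rewrite slice_prod.
have -> : \prod_(i < n) slice w (dilate (z ^+ i) p) =
    (c ^+ n) *: \prod_(a <- s) (1 - a ^+ n *: 'X^n); last first.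
  by rewrite scalerA mulVf ?expf_neq0// scale1r.
apply: poly_eq_circle => t _; rewrite horner_prod hornerZ horner_prod.
transitivity (\prod_(i < n) (c * \prod_(a <- s) (1 - z ^+ i * (a * t)))).
  apply: eq_bigr => i _; rewrite slice_dilate ps horner_comp !hornerZ hornerX horner_prod.
  congr (_ * _); apply: eq_bigr => a _; rewrite !hornerE; congr (1 - _).
  by rewrite /= (mulrC a).
rewrite big_split /= prodr_const card_ord; congr (_ * _).
rewrite exchange_big; apply: eq_bigr => a _.
by rewrite prod_root_sub// exprMn !hornerE.
Qed.

Definition truncate2 n q : P2 :=
  \poly_(l < n) \poly_(k < n - l) coef2 q k l.

Lemma coef2_truncate n q k l :
  coef2 (truncate2 n q) k l = if (k + l < n)%N then coef2 q k l else 0.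
Proof.
rewrite {1}/coef2 /truncate2 coef_poly; case: ltnP => ln.
  by rewrite coef_poly; congr (if _ then _ else _); apply/idP/idP; lia.
by rewrite coef0 ifF//; lia.
Qed.

Lemma coef_slice_truncate w n q d :
  (slice w (truncate2 n q))`_d = if (d < n)%N then (slice w q)`_d else 0.
Proof.
rewrite !coef_slice; case: ifP => dn.
  apply: eq_bigr => l _; have ld : (l <= d)%N by rewrite -ltnS.
  by rewrite coef2_truncate subnK// dn.
rewrite big1// => l _; have ld : (l <= d)%N by rewrite -ltnS.
by rewrite coef2_truncate subnK// dn mul0r.
Qed.

Definition reflect2 n m p : P2 := \poly_(l < m.+1) reflect_poly n p`_(m - l).

Section Reflect.
Variables (n m : nat) (p : P2).
Hypotheses (szp : (size p <= m.+1)%N) (szYp : (sizeY p <= n.+1)%N).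

Lemma peval_reflect2 z : torus2 z ->
  peval (reflect2 n m p) z = z.1 ^+ n * z.2 ^+ m * (peval p z)^*%C.
Proof.
case: z => x y [/= /normc_eq1 x1 /normc_eq1 y1].
have szf : (size (fix1 p x) <= m.+1)%N := leq_trans (size_fix1 p x) szp.
rewrite -(horner_fix1 p) /= -mulrA -(horner_reflect_unit szf y1).
transitivity ((reflect_poly m (fix1 p x)).[y] * x ^+ n); last exact: mulrC.
rewrite /peval !horner_poly horner_sum mulr_suml; apply: eq_bigr => l _ /=.
rewrite hornerM -polyC_exp hornerC horner_reflect_unit//; last first.
  by rewrite (leq_trans (max_size_coefXY _ _)).
rewrite /fix1 coef_map_id0 ?horner0//.
by rewrite -[LHS]mulrA [LHS]mulrC.
Qed.

Lemma slice_reflect2 w : normc w = 1 ->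
  slice w (reflect2 n m p) = w ^+ m *: reflect_poly (n + m) (slice w p).
Proof.
move=> w1; apply: poly_eq_circle => t t1; rewrite horner_slice peval_reflect2.
  rewrite hornerZ horner_reflect_unit ?size_slice// horner_slice /=.
  by rewrite exprMn exprD; ring.
by split; apply/normc_eq1; rewrite //= normcM w1 t1 mulr1.
Qed.

End Reflect.
End DilatesAndTruncations.

(** * Polynomials killed by every annihilating functional *)

Section Approximants.
Variable R : realType.
Local Notation C := R[i].
Local Notation P2 := {poly {poly C}}.
Variables (p : P2) (n m : nat).
Hypotheses (szp : (size p <= m.+1)%N) (szYp : (sizeY p <= n.+1)%N).
Hypothesis p_neq0 : forall z : C * C, bidisk z -> peval p z <> 0.

Let c := peval p (0, 0).

Lemma peval00_neq0 : c != 0.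
Proof. by apply/eqP/p_neq0; split; rewrite /= normr0 ltr01. Qed.

Lemma horner_slice_neq0 w t : normc w = 1 -> normc t < 1 -> (slice w p).[t] != 0.
Proof.
move=> w1 t1; rewrite horner_slice; apply/eqP/p_neq0.
by split; rewrite normc_lt1 //= normcM w1 mul1r.
Qed.

Lemma slice_at0 w : (slice w p).[0] = c.
Proof. by rewrite horner_slice mulr0. Qed.

Lemma slice_factor w : normc w = 1 -> exists s : seq C,
  [/\ size s = (n + m)%N, {in s, forall a, normc a <= 1} &
      slice w p = c *: \prod_(a <- s) (1 - a *: 'X)].
Proof.
move=> w1; have [|s [ss s1 ps]] := factor_disk_free (size_slice w szp szYp).
  by move=> t; exact: horner_slice_neq0.
by exists s; split => //; rewrite -(slice_at0 w).
Qed.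

(** The means of the rotation products tend to 1, and stay bounded in the
    space of exponent 1: the mean of N of them has O(N) coefficients of size
    O(1/N) on each slice, in degrees O(N). *)
Lemma annihilates_one alpha F : alpha <= 1 -> annihilates alpha p F -> F 1 = 0.
Proof.
move=> a1 Fann.
have /choice[g gP] : forall j : nat, exists g : P2, forall w (s : seq C),
    slice w p = c *: \prod_(a <- s) (1 - a *: 'X) ->
    slice w (p * g) = \prod_(a <- s) (1 - a ^+ j.+1 *: 'X^(j.+1)).
  by move=> j; apply: ex_rotation_product => //; exact: peval00_neq0.
pose h N := ((N%:R^-1)%:P%:P : P2) * \sum_(j < N) g j.
have slice_h N w s : slice w p = c *: \prod_(a <- s) (1 - a *: 'X) ->
    slice w (p * h N) = dilate_mean N s.
  move=> ps; rewrite /h mulrCA sliceZ mulr_sumr slice_sum; congr (_ *: _).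
  by apply: eq_bigr => j _; exact: gP.
pose M := (n + m)%N; pose B : R := M%:R * 2 ^+ M.
have B0 : 0 <= B by rewrite mulr_ge0// exprn_ge0.
pose b N d : R := if d == 0%N then 1 else if (d <= N * M)%N then B / N%:R else 0.
have hb N d w : (0 < N)%N -> normc w = 1 -> normc (slice w (p * h N))`_d <= b N d.
  move=> N0 w1; have [s [ss s1 ps]] := slice_factor w1.
  rewrite (slice_h N w s ps) /b; case: eqP => [->|/eqP d0].
    by rewrite dilate_mean0// normc1.
  case: leqP => dN; first by rewrite /B /M -ss coef_dilate_mean_le// lt0n.
  by rewrite coef_dilate_mean_eq0 ?normc0// ss.
apply: (annihilates_limit (K := 1 + (M.+1%:R * B) ^+ 2) Fann) => e D e0.
pose N := (Num.truncn (B / e)).+1.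
have N0 : 0 < N%:R :> R by rewrite ltr0n.
have BN : B / N%:R <= e.
  rewrite ler_pdivrMr// mulrC -ler_pdivrMr// ltW// /N.
  by rewrite truncnS_gt.
exists (h N); split.
  apply: boxsum_le_slice (fun d w => @hb N d w isT) _ => k.
  apply: (@le_trans _ _ (\sum_(d < k) (if d == 0%N :> nat then 1 else
      if (d <= N * M)%N then d.+1%:R * (B / N%:R) ^+ 2 else 0))).
    apply: ler_sum => d _; rewrite /b; case: eqP => [->|_].
      by rewrite expr1n mulr1 /weight powR1.
    case: ifP => _; last by rewrite expr0n mulr0.
    rewrite ler_wpM2r ?sqr_ge0// /weight.
    by rewrite -[leRHS]powRr1// ler_powR// ler1n.
  apply: (@le_trans _ _ (1 + \sum_(d < (N * M).+1) (N * M).+1%:R * (B / N%:R) ^+ 2)).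
    pose G d : R := if d == 0%N then 1 else
      if (d <= N * M)%N then d.+1%:R * (B / N%:R) ^+ 2 else 0.
    have G0 d : 0 <= G d.
      by rewrite /G; case: ifP => // _; case: ifP => // _; rewrite mulr_ge0 ?sqr_ge0.
    pose k' := maxn k (N * M).+1.
    apply: (@le_trans _ _ (\sum_(d < k') G d)).
      rewrite -(big_mkord xpredT G) -(big_mkord xpredT G).
      rewrite [leRHS](@big_cat_nat _ _ _ k) ?leq_maxl//= lerDl.
      exact: sumr_ge0.
    rewrite -(big_mkord xpredT G) [leLHS](@big_cat_nat _ _ _ (N * M).+1) ?leq_maxr//=.
    rewrite [X in _ + X]big_nat_cond [X in _ + X]big1 ?addr0; last first.
      move=> d; rewrite andbT => /andP[Nd _]; rewrite /G gtn_eqF ?ifF//; lia.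
    rewrite big_mkord big_ord_recl [leRHS]addrC -lerBlDr.
    rewrite big_ord_recl /=; set S1 := \sum_(i < N * M) _; set S2 := \sum_(i < N * M) _.
    have S12 : S1 <= S2.
      apply: ler_sum => i _; rewrite /G /= /bump /= ifT; last by have := ltn_ord i; lia.
      by rewrite ler_wpM2r ?sqr_ge0// ler_nat; have := ltn_ord i; lia.
    have T0 : 0 <= (N * M).+1%:R * (B / N%:R) ^+ 2 by rewrite mulr_ge0 ?sqr_ge0.
    by rewrite /G /=; lra.
  rewrite sumr_const card_ord lerD2l -[leLHS]mulr_natr mulrAC -expr2 -exprMn.
  rewrite lerXn2r ?nnegrE ?mulr_ge0 ?invr_ge0 ?ler0n//.
  rewrite [B / _]mulrC mulrA ler_wpM2r// ler_pdivrMr// -natrM ler_nat /N; lia.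
move=> k l _ _; rewrite -coef2B.
apply: coef2_le_slice => w w1.
rewrite /slice hornerD hornerN hornerC -/(slice w (p * h N)) coefB coef1.
case: (posnP (k + l)) => [->|kl0].
  have [s [ss s1 ps]] := slice_factor w1.
  by rewrite (slice_h N w s ps) dilate_mean0// subrr normc0 ltW.
rewrite subr0; apply: le_trans (hb N (k + l)%N w isT w1) _.
by rewrite /b gtn_eqF//; case: ifP => // _; exact: ltW.
Qed.

(** The constant term of p is nonzero, so 1 - p / p(0, 0) generates 1 / p by a
    geometric series. *)
Definition residual : P2 := 1 - ((peval p (0, 0))^-1)%:P%:P * p.

Lemma peval_residual0 z : z = (0, 0) -> peval residual z = 0.
Proof.
have E (a : C) : peval (1%:P%:P - a%:P%:P * p) (0, 0) = 1 - a * peval p (0, 0).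
  by rewrite (pevalD 1%:P%:P) (pevalN (a%:P%:P * p)) (pevalM a%:P%:P p) !pevalC.
move=> ->; rewrite /residual; move: (E (peval p (0, 0))^-1); rewrite !polyC1 => ->.
by rewrite mulVf ?subrr// peval00_neq0.
Qed.

(** An inverse of p modulo terms of total degree at least N. *)
Definition inv_mod N : P2 :=
  ((peval p (0, 0))^-1)%:P%:P * \sum_(i < N) residual ^+ i.

Lemma inv_modE N : p * inv_mod N = 1 - residual ^+ N.
Proof.
rewrite /inv_mod mulrCA mulrA.
have -> : ((peval p (0, 0))^-1)%:P%:P * p = - (residual - 1).
  by rewrite /residual addrAC subrr sub0r opprK.
by rewrite mulNr -subrX1 opprB.
Qed.

Lemma coef_slice_inv_mod w N j : (j < N)%N ->
  (slice w p * slice w (inv_mod N))`_j = (1 : {poly C})`_j.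
Proof.
move=> jN; rewrite -sliceM inv_modE /slice hornerD hornerN hornerC.
rewrite -/(slice w (residual ^+ N)) sliceX.
have e0 : root (slice w residual) 0.
  by apply/eqP; rewrite (horner_slice w residual 0) peval_residual0// mulr0.
have /factor_theorem[u uE] := e0.
by rewrite uE subr0 exprMn coefB coefMXn jN subr0.
Qed.

Lemma slice_coef_bound : exists A : nat -> R, forall w, normc w = 1 ->
  forall t M, wsum t M (slice w p) <= A t.
Proof.
pose A d := \sum_(l < d.+1) normc (coef2 p (d - l) l).
have A0 d : 0 <= A d by apply: sumr_ge0 => l _; exact: normc_ge0.
exists (fun t => \sum_(d < (n + m).+1) d.+1%:R ^+ t * A d) => w w1 t M.
have dA d : normc (slice w p)`_d <= A d.
  rewrite coef_slice; apply: (le_trans (normc_sum _ _ _)).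
  by apply: ler_sum => l _; rewrite normcM normcX w1 expr1n mulr1.
pose M' := maxn M (n + m).+1.
pose G d : R := d.+1%:R ^+ t * normc (slice w p)`_d.
have G0 d : 0 <= G d by rewrite mulr_ge0 ?exprn_ge0 ?normc_ge0.
apply: (@le_trans _ _ (\sum_(d < M') G d)).
  rewrite /wsum -(big_mkord xpredT G) -(big_mkord xpredT G).
  rewrite [leRHS](@big_cat_nat _ _ _ M) ?leq_maxl//= lerDl.
  exact: sumr_ge0.
rewrite -(big_mkord xpredT G) (@big_cat_nat _ _ _ (n + m).+1) ?leq_maxr//=.
rewrite [X in _ + X]big_nat_cond [X in _ + X]big1 ?addr0; last first.
  move=> d; rewrite andbT => /andP[Nd _]; rewrite /G nth_default ?normc0 ?mulr0//.
  exact: leq_trans (size_slice w szp szYp) Nd.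
by rewrite big_mkord; apply: ler_sum => d _; rewrite ler_wpM2l ?exprn_ge0.
Qed.

(** Division of a power of the reflection by p gives a function smooth up to
    the torus, which is the limit of its truncations. *)
Lemma annihilates_reflect_pow alpha : exists k, forall F,
  annihilates alpha p F -> F (reflect2 n m p ^+ k) = 0.
Proof.
pose t := (Num.truncn `|alpha|).+2.
have ta : alpha <= (t + t)%N%:R - 2.
  apply: le_trans (ler_norm _) _; apply: (@le_trans _ _ ((Num.truncn `|alpha|).+1%:R)).
    by rewrite ltW// truncnS_gt.
  by rewrite lerBrDr -natrD ler_nat /t; lia.
(* With 2 t >= alpha + 2 coefficients of size O(d^-t) have finite norm. *)
exists t.+2 => F Fann; set r := reflect2 n m p.
have [B wB] := wsum_reflect_div t (n + m) peval00_neq0.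
have [A wA] := slice_coef_bound.
pose T N := truncate2 N (r ^+ t.+2 * inv_mod N).
have A0 : 0 <= A t by apply: le_trans (wA 1 (@normc1 R) t 0%N); exact: wsum_ge0.
have wT w N M : normc w = 1 -> wsum t M (slice w (p * T N)) <= A t * B.
  move=> w1; rewrite sliceM; apply: (le_trans (wsumM _ _ _ _)).
  apply: ler_pM; rewrite ?wsum_ge0 ?wA//.
  pose Q := reflect_poly (n + m) (slice w p) ^+ t.+2 * slice w (inv_mod N).
  apply: (@le_trans _ _ (wsum t N Q)); last first.
    apply: wB (size_slice w szp szYp) _ (slice_at0 w) _ => //.
      by move=> z; exact: horner_slice_neq0.
    by move=> j; exact: coef_slice_inv_mod.
  have normT d : normc (slice w (T N))`_d = if (d < N)%N then normc Q`_d else 0.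
    rewrite coef_slice_truncate; case: ifP => _; last by rewrite normc0.
    rewrite sliceM sliceX slice_reflect2// exprZn -scalerAl coefZ normcM !normcX w1.
    by rewrite !expr1n mul1r.
  pose G d : R := d.+1%:R ^+ t * normc (slice w (T N))`_d.
  have G0 d : 0 <= G d by rewrite mulr_ge0 ?exprn_ge0 ?normc_ge0.
  apply: (@le_trans _ _ (\sum_(d < maxn M N) G d)).
    rewrite /wsum -(big_mkord xpredT G) -(big_mkord xpredT G).
    rewrite [leRHS](@big_cat_nat _ _ _ M) ?leq_maxl//= lerDl.
    exact: sumr_ge0.
  rewrite -(big_mkord xpredT G) (@big_cat_nat _ _ _ N) ?leq_maxr//=.
  rewrite [X in _ + X]big_nat_cond [X in _ + X]big1 ?addr0; last first.
    by move=> d; rewrite andbT => /andP[Nd _]; rewrite /G normT ltnNge Nd mulr0.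
  by rewrite big_mkord; apply: ler_sum => d _; rewrite /G normT ltn_ord.
have AB0 : 0 <= A t * B.
  by apply: le_trans (wT 1 0%N 0%N (@normc1 R)); exact: wsum_ge0.
apply: (annihilates_limit (K := (A t * B) ^+ 2 * 2) Fann) => eps D eps0.
pose N := (D + D)%N; exists (T N); split.
  apply: (@boxsum_le_slice _ _ _ (fun d => A t * B / d.+1%:R ^+ t)) => [d w w1|k].
    rewrite ler_pdivlMr ?exprn_gt0// mulrC.
    by apply: le_trans (wT w N d.+1 w1); rewrite coef_le_wsum.
  apply: (@le_trans _ _ (\sum_(d < k) (A t * B) ^+ 2 * (d.+1%:R ^+ 2)^-1)); last first.
    by rewrite -mulr_sumr ler_wpM2l ?sqr_ge0 ?sum_inv_sqr.
  apply: ler_sum => d _; rewrite expr_div_n mulrCA ler_wpM2l ?sqr_ge0//.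
  rewrite -exprM muln2 -addnn ler_pdivrMr ?exprn_gt0//.
  rewrite mulrC ler_pdivlMr ?exprn_gt0//.
  rewrite -!powR_mulrn// /weight -powRD; last by rewrite pnatr_eq0 implybT.
  by rewrite ler_powR ?ler1n// -lerBrDr.
move=> k l kD lD; rewrite -coef2B; apply: le_trans (ltW eps0).
apply: coef2_le_slice => w w1.
rewrite /slice hornerD hornerN -/(slice w (p * T N)) -/(slice w (r ^+ t.+2)) coefB.
have klN : (k + l < N)%N by rewrite /N; lia.
rewrite sliceM (@coef_mulr_mod _ N _ (slice w (r ^+ t.+2 * inv_mod N)))//; last first.
  by move=> j jN; rewrite coef_slice_truncate jN.
rewrite sliceM mulrCA (@coef_mulr_mod _ N _ 1)//; last first.
  by move=> j jN; rewrite coef_slice_inv_mod.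
by rewrite mulr1 subrr normc0.
Qed.

End Approximants.

(** * Common factors of polynomials of two variables *)

Section Ideals.
Variable C : closedFieldType.
Local Notation P2 := {poly {poly C}}.
Implicit Types (p q x y z : P2).

(** A polynomial that vanishes identically at a value of the first variable is
    divisible by the corresponding linear factor. *)
Lemma map_horner_eq0 y (a : C) : map_poly (horner_eval a) y = 0 -> exists y', y = ('X - a%:P)%:P * y'.
Proof.
move=> ya; have /fin_all_exists[f fP] : forall l : 'I_(size y),
    exists r : {poly C}, y`_l = r * ('X - a%:P).
  move=> l; apply/factor_theorem/eqP.
  by have /(congr1 (fun r : {poly C} => r`_l)) := ya; rewrite coef0 coef_map /= horner_evalE.
exists (\poly_(l < size y) oapp f 0 (insub l)).
apply/polyP => l; rewrite coefCM coef_poly; case: ltnP => ly.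
  by rewrite insubT /= mulrC; exact: (fP (Ordinal ly)).
by rewrite nth_default// mulr0.
Qed.

(** Gauss: a nonzero polynomial in the first variable alone can be cancelled
    from a product by distributing its linear factors. *)
Lemma cancel_content (c : {poly C}) x y z : c != 0 -> c%:P * x = y * z ->
  exists (g d : {poly C}) (y1 z1 : P2),
    [/\ y = g%:P * y1, z = d%:P * z1 & x = y1 * z1].
Proof.
have [N] := ubnP (size c); elim: N c y z => // N IH c y z cN c0 E.
have [c1|c1] := leqP (size c) 1.
  have /size_poly1P[k k0 ck] : size c == 1%N by rewrite eqn_leq c1 size_poly_gt0.
  exists k%:P, 1, (k^-1%:P%:P * y), z; split; first 1 last.
  - by rewrite polyC1 mul1r.
  - by rewrite -mulrA -E ck mulrA -!polyCM mulVf// mul1r.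
  by rewrite mulrA -!polyCM mulfV// mul1r.
have /closed_rootP[a /factor_theorem[c' cE]] : size c != 1%N by rewrite gtn_eqF.
have c'0 : c' != 0 by apply: contraNneq c0 => c'0; rewrite cE c'0 mul0r.
have c'N : (size c' < N)%N.
  by move: cN; rewrite cE size_Mmonic ?monicXsubC// size_XsubC addn2.
have X0 : ('X - a%:P)%:P != 0 :> P2 by rewrite polyC_eq0 polyXsubC_eq0.
have : map_poly (horner_eval a) y * map_poly (horner_eval a) z = 0.
  have := congr1 (map_poly (horner_eval a)) E; rewrite !rmorphM /= => <-.
  by rewrite map_polyC /= horner_evalE cE hornerM hornerXsubC subrr mulr0 polyC0 mul0r.
move=> /eqP; rewrite mulf_eq0 => /orP[/eqP/map_horner_eq0[y' yE]|/eqP/map_horner_eq0[z' zE]].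
  have [|g [d [y1 [z1 [yg zd xE]]]]] := IH c' y' z c'N c'0.
    by apply: (mulfI X0); rewrite !mulrA -yE -E cE polyCM (mulrC c'%:P).
  exists (('X - a%:P) * g), d, y1, z1; split => //.
  by rewrite yE yg polyCM mulrA.
have [|g [d [y1 [z1 [yg zd xE]]]]] := IH c' y z' c'N c'0.
  by apply: (mulfI X0); rewrite mulrA mulrCA -zE -E cE polyCM (mulrC c'%:P).
exists g, (('X - a%:P) * d), y1, z1; split => //.
by rewrite zE zd polyCM mulrA.
Qed.

Lemma size_outerM (c : {poly C}) x : (size (c%:P * x)%R <= size x)%N.
Proof. by rewrite mul_polyC size_scale_leq. Qed.

(** Bezout over the fraction field of the polynomials in the first variable,
    with denominators cleared: if the greatest common divisor is not constant in
    the second variable, irreducibility makes it p up to factors in the first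
    variable, which [cancel_content] removes. *)
Lemma ideal_or_dvd p q : p != 0 ->
    (forall x y, p = x * y ->
      (exists k : C, x = k%:P%:P) \/ (exists k : C, y = k%:P%:P)) ->
  (exists (r : {poly C}) (u v : P2), r != 0 /\ r%:P = u * p + v * q) \/
  ((1 < size p)%N /\ exists u, q = u * p).
Proof.
move=> p0 irr; have [sp|sp] := leqP (size p) 1.
  left; exists p`_0, 1, 0; rewrite -(size1_polyC sp); split; last first.
    by rewrite (mul1r p) (mul0r q) addr0.
  by apply/eqP => p00; move/eqP: p0; apply; rewrite (size1_polyC sp) p00 polyC0.
pose d := gcdp p q; have d0 : d != 0 by rewrite gcdp_eq0 (negbTE p0).
have notC y : (1 < size y)%N -> ~ exists k : C, y = k%:P%:P.
  by move=> sy [k yk]; move: sy; rewrite yk ltnNge size_polyC_leq1.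
have [sd|sd] := leqP (size d) 1.
  left; have [[u v] /eqpP[[c1 c2] /= /andP[c10 c20] E]] := Bezoutp p q.
  exists (c2 * d`_0), (c1%:P * u), (c1%:P * v); split.
    rewrite mulf_neq0//; apply/eqP => d00.
    by move/eqP: d0; apply; rewrite (size1_polyC sd) d00 polyC0.
  rewrite polyCM -(size1_polyC sd) -!mulrA -mulrDr.
  by move: E; rewrite -/d -!mul_polyC /= => ->.
right; split => //.
have /Pdiv.Idomain.dvdpP[[c e] /= c0 E] := dvdp_gcdl p q.
move: E; rewrite -/d -mul_polyC => /(cancel_content c0)[g [dl [e1 [d1 [eg dd pE]]]]].
have sd1 : (1 < size d1)%N by apply: leq_trans sd _; rewrite dd size_outerM.
case: (irr _ _ pE) => [[k e1k]|]; last by move/(notC _ sd1).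
have k0 : k != 0 by apply: contraNneq p0 => k0; rewrite pE e1k k0 !polyC0 mul0r.
have d1E : d1 = (k^-1)%:P%:P * p by rewrite pE e1k mulrA -!polyCM mulVf// mul1r.
have /Pdiv.Idomain.dvdpP[[c' e'] /= c'0 E'] := dvdp_gcdr p q.
move: E'; rewrite -/d -mul_polyC dd d1E mulrA => E'.
rewrite mulrA in E'.
have [g' [dl' [e2 [p1 [_ pE' qE]]]]] := cancel_content c'0 E'.
have sp1 : (1 < size p1)%N by apply: leq_trans sp _; rewrite pE' size_outerM.
case: (irr _ _ pE') => [[k' dk']|]; last by move/(notC _ sp1).
have k'0 : k' != 0 by apply: contraNneq p0 => k'0; rewrite pE' dk' k'0 !polyC0 mul0r.
exists (e2 * (k'^-1)%:P%:P); rewrite qE -mulrA; congr (_ * _).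
by rewrite [in RHS]pE' dk' mulrA -!polyCM mulVf// mul1r.
Qed.

End Ideals.

Lemma irreducible2_swap (R : realType) (p : {poly {poly R[i]}}) :
  irreducible2 p -> irreducible2 (swapXY p).
Proof.
move=> [p0 irr]; split=> [|q r E]; first by rewrite swapXY_eq0.
have pE : p = swapXY q * swapXY r by rewrite -rmorphM /= -E swapXYK.
have back (y : {poly {poly R[i]}}) :
    (exists c : R[i], swapXY y = c%:P%:P) -> exists c : R[i], y = c%:P%:P.
  by move=> [c yc]; exists c; rewrite -[y]swapXYK yc swapXY_polyC map_polyC.
by case: (irr _ _ pE) => /back; [left|right].
Qed.

(** * Functionals that are eigenvectors of both multiplications *)

Section Eigenfunctionals.
Variable R : realType.
Local Notation C := R[i].
Local Notation P2 := {poly {poly C}}.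
Implicit Types (p q g : P2) (F : P2 -> C) (alpha : R).

(** Bernoulli's inequality at exponents divisible by A + 1 gives growth of degree
    A + 1 when x > 1. *)
Lemma poly_growth (x K : R) A : 0 <= x -> (forall k, x ^+ k <= K * k.+1%:R ^+ A) ->
  x <= 1.
Proof.
move=> x0 xK; rewrite leNgt; apply/negP => x1; pose d := x - 1.
have d0 : 0 < d by rewrite subr_gt0.
have K0 : 0 <= K by have := xK 0%N; rewrite expr0 expr1n mulr1; apply: le_trans.
have bern k : k%:R * d <= x ^+ k.
  suff : 1 + k%:R * d <= x ^+ k by apply: le_trans; rewrite lerDr.
  elim: k => [|k IH]; first by rewrite mul0r addr0 expr0.
  rewrite exprS (_ : x = 1 + d) ?(addrC 1) ?subrK//.
  rewrite /d; apply: (@le_trans _ _ (x * (1 + k%:R * (x - 1)))); last by rewrite ler_wpM2l.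
  have kd : 0 <= k%:R * d ^+ 2 by rewrite mulr_ge0 ?sqr_ge0.
  by move: kd; rewrite /d -natr1; move: (k%:R : R) => y kd; nra.
pose L := K * A.+2%:R ^+ A.
have L0 : 0 <= L by rewrite mulr_ge0 ?exprn_ge0.
have key k : (0 < k)%N -> k%:R * d ^+ A.+1 <= L.
  move=> k0; have kp : 0 < k%:R :> R by rewrite ltr0n.
  have : (k%:R * d) ^+ A.+1 <= L * k%:R ^+ A.
    apply: (@le_trans _ _ (x ^+ (k * A.+1))).
      rewrite exprM lerXn2r ?nnegrE ?exprn_ge0//.
      by rewrite mulr_ge0 ?ltW.
    apply: le_trans (xK _) _; rewrite /L -mulrA ler_wpM2l// -exprMn.
    by rewrite lerXn2r ?nnegrE ?mulr_ge0// -natrM ler_nat; nia.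
  rewrite exprMn exprS (mulrAC k%:R) ler_pM2r ?exprn_gt0//.
pose k := (Num.truncn (L / d ^+ A.+1)).+1.
have := key k isT; rewrite -ler_pdivlMr ?exprn_gt0// leNgt.
by rewrite truncnS_gt.
Qed.

(** Remove factors from the left until the remaining product no longer kills
    F; the last factor removed is the one that kills a multiple of F. *)
Lemma kill_factor F (I : eqType) (r : seq I) (x : I -> P2) : lin2 F ->
    (exists q, F q != 0) -> (forall q, F ((\prod_(a <- r) x a) * q) = 0) ->
  exists g a, (exists q, F (g * q) != 0) /\ forall q, F (g * (x a * q)) = 0.
Proof.
move=> Fl; elim: r => [|a r IH] [q0 Fq0] kill.
  by move: (kill q0); rewrite big_nil mul1r => E; rewrite E eqxx in Fq0.
have [H|H] := pselect (exists q, F ((\prod_(a <- r) x a) * q) != 0).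
  exists (\prod_(a <- r) x a), a; split=> // q.
  by have := kill q; rewrite big_cons -mulrA mulrCA.
apply: IH; first by exists q0.
by move=> q; apply/eqP; apply: contrapT => /negP Fq; apply: H; exists q.
Qed.

Lemma const2_mul F (c : C) x : lin2 F -> c != 0 ->
  (forall q, F (c%:P%:P * x * q) = 0) -> forall q, F (x * q) = 0.
Proof.
move=> Fl c0 H q; have := H q; rewrite -mulrA Fl.2 => /eqP.
by rewrite mulf_eq0 (negbTE c0) => /eqP.
Qed.

(** If the ideal killed by a nonzero F contains nonzero polynomials in each
    variable, the multiples of F form a finite-dimensional space on which the
    two coordinate multiplications have a common eigenvector. *)
Lemma common_eigenfunctional alpha p F (r s : {poly C}) :
    annihilates alpha p F -> (exists q, F q != 0) -> r != 0 -> s != 0 ->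
    (forall q, F (r%:P * q) = 0) -> (forall q, F (s^:P * q) = 0) ->
  exists F' (x y c : C), [/\ annihilates alpha p F', c != 0 &
    forall k l, F' (mono R k l) = c * x ^+ k * y ^+ l].
Proof.
move=> Fann Fn0 r0 s0 rF sF; have Fl : lin2 F by case: Fann.
have [rs rE] := closed_field_poly_normal r.
have [ss sE] := closed_field_poly_normal s.
have rE2 : r%:P = (lead_coef r)%:P%:P * \prod_(a <- rs) ('X - a%:P)%:P.
  by rewrite [in LHS]rE -mul_polyC polyCM rmorph_prod.
have sE2 : s^:P = (lead_coef s)%:P%:P * \prod_(a <- ss) ('X - a%:P%:P).
  rewrite [in LHS]sE map_polyZ /= rmorph_prod /= -mul_polyC; congr (_ * _).
  by apply: eq_bigr => a _; rewrite rmorphB /= map_polyX map_polyC.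
have rF' : forall q, F ((\prod_(a <- rs) ('X - a%:P)%:P) * q) = 0.
  apply: (@const2_mul _ (lead_coef r)) => //; first by rewrite lead_coef_eq0.
  by move=> q; rewrite -rE2 rF.
have [g [x [Fg0 Fgx]]] := kill_factor Fl Fn0 rF'.
pose G q := F (g * q); have Gann : annihilates alpha p G := annihilates_mul g Fann.
have Gl : lin2 G by case: Gann.
have sG : forall q, G ((\prod_(a <- ss) ('X - a%:P%:P)) * q) = 0.
  apply: (@const2_mul _ (lead_coef s)) => //; first by rewrite lead_coef_eq0.
  by move=> q; rewrite -sE2 /G mulrCA sF.
have [g' [y [Hg0 Hgy]]] := kill_factor Gl Fg0 sG.
pose H q := G (g' * q); have Hann : annihilates alpha p H := annihilates_mul g' Gann.
have Hl : lin2 H by case: Hann.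
have Hx q : H ('X%:P * q) = x * H q.
  have : H (('X - x%:P)%:P * q) = 0 by rewrite /H /G (mulrCA g') Fgx.
  by rewrite polyCB mulrBl Hl.1 (lin2N _ Hl) Hl.2 => /eqP; rewrite subr_eq0 => /eqP.
have Hy q : H ('X * q) = y * H q.
  have := Hgy q; rewrite -/(H _).
  by rewrite mulrBl Hl.1 (lin2N _ Hl) Hl.2 => /eqP; rewrite subr_eq0 => /eqP.
have HE k l : H (mono R k l) = H 1 * x ^+ k * y ^+ l.
  elim: k => [|k IH].
    elim: l => [|l IH]; first by rewrite /mono !expr0 !mulr1.
    by rewrite /mono exprS mulrCA Hy -/(mono R 0 l) IH !expr0 !mulr1 exprS mulrCA.
  by rewrite /mono exprS polyCM -mulrA Hx -/(mono R k l) IH exprS; ring.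
exists H, x, y, (H 1); split => //.
apply/eqP => H10; case: Hg0 => q /eqP; apply.
by apply: (lin2_eq0 Hl) => k l; rewrite HE H10 !mul0r.
Qed.

End Eigenfunctionals.

(** * Bounded evaluations and zeros on the boundary of the bidisk *)

Section Eigenvalues.
Variable R : realType.
Local Notation C := R[i].
Local Notation P2 := {poly {poly C}}.
Implicit Types (p q g : P2) (F : P2 -> C) (alpha : R).

Lemma weight_le_pow alpha : exists A, forall d, weight alpha d <= d.+1%:R ^+ A :> R.
Proof.
exists (Num.truncn `|alpha|).+1 => d; rewrite /weight -powR_mulrn//.
apply: ler_powR; first by rewrite ler1n.
by apply: le_trans (ler_norm _) _; rewrite ltW// truncnS_gt.
Qed.

(** The values of F on powers of one variable are geometric, while boundedness
    allows polynomial growth only. *)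
Lemma eigenvalue_le1 alpha F (x y c : C) : dual_bounded alpha F -> c != 0 ->
  (forall k l, F (mono R k l) = c * x ^+ k * y ^+ l) -> normc x <= 1 /\ normc y <= 1.
Proof.
move=> [K FK] c0 FE; have [A wA] := weight_le_pow alpha.
have c1 : 0 < normc c ^+ 2 by rewrite exprn_gt0// normc_gt0.
have le1 (z : R) : 0 <= z ->
    (forall k, normc c ^+ 2 * (z ^+ k) ^+ 2 / weight alpha k <= K) -> z <= 1.
  move=> z0 zK; rewrite -(@expr_le1 _ 2)//.
  apply: (@poly_growth _ _ (K / normc c ^+ 2) A); first exact: sqr_ge0.
  move=> k; rewrite mulrAC ler_pdivlMr// mulrC.
  have := zK k; rewrite ler_pdivrMr ?weight_gt0// -!exprM mulnC => /le_trans; apply.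
  apply: ler_wpM2l (wA k); apply: le_trans (zK 0%N).
  by rewrite divr_ge0 ?weight_ge0// mulr_ge0// sqr_ge0.
have G0 k l : 0 <= normc (F (mono R k l)) ^+ 2 / weight alpha (k + l).
  by rewrite divr_ge0 ?sqr_ge0 ?weight_ge0.
split; apply: le1 => [|k]; rewrite ?normc_ge0//; apply: le_trans (FK k.+1).
  have := @term_le_boxsum _ k.+1 k 0 _ G0 (leqnn _) isT.
  by rewrite FE expr0 mulr1 addn0 normcM normcX exprMn.
have := @term_le_boxsum _ k.+1 0 k _ G0 isT (leqnn _).
by rewrite FE expr0 mulr1 add0n normcM normcX exprMn.
Qed.

(** Doubling a box adds n^2 terms with n < k + l + 1 <= 3 n, hence at
    least 1 / 9. *)
Lemma boxsum_weight_unbounded alpha K : alpha <= 2 ->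
  exists n, K < boxsum n (fun k l => (weight alpha (k + l))^-1).
Proof.
move=> a2; pose G k l : R := (weight alpha (k + l))^-1.
have G0 k l : 0 <= G k l by rewrite invr_ge0 weight_ge0.
have double n : (0 < n)%N -> boxsum n G + 9%:R^-1 <= boxsum (n + n) G.
  move=> n0; have n0' : 0 < n%:R :> R by rewrite ltr0n.
  rewrite !boxsumE big_split_ord /=; apply: lerD.
    apply: ler_sum => k _; rewrite big_split_ord /= lerDl; exact: sumr_ge0.
  apply: (@le_trans _ _ (\sum_(k < n) \sum_(l < n) ((3 * n%:R) ^+ 2)^-1)).
    under eq_bigr do rewrite sumr_const card_ord.
    rewrite sumr_const card_ord -mulrnA le_eqVlt; apply/orP; left; apply/eqP.
    by rewrite -[RHS]mulr_natr natrM; field; rewrite gt_eqF.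
  apply: ler_sum => k _; rewrite big_split_ord /=; apply: ler_wpDr.
    exact: sumr_ge0.
  apply: ler_sum => l _; rewrite /G lef_pV2 ?posrE ?weight_gt0 ?exprn_gt0 ?mulr_gt0//.
  apply: (@le_trans _ _ ((n + k + l).+1%:R `^ 2)).
    by rewrite ler_powR// ler1n.
  rewrite powR_mulrn// lerXn2r ?nnegrE ?mulr_ge0// -natrM ler_nat.
  by have := ltn_ord k; have := ltn_ord l; lia.
have grow j : j%:R / 9%:R <= boxsum (2 ^ j) G.
  elim: j => [|j IH]; first by rewrite mul0r boxsum_ge0.
  rewrite expnS mul2n -addnn; apply: le_trans (double _ _); last by rewrite expn_gt0.
  by rewrite -natr1 mulrDl mul1r lerD2r.
pose j := (Num.truncn (K * 9%:R)).+1; exists (2 ^ j)%N.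
by apply: lt_le_trans (grow j); rewrite ltr_pdivlMr ?ltr0n// truncnS_gt.
Qed.

Lemma eigenvalue_torus alpha F (x y c : C) : alpha <= 2 -> dual_bounded alpha F ->
  c != 0 -> (forall k l, F (mono R k l) = c * x ^+ k * y ^+ l) ->
  ~ (normc x = 1 /\ normc y = 1).
Proof.
move=> a2 [K FK] c0 FE [x1 y1].
have c1 : 0 < normc c ^+ 2 by rewrite exprn_gt0// normc_gt0.
have [n] := boxsum_weight_unbounded (K / normc c ^+ 2) a2.
rewrite ltr_pdivrMr// mulrC -boxsumZ ltNge => /negP; apply.
apply: le_trans (FK n); apply: le_boxsum => k l _ _.
by rewrite FE !normcM !normcX x1 y1 !expr1n !mulr1.
Qed.

(** A polynomial of degree at most m without zeros in the disk is comparable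
    to a constant on smaller disks, as each of its linear factors is. *)
Lemma harnack m (h : {poly C}) (r : R) z w : (size h <= m.+1)%N -> 0 <= r < 1 ->
    (forall t, normc t < 1 -> h.[t] != 0) -> normc z <= r -> normc w <= r ->
  (1 - r) ^+ m * normc h.[z] <= (1 + r) ^+ m * normc h.[w].
Proof.
move=> szh /andP[r0 r1] h0 zr wr; have [s [<- s1 ->]] := factor_disk_free szh h0.
rewrite !hornerZ !normcM mulrCA [leRHS]mulrCA ler_wpM2l ?normc_ge0//.
rewrite !horner_prod !normc_prod {szh h0 h}.
have bound a t : normc a <= 1 -> normc t <= r -> 1 - r <= normc (1 - a *: 'X).[t] <= 1 + r.
  move=> a1 tr; have atr : normc (a * t) <= r.
    by rewrite normcM -[r]mul1r ler_pM ?normc_ge0.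
  have -> : (1 - a *: 'X).[t] = 1 - a * t by rewrite !hornerE.
  apply/andP; split; last first.
    by apply: (le_trans (normc_triangle _ _)); rewrite normc1 normc_opp lerD2l.
  rewrite lerBlDr; apply: le_trans (lerD (lexx _) atr).
  by rewrite -[leLHS](@normc1 R) -{1}(subrK (a * t) 1) normc_triangle.
elim: s s1 => [|a s IH] s1; first by rewrite !big_nil !expr0.
rewrite !big_cons !exprS (mulrACA (1 - r)) (mulrACA (1 + r)).
have a1 : normc a <= 1 by apply: s1; rewrite mem_head.
have {}IH := IH (fun b bs => s1 b (mem_behead (bs : b \in behead (a :: s)))).
have /andP[z1 z2] := bound a z a1 zr; have /andP[w1 w2] := bound a w a1 wr.
apply: ler_pM => //; first by rewrite mulr_ge0 ?normc_ge0// subr_ge0 ltW.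
  by rewrite mulr_ge0 ?exprn_ge0 ?subr_ge0 ?(ltW r1)// prodr_ge0// => b _; exact: normc_ge0.
by rewrite mulrC ler_pM ?normc_ge0 ?subr_ge0 ?(ltW r1).
Qed.

(** The difference is divisible by X - x. *)
Lemma horner_lipschitz (g : {poly C}) (x : C) : normc x = 1 -> exists K, 0 <= K /\
  forall r : R, 0 <= r <= 1 -> normc (g.[r%:C * x] - g.[x]) <= K * (1 - r).
Proof.
move=> x1; have /factor_theorem[u uE] : root (g - g.[x]%:P) x.
  by apply/eqP; rewrite !hornerE subrr.
exists (\sum_(i < size u) normc u`_i); split; first by apply: sumr_ge0 => i _; exact: normc_ge0.
move=> r /andP[r0 r1].
have -> : g.[r%:C * x] - g.[x] = (g - g.[x]%:P).[r%:C * x] by rewrite !hornerE.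
rewrite uE hornerM hornerXsubC normcM ler_pM ?normc_ge0//.
  rewrite horner_coef; apply: (le_trans (normc_sum _ _ _)); apply: ler_sum => i _.
  rewrite normcM normcX normcM x1 mulr1 normc_real ger0_norm//.
  by rewrite ler_piMr ?normc_ge0// exprn_ile1.
have -> : r%:C * x - x = (r - 1)%:C * x by rewrite rmorphB rmorph1 mulrBl mul1r.
by rewrite normcM x1 mulr1 normc_real -normrN opprB ger0_norm ?subr_ge0.
Qed.

(** Hurwitz: p(s x, .) has no zeros in the disk for s < 1, so [harnack] compares
    its values at w and at any other z; the comparison persists as s tends to
    1, where the value at w is 0. *)
Lemma fix1_eq0_of_zero p (x w : C) : (forall z, bidisk z -> peval p z <> 0) ->
  normc x = 1 -> normc w < 1 -> peval p (x, w) = 0 -> fix1 p x = 0.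
Proof.
move=> p_neq0 x1 w1 pxw; apply: poly_eq_disk => z z1; rewrite horner0 horner_fix1.
pose r := Num.max (normc z) (normc w).
have r01 : 0 <= r < 1 by rewrite le_max normc_ge0 gt_max z1 w1.
have zr : normc z <= r by rewrite le_max lexx.
have wr : normc w <= r by rewrite le_max lexx orbT.
have [K1 [K10 K1P]] := @horner_lipschitz p.[w%:P] x x1.
have [K2 [K20 K2P]] := @horner_lipschitz p.[z%:P] x x1.
pose m := (size p).-1; pose A := (1 - r) ^+ m; pose B := (1 + r) ^+ m.
have A0 : 0 < A by rewrite exprn_gt0// subr_gt0; case/andP: r01.
have B0 : 0 <= B by rewrite exprn_ge0// addr_ge0//; case/andP: r01.
have key s : 0 <= s < 1 -> A * normc (peval p (x, z)) <= (B * K1 + A * K2) * (1 - s).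
  move=> /andP[s0 s1]; have s01 : 0 <= s <= 1 by rewrite s0 ltW.
  have sx : normc (s%:C * x) < 1 by rewrite normcM x1 mulr1 normc_real ger0_norm.
  have H : A * normc (fix1 p (s%:C * x)).[z] <= B * normc (fix1 p (s%:C * x)).[w].
    apply: harnack => //; first by apply: leq_trans (size_fix1 _ _) _; rewrite /m leqSpred.
    move=> t t1; rewrite horner_fix1; apply/eqP/p_neq0.
    by split; rewrite normc_lt1.
  have Hw := K1P s s01; have Hz := K2P s s01.
  rewrite -[p.[w%:P].[x]]/(peval p (x, w)) pxw subr0 in Hw.
  have zle : normc (peval p (x, z)) <= normc (fix1 p (s%:C * x)).[z] + K2 * (1 - s).
    rewrite -[peval p (x, z)](subrK (fix1 p (s%:C * x)).[z]) addrC.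
    apply: (le_trans (normc_triangle _ _)); rewrite lerD2l normc_subr horner_fix1.
    exact: Hz.
  rewrite !horner_fix1 in H zle.
  rewrite -[p.[w%:P].[_]]/(peval p (s%:C * x, w)) in Hw.
  apply: le_trans (ler_wpM2l (ltW A0) zle) _.
  rewrite mulrDr mulrDl -!mulrA lerD2r; apply: (le_trans H).
  exact: ler_wpM2l.
have : A * normc (peval p (x, z)) <= 0.
  apply/ler_addgt0Pr => e e0; rewrite add0r.
  pose L := B * K1 + A * K2; have L0 : 0 <= L by rewrite addr_ge0 ?mulr_ge0 ?(ltW A0).
  pose d := Num.min 1 (e / (L + 1)).
  have d0 : 0 < d by rewrite lt_min ltr01 divr_gt0// ltr_wpDl.
  have d1 : d <= 1 by rewrite ge_min lexx.
  apply: le_trans (key (1 - d) _) _; first by rewrite subr_ge0 d1 ltrBlDr ltrDl.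
  rewrite opprB addrCA subrr addr0.
  apply: (@le_trans _ _ (L * (e / (L + 1)))).
    by rewrite ler_wpM2l// ge_min lexx orbT.
  by rewrite mulrCA ger_pMr// ler_pdivrMr ?ltr_wpDl// mul1r lerDl.
rewrite pmulr_rle0// => pz; apply: (@eq0_normc R).
by apply/le_anti; rewrite pz normc_ge0.
Qed.

End Eigenvalues.

(** * The reflection of p and its zeros on the torus *)

Section TorusZeros.
Variable R : realType.
Local Notation C := R[i].
Local Notation P2 := {poly {poly C}}.
Implicit Types (p q g : P2) (F : P2 -> C) (alpha : R).

(** p has no component in common with its reflection, as witnessed by
    eliminating either variable. *)
Definition transversal n m p := exists r s : {poly C},
  [/\ r != 0, s != 0,
      exists u v, r%:P = u * p + v * reflect2 n m p &
      exists u v, s^:P = u * p + v * reflect2 n m p].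

Definition torus_over p :=
  forall x : C, normc x = 1 -> exists y, normc y = 1 /\ peval p (x, y) = 0.

Lemma peval_inner (s : {poly C}) z : peval (s^:P) z = s.[z.2].
Proof. by rewrite /peval horner_map hornerC. Qed.

Lemma bidisk_swap p : (forall z, bidisk z -> peval p z <> 0) ->
  forall z, bidisk z -> peval (swapXY p) z <> 0.
Proof. by move=> p_neq0 z [z1 z2]; rewrite peval_swap; apply: p_neq0. Qed.

(** On the torus the reflection of p vanishes where p does. *)
Lemma transversal_zero n m p (r u v : P2) z :
    (size p <= m.+1)%N -> (sizeY p <= n.+1)%N ->
    r = u * p + v * reflect2 n m p -> torus2 z -> peval p z = 0 -> peval r z = 0.
Proof.
move=> szp szYp -> zT pz; rewrite pevalD !pevalM peval_reflect2// pz.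
by rewrite conjc0 !mulr0 addr0.
Qed.

(** Modulo p, the k-th power of an element of the ideal is a multiple of the
    k-th power of the reflection. *)
Lemma annihilates_ideal_pow alpha n m p F k (r u v : P2) :
    annihilates alpha p F ->
    (forall G, annihilates alpha p G -> G (reflect2 n m p ^+ k) = 0) ->
    r = u * p + v * reflect2 n m p ->
  forall q, F (r ^+ k * q) = 0.
Proof.
move=> Fann kill -> q; set x := u * p; set y := v * _.
have Fl : lin2 F by case: Fann.
have -> : (x + y) ^+ k * q = p * (u * (\sum_(i < k) (x + y) ^+ (k.-1 - i) * y ^+ i) * q) +
    (v ^+ k * q) * reflect2 n m p ^+ k.
  have := subrXX (x + y) y k; rewrite addrK => /eqP; rewrite subr_eq => /eqP ->.
  rewrite mulrDl /y exprMn; congr (_ + _); last by rewrite mulrAC.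
  by rewrite /x !mulrA (mulrC p u).
rewrite Fl.1; case: (Fann) => _ _ ->; rewrite add0r.
exact: (kill (fun x => F (v ^+ k * q * x)) (annihilates_mul _ Fann)).
Qed.

(** Some multiple of a nonzero annihilating functional would be the evaluation at
    a zero of p, up to a scalar. Boundedness puts this zero in the closed bidisk;
    on a face of the boundary, p would vanish on a whole circle of the torus,
    where a nonzero one-variable polynomial should vanish too. *)
Lemma transversal_cyclic alpha n m p F :
    (size p <= m.+1)%N -> (sizeY p <= n.+1)%N ->
    (forall z, bidisk z -> peval p z <> 0) -> transversal n m p ->
    alpha <= 2 \/ zero_set p `&` torus2 = set0 ->
  annihilates alpha p F -> forall q, F q = 0.
Proof.
move=> szp szYp p_neq0 [r [s [r0 s0 [u [v rE]] [u' [v' sE]]]]] side Fann.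
have rz z : torus2 z -> peval p z = 0 -> r.[z.1] = 0.
  move=> zT pz; rewrite -(peval_outer r z).
  exact: (transversal_zero szp szYp rE zT pz).
have sz z : torus2 z -> peval p z = 0 -> s.[z.2] = 0.
  move=> zT pz; rewrite -(peval_inner s z).
  exact: (transversal_zero szp szYp sE zT pz).
have [k kill] := annihilates_reflect_pow szp szYp p_neq0 alpha.
move=> q; apply: contrapT => /eqP Fq.
have [||||F' [x [y [c [F'ann c0 F'E]]]]] :=
    @common_eigenfunctional _ alpha p F (r ^+ k) (s ^+ k) Fann (ex_intro _ q Fq).
- by rewrite expf_neq0.
- by rewrite expf_neq0.
- by move=> q'; rewrite polyC_exp; exact: annihilates_ideal_pow kill rE q'.
- by move=> q'; rewrite rmorphXn; exact: annihilates_ideal_pow kill sE q'.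
have [F'l F'b F'p] := F'ann.
have [x1 y1] := eigenvalue_le1 F'b c0 F'E.
have pxy : peval p (x, y) = 0.
  have := F'p 1; rewrite mulr1 (lin2_box F'l (leqnn _)).
  rewrite (eq_boxsum (G := fun k l => c * (coef2 p k l * monomial (k, l) (x, y)))).
    rewrite boxsumZ -peval_box// => /eqP.
    by rewrite mulf_eq0 (negbTE c0) => /eqP.
  by move=> i j _ _; rewrite F'E /monomial /=; ring.
have T (w : C) : normc w = 1 -> `|w| = 1 by move=> w1; apply/normc_eq1.
move: x1 y1; rewrite !le_eqVlt => /orP[/eqP x1|x1] /orP[/eqP y1|y1].
- case: side => [a2|Z0]; first exact: (eigenvalue_torus a2 F'b c0 F'E).
  suff : set0 (x, y) by [].
  by rewrite -Z0; split => //; split; apply: T.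
- have px0 := fix1_eq0_of_zero p_neq0 x1 y1 pxy.
  move/eqP: s0; apply; apply: poly_eq_circle => w w1; rewrite horner0.
  apply: (sz (x, w)); first by split; apply: T.
  by rewrite -horner_fix1 px0 horner0.
- have pyx : peval (swapXY p) (y, x) = 0 by rewrite peval_swap.
  have py0 := fix1_eq0_of_zero (bidisk_swap p_neq0) y1 x1 pyx.
  move/eqP: r0; apply; apply: poly_eq_circle => w w1; rewrite horner0.
  apply: (rz (w, y)); first by split; apply: T.
  by have := peval_swap p (y, w); rewrite /= -horner_fix1 py0 horner0.
- by apply: (p_neq0 (x, y)) => //; split; rewrite normc_lt1.
Qed.

(** Each coordinate of a common zero is a root of a one-variable polynomial. *)
Lemma transversal_finite n m p : (size p <= m.+1)%N -> (sizeY p <= n.+1)%N ->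
  transversal n m p -> finite_set (zero_set p `&` torus2).
Proof.
move=> szp szYp [r [s [r0 s0 [u [v rE]] [u' [v' sE]]]]].
have fin (t : {poly C}) : t != 0 -> finite_set [set x | t.[x] = 0].
  move=> t0; have [rs tE] := closed_field_poly_normal t.
  apply: (sub_finite_set _ (finite_seq rs)) => x /= tx.
  have : root t x by apply/eqP.
  by rewrite tE rootZ ?lead_coef_eq0// root_prod_XsubC.
apply: (sub_finite_set _ (finite_setX (fin r r0) (fin s s0))) => z [pz zT]; split.
  by rewrite /= -(peval_outer r z); exact: (transversal_zero szp szYp rE zT pz).
by rewrite /= -(peval_inner s z); exact: (transversal_zero szp szYp sE zT pz).
Qed.

(** When p divides its reflection, the zeros of each polynomial p(x, .) with
    |x| = 1 are symmetric in the circle, and none lies inside. *)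
Lemma torus_over_of_dvd n m p u : size p = m.+1 -> (0 < m)%N ->
    (sizeY p <= n.+1)%N -> (forall z, bidisk z -> peval p z <> 0) ->
  reflect2 n m p = u * p -> torus_over p.
Proof.
move=> szp m0 szYp p_neq0 pE x x1.
have szp' : (size p <= m.+1)%N by rewrite szp.
have p0 : p != 0 by rewrite -size_poly_gt0 szp.
have szu : (size u <= 1)%N.
  have [->|u0] := eqVneq u 0; first by rewrite size_poly0.
  have : (size (u * p)%R <= m.+1)%N by rewrite -pE size_poly.
  by rewrite size_mul// szp addnS /= -[m.+1]add1n leq_add2r.
have uE := size1_polyC szu; set u0 := u`_0 in uE.
have [q0|q0] := eqVneq (fix1 p x) 0.
  by exists 1; rewrite normc1 -horner_fix1 q0 horner0.
set q := fix1 p x in q0.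
have szq : (size q <= m.+1)%N by rewrite (leq_trans (size_fix1 _ _)).
have qE : x ^+ n *: reflect_poly m q = u0.[x] *: q.
  apply: poly_eq_circle => y y1; rewrite !hornerZ horner_reflect_unit//.
  rewrite /q !horner_fix1 mulrA.
  have := peval_reflect2 szp' szYp (_ : torus2 (x, y)); rewrite pE uE pevalM peval_outer /= => ->//.
  by split; apply/normc_eq1.
have xn0 : x ^+ n != 0 by rewrite expf_neq0// normc_unit_neq0.
have out t : q.[t] = 0 -> 1 <= normc t.
  move=> qt; rewrite leNgt; apply/negP => t1; move/eqP: q0; apply.
  by apply: (fix1_eq0_of_zero p_neq0 x1 t1); rewrite -horner_fix1.
have szq1 : size q != 1%N.
  apply/eqP => szq1.
  have := congr1 (fun f : {poly C} => f`_m) qE; rewrite !coefZ.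
  rewrite [q`_m]nth_default ?szq1// mulr0 coef_poly ltnSn subnn => /eqP.
  rewrite mulf_eq0 (negbTE xn0) conjc_eq0 => /eqP q00.
  by move/eqP: q0; apply; rewrite (size1_polyC (eq_leq szq1)) q00 polyC0.
have /closed_rootP[y /eqP qy] := szq1.
have y1 := out y qy.
have y0 : y != 0 by rewrite -normc_gt0 (lt_le_trans _ y1).
exists y; split; last by rewrite -horner_fix1.
apply/le_anti; rewrite y1 andbT.
have := congr1 (fun f : {poly C} => f.[y]) qE; rewrite !hornerZ qy mulr0.
rewrite horner_reflect// => /eqP; rewrite !mulf_eq0 (negbTE xn0) expf_eq0 (negbTE y0) andbF /=.
rewrite conjc_eq0 => /eqP/out; rewrite normcV normc_conj invf_ge1//.
by rewrite normc_gt0.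
Qed.

Lemma reflect2_swap n m p : (size p <= m.+1)%N -> (sizeY p <= n.+1)%N ->
  swapXY (reflect2 n m p) = reflect2 m n (swapXY p).
Proof.
move=> szp szYp; apply: poly2_eq_torus => -[x y] [/= x1 y1].
rewrite peval_swap !peval_reflect2 ?swapXYK -?sizeYE//=.
  by rewrite peval_swap /= [x ^+ m * _]mulrC.
by rewrite sizeYE swapXYK.
Qed.

(** [ideal_or_dvd] is used twice, with the variables exchanged the second
    time. *)
Lemma transversal_or_torus_over n m p : irreducible2 p ->
    size p = m.+1 -> sizeY p = n.+1 ->
    (forall z, bidisk z -> peval p z <> 0) ->
  transversal n m p \/ (torus_over p \/ torus_over (swapXY p)).
Proof.
move=> irr szp szYp p_neq0.
have szp' : (size p <= m.+1)%N by rewrite szp.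
have szYp' : (sizeY p <= n.+1)%N by rewrite szYp.
have szs : size (swapXY p) = n.+1 by rewrite -sizeYE.
have szYs : (sizeY (swapXY p) <= m.+1)%N by rewrite sizeYE swapXYK szp.
have [H1|[szp1 [u E]]] := ideal_or_dvd (reflect2 n m p) irr.1 irr.2; last first.
  right; left; apply: (torus_over_of_dvd szp _ szYp' p_neq0 E).
  by move: szp1; rewrite szp.
have irr' := irreducible2_swap irr.
have [H2|[szp1 [u E]]] := ideal_or_dvd (reflect2 m n (swapXY p)) irr'.1 irr'.2; last first.
  right; right; apply: (torus_over_of_dvd szs _ szYs (bidisk_swap p_neq0) E).
  by move: szp1; rewrite szs.
left; have [r [u [v [r0 rE]]]] := H1; have [s [u' [v' [s0 sE]]]] := H2.
exists r, s; split => //; first by exists u, v.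
exists (swapXY u'), (swapXY v'); rewrite -swapXY_polyC sE rmorphD !rmorphM /=.
by rewrite -reflect2_swap// !swapXYK.
Qed.

Lemma circle_infinite : infinite_set [set x : C | normc x = 1].
Proof.
move=> /finite_seqP[rs rsE].
have : \prod_(a <- rs) ('X - a%:P) = 0 :> {poly C}.
  apply: poly_eq_circle => x x1; rewrite horner0; apply/eqP.
  rewrite -rootE root_prod_XsubC.
  have : [set` rs] x by rewrite -rsE.
  by [].
by apply/eqP; rewrite monic_neq0// monic_prod_XsubC.
Qed.

Lemma torus_over_infinite p : torus_over p -> infinite_set (zero_set p `&` torus2).
Proof.
move=> pT /(finite_image fst); apply: contra_not circle_infinite => fin.
apply: sub_finite_set fin => x /= x1; have [y [y1 pxy]] := pT x x1.
by exists (x, y) => //; split => //; split; apply/normc_eq1.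
Qed.

Lemma torus_over_swap_infinite p : torus_over (swapXY p) ->
  infinite_set (zero_set p `&` torus2).
Proof.
move=> pT /(finite_image snd); apply: contra_not circle_infinite => fin.
apply: sub_finite_set fin => x /= x1; have [y [y1 pxy]] := pT x x1.
exists (y, x) => //; split; last by split; apply/normc_eq1.
by rewrite /zero_set /= -pxy peval_swap.
Qed.

End TorusZeros.

(** * Weak limits of functionals *)

Section WeakLimits.
Variable R : realType.
Local Notation C := R[i].
Local Notation P2 := {poly {poly C}}.
Implicit Types (p q g : P2) (F : P2 -> C) (alpha : R).

(** A cluster point of an ultrafilter is a limit, and a segment is compact. *)
Lemma ultra_cvg (U : set_system nat) (f : nat -> R) M : UltraFilter U ->
  (forall n, `|f n| <= M) -> exists l : R, f @ U --> l.
Proof.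
move=> UU fM; have fb : (f @ U) `[- M, M]%classic.
  by apply: (@filterE _ U) => n /=; rewrite in_itv /= -ler_norml.
have [l [_ lU]] := segment_compact _ fb.
exists l => A lA; have [//|UnA] := in_ultra_setVsetC (f @^-1` A) UU.
by have [x [nAx Ax]] := lU (~` A) A UnA lA.
Qed.

Lemma lin2_bound F q : lin2 F -> normc (F q) <=
  boxsum (bidim q) (fun k l => normc (coef2 q k l) * normc (F (mono R k l))).
Proof.
move=> Fl; rewrite {1}(lin2_box Fl (leqnn (bidim q))).
apply: (le_trans (normc_sum _ _ _)); apply: ler_sum => i _.
by rewrite normcM.
Qed.

(** Weak compactness: pointwise limits along a free ultrafilter are linear and
    are approached simultaneously at finitely many polynomials, for arbitrarily
    large indices. *)
Lemma weak_limit_point (Phi : nat -> P2 -> C) : (forall n, lin2 (Phi n)) ->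
    (forall k l, exists M, forall n, normc (Phi n (mono R k l)) <= M) ->
  exists L : P2 -> C, lin2 L /\
    forall (qs : seq P2) e N, 0 < e -> exists n, (N <= n)%N /\
      {in qs, forall q, normc (Phi n q - L q) <= e}.
Proof.
move=> Phil Mb.
have bounded q : exists M, forall n, normc (Phi n q) <= M.
  have /choice[M MP] : forall kl : nat * nat, exists M,
      forall n, normc (Phi n (mono R kl.1 kl.2)) <= M by move=> kl; exact: Mb.
  exists (boxsum (bidim q) (fun k l => normc (coef2 q k l) * M (k, l))) => n.
  apply: le_trans (lin2_bound _ (Phil n)) _; apply: le_boxsum => k l _ _.
  by rewrite ler_wpM2l ?normc_ge0//; exact: (MP (k, l)).
have [U [UU ooU]] := ultraFilterLemma (eventually_filter : ProperFilter \oo).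
have /choice[L LP] : forall q, exists l : C,
    ((fun n => complex.Re (Phi n q)) @ U --> complex.Re l) /\
    ((fun n => complex.Im (Phi n q)) @ U --> complex.Im l).
  move=> q; have [M MP] := bounded q.
  have [a aP] := @ultra_cvg U (fun n => complex.Re (Phi n q)) M UU
    (fun n => le_trans (Re_le_normc _) (MP n)).
  have [b bP] := @ultra_cvg U (fun n => complex.Im (Phi n q)) M UU
    (fun n => le_trans (Im_le_normc _) (MP n)).
  by exists (a +i* b).
have near_L q e : 0 < e -> U [set n | normc (Phi n q - L q) <= e].
  move=> e0; have e2 : 0 < e / 2 by rewrite divr_gt0.
  have [LR LI] := LP q.
  have /cvgrPdist_le/(_ _ e2) HR := LR; have /cvgrPdist_le/(_ _ e2) HI := LI.
  apply: filterS2 HR HI => n /= hR hI.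
  apply: (le_trans (normc_le_Re_Im _)); rewrite (splitr e).
  by rewrite !raddfB /= distrC [X in _ + X]distrC lerD.
have near_all (qs : seq P2) e N : 0 < e -> exists n, (N <= n)%N /\
    {in qs, forall q, normc (Phi n q - L q) <= e}.
  move=> e0; suff : U [set n | (N <= n)%N /\ {in qs, forall q, normc (Phi n q - L q) <= e}].
    by move=> /filter_ex[n nP]; exists n.
  elim: qs => [|q qs IH].
    by apply: filterS (ooU _ (nbhs_infty_ge N)) => n /= Nn; split.
  apply: filterS2 (near_L q e e0) IH => n /= nq [Nn nqs]; split => // x.
  by rewrite in_cons => /orP[/eqP ->|/nqs].
exists L; split => //.
have eq_of_small (x y : C) : (forall e, 0 < e -> normc (x - y) <= e) -> x = y.
  move=> xy; apply/eqP; rewrite -subr_eq0; apply/eqP/(@eq0_normc R)/le_anti.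
  rewrite normc_ge0 andbT; apply/ler_addgt0Pr => e e0; rewrite add0r; exact: xy.
split=> [q r|c q]; apply: eq_of_small => e e0.
  have e3 : 0 < e / 3%:R by rewrite divr_gt0.
  have [n [_ nP]] := near_all [:: q; r; q + r] _ 0%N e3.
  have Hq := nP q; have Hr := nP r; have Hqr := nP (q + r).
  have -> : L (q + r) - (L q + L r) =
      - (Phi n (q + r) - L (q + r)) + ((Phi n q - L q) + (Phi n r - L r)).
    by rewrite (Phil n).1; ring.
  apply: (le_trans (normc_triangle _ _)); rewrite normc_opp.
  apply: le_trans (lerD (lexx _) (normc_triangle _ _)) _.
  apply: le_trans (lerD (Hqr _) (lerD (Hq _) (Hr _))) _; rewrite ?inE ?eqxx ?orbT//.
  lra.
have c0 : 0 < normc c + 1 by rewrite ltr_wpDl ?normc_ge0.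
have ec : 0 < e / (normc c + 1) by rewrite divr_gt0.
have [n [_ nP]] := near_all [:: q; c%:P%:P * q] _ 0%N ec.
have Hq := nP q; have Hcq := nP (c%:P%:P * q).
have -> : L (c%:P%:P * q) - c * L q =
    - (Phi n (c%:P%:P * q) - L (c%:P%:P * q)) + c * (Phi n q - L q).
  by rewrite (Phil n).2; ring.
apply: (le_trans (normc_triangle _ _)); rewrite normc_opp normcM.
apply: le_trans (lerD (Hcq _) (ler_wpM2l (normc_ge0 c) (Hq _))) _; rewrite ?inE ?eqxx ?orbT//.
rewrite -{1}[e / _]mul1r -mulrDl addrC mulrCA mulfV ?mulr1// gt_eqF//.
Qed.

(** The bound is required only on boxes of size at most the index, as arbitrarily
    large indices are available. The constant doubles because finitely many
    values are only known up to a small error e, with (a + e)^2 <= 2 a^2 + 2 e^2. *)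
Lemma weak_limit alpha (Phi : nat -> P2 -> C) K : (forall n, lin2 (Phi n)) ->
    (forall k l, exists M, forall n, normc (Phi n (mono R k l)) <= M) ->
    (forall n N, (N <= n)%N ->
      boxsum N (fun k l => normc (Phi n (mono R k l)) ^+ 2 / weight alpha (k + l)) <= K) ->
  exists L : P2 -> C, [/\ lin2 L, dual_bounded alpha L &
    forall (qs : seq P2) e N, 0 < e -> exists n, (N <= n)%N /\
      {in qs, forall q, normc (Phi n q - L q) <= e}].
Proof.
move=> Phil Mb PhiK; have [L [Ll LP]] := weak_limit_point Phil Mb.
exists L; split => //; exists (2 * K + 2) => N.
pose W := boxsum N (fun k l => (weight alpha (k + l))^-1).
have W0 : 0 <= W by apply: boxsum_ge0 => k l; rewrite invr_ge0 weight_ge0.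
pose e := (W + 1)^-1; have e0 : 0 < e by rewrite invr_gt0 ltr_wpDl.
have e1 : e <= 1 by rewrite invf_le1 ?ltr_wpDl// lerDr.
have [n [Nn nP]] := LP [seq mono R i.1 i.2 | i <- [seq (k, l) | k <- iota 0 N, l <- iota 0 N]] e N e0.
apply: (@le_trans _ _ (2 * boxsum N (fun k l =>
    normc (Phi n (mono R k l)) ^+ 2 / weight alpha (k + l)) + 2 * (e ^+ 2 * W))).
  rewrite -!boxsumZ -boxsumD; apply: le_boxsum => k l kN lN.
  rewrite !mulrA -mulrDl ler_wpM2r ?invr_ge0 ?weight_ge0//.
  have : normc (L (mono R k l)) <= normc (Phi n (mono R k l)) + e.
    rewrite -[L _](subrK (Phi n (mono R k l))) addrC.
    apply: le_trans (normc_triangle _ _) _; rewrite lerD2l normc_subr; apply: nP.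
    by apply/mapP; exists (k, l) => //; apply/allpairsP; exists (k, l); rewrite !mem_iota.
  move: (normc_ge0 (L (mono R k l))) (normc_ge0 (Phi n (mono R k l))).
  move: (normc (L _)) (normc (Phi _ _)) => x y x0 y0 xy; move: (e) e0 xy => d d0 xy.
  have h1 : 0 <= (y + d - x) * (y + d + x).
    apply: mulr_ge0; first by rewrite subr_ge0.
    by apply: addr_ge0 => //; apply: addr_ge0 => //; exact: ltW.
  have h2 := sqr_ge0 (y - d); rewrite -subr_ge0.
  have -> : 2 * y * y + 2 * d * d - x ^+ 2 = (y + d - x) * (y + d + x) + (y - d) ^+ 2.
    by ring.
  exact: addr_ge0.
apply: lerD; first by rewrite ler_wpM2l// PhiK.
rewrite -[leRHS]mulr1 ler_wpM2l// expr2 -mulrA mulr_ile1 ?(ltW e0)//.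
  by rewrite mulr_ge0 ?(ltW e0).
by rewrite mulrC ler_pdivrMr ?ltr_wpDl// mul1r lerDl.
Qed.

End WeakLimits.

(** * Annihilating functionals carried by the torus *)

Section BoundedFunctionals.
Variable R : realType.
Local Notation C := R[i].
Local Notation P2 := {poly {poly C}}.
Implicit Types (p q g : P2) (F : P2 -> C) (alpha : R).

Lemma weight_anti alpha d e : 0 <= alpha -> (d <= e)%N ->
  (weight alpha e)^-1 <= (weight alpha d)^-1 :> R.
Proof.
move=> a0 de; rewrite lef_pV2 ?posrE ?weight_gt0// /weight.
by rewrite ge0_ler_powR ?nnegrE// ler_nat.
Qed.

(** The sum S(n) of the first n terms satisfies S(2 n + 1) <= 1 + rho S(n) with
    rho = 2^(1 - alpha) < 1, and S(n) <= S(2 n + 1). *)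
Lemma weight_summable alpha : 1 < alpha -> exists K, forall n,
  \sum_(l < n) (weight alpha l)^-1 <= K :> R.
Proof.
move=> a1; pose t l : R := (weight alpha l)^-1.
have a0 : 0 <= alpha by rewrite ltW// (lt_trans ltr01).
have t0 l : 0 <= t l by rewrite invr_ge0 weight_ge0.
pose rho : R := 2 * (2 `^ alpha)^-1.
have rho1 : rho < 1.
  rewrite /rho ltr_pdivrMr ?powR_gt0// mul1r -[X in X < _](@powRr1 R)//.
  have -> : alpha = 1 + (alpha - 1) by rewrite addrC subrK.
  rewrite powRD ?pnatr_eq0 ?implybT// ltr_pMr ?powR_gt0//.
  rewrite [X in X < _](_ : _ = 1 `^ (alpha - 1)); last by rewrite powR1.
  by rewrite gt0_ltr_powR ?nnegrE ?subr_gt0// ltr1n.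
(* The terms of index 2 n + 1 and 2 n + 2 are at most half of rho times the
   term of index n. *)
have step n : t (n.*2.+1) + t (n.*2.+2) <= rho * t n.
  have E : t n.*2.+1 = (2 `^ alpha)^-1 * t n.
    by rewrite /t /weight -invfM -powRM// -natrM; congr (_%:R `^ _)^-1; lia.
  rewrite /rho -mulrA -E mulr_natl mulr2n lerD2l.
  exact: weight_anti.
have double n : \sum_(l < n.*2.+1) t l <= 1 + rho * \sum_(l < n) t l.
  elim: n => [|n IH]; first by rewrite big_ord1 big_ord0 mulr0 addr0 /t /weight powR1 invr1.
  rewrite doubleS [X in X <= _]big_ord_recr [X in X + _ <= _]big_ord_recr /=.
  rewrite [in leRHS]big_ord_recr /= mulrDr.
  by rewrite -addrA [leRHS]addrA; apply: lerD; [exact: IH|exact: step].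
exists (1 - rho)^-1 => n; rewrite -[leRHS]mul1r ler_pdivlMr ?subr_gt0//.
rewrite mulrBr mulr1 lerBlDr [_ * rho]mulrC; apply: le_trans (double n).
rewrite -(big_mkord xpredT t) -(big_mkord xpredT t).
rewrite [leRHS](@big_cat_nat _ _ _ n) //= ?lerDl; last by lia.
by apply: sumr_ge0.
Qed.

(** There are d + 1 monomials of degree d, so the squared norm is the sum of
    (d + 1)^(1 - alpha). *)
Lemma annihilates_peval alpha p z : 2 < alpha -> torus2 z -> peval p z = 0 ->
  annihilates alpha p (fun q => peval q z).
Proof.
case: z => x y a2 [/= /normc_eq1 x1 /normc_eq1 y1] pz.
split; first exact: lin2_peval; last by move=> q; rewrite pevalM pz mul0r.
have [|K KP] := @weight_summable (alpha - 1); first by rewrite ltrBrDr.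
exists K => n; apply: (@le_trans _ _ (boxsum n (fun k l => (weight alpha (k + l))^-1))).
  apply: le_boxsum => k l _ _.
  by rewrite peval_mono /monomial /= normcM !normcX x1 y1 !expr1n mulr1 expr1n mul1r.
apply: le_trans (KP (n + n)%N).
apply: le_trans (boxsum_le_diag _ _) _ => [k l|]; first by rewrite invr_ge0 weight_ge0.
apply: ler_sum => d _.
under eq_bigr => l _ do rewrite subnK -1?ltnS//.
rewrite sumr_const card_ord -[leLHS]mulr_natr /weight.
rewrite ler_pdivrMl ?powR_gt0// ler_pdivlMr ?powR_gt0//.
rewrite mulrC -{2}[d.+1%:R](@powRr1 R)// -powRD ?pnatr_eq0 ?implybT//.
by rewrite subrK.
Qed.

(** A limit of means of point evaluations over a curve (x, eta x) in the zero set.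
    For fixed l, the values on z1^k z2^l are the Fourier coefficients of the
    unimodular function eta^l, so the sum of their squares is at most 1. The
    choice of eta is arbitrary, as only finitely many of its values enter each
    mean. *)
Lemma torus_over_functional alpha p : 1 < alpha -> torus_over p ->
  exists F, annihilates alpha p F /\ F 1 != 0.
Proof.
move=> a1 pT; have [K KP] := weight_summable a1.
have /choice[eta etaP] : forall x : C, exists y : C,
    normc x = 1 -> normc y = 1 /\ peval p (x, y) = 0.
  move=> x; have [x1|x1] := pselect (normc x = 1); last by exists 0.
  by have [y yP] := pT x x1; exists y.
have /choice[z zP] : forall n, exists z : C, n.+1.-primitive_root z.
  by move=> n; exact: ex_prim_root.
have z1 n j : normc (z n ^+ j) = 1 by rewrite normcX (prim_root_normc (zP n)) expr1n.
pose Phi n q : C := n.+1%:R^-1 * \sum_(j < n.+1) peval q (z n ^+ j, eta (z n ^+ j)).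
have Phil n : lin2 (Phi n).
  split=> [q r|c q]; rewrite /Phi.
    by rewrite -mulrDr -big_split; congr (_ * _); apply: eq_bigr => j _; rewrite pevalD.
  rewrite mulrCA; congr (_ * _); rewrite mulr_sumr; apply: eq_bigr => j _.
  by rewrite pevalM pevalC.
have mono1 n j k l : normc (peval (mono R k l) (z n ^+ j, eta (z n ^+ j))) = 1.
  rewrite peval_mono /monomial /= normcM !normcX (prim_root_normc (zP n)).
  by rewrite (etaP _ (z1 n j)).1 !expr1n mulr1.
have row n l : \sum_(k < n.+1) normc (Phi n (mono R k l)) ^+ 2 = 1.
  pose h : {poly C} := \poly_(j < n.+1) eta (z n ^+ j) ^+ l.
  have := parseval (zP n) (size_poly _ _ : (size h <= n.+1)%N).
  rewrite [X in _ = _ * X](eq_bigr (fun=> 1)); last first.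
    move=> j _; rewrite coef_poly ltn_ord normcX (etaP _ (z1 n j)).1.
    by rewrite !expr1n.
  rewrite sumr_const card_ord => E.
  transitivity (\sum_(k < n.+1) (n.+1%:R^-1) ^+ 2 * normc h.[z n ^+ k] ^+ 2).
    apply: eq_bigr => k _; rewrite /Phi normcM normcV normc_nat exprMn; congr (_ * normc _ ^+ 2).
    rewrite horner_poly; apply: eq_bigr => j _.
    by rewrite peval_mono /monomial /= -!exprM mulnC mulrC.
  rewrite -mulr_sumr E -[X in _ * (_ * X)]/(n.+1%:R) -expr2 -exprMn mulVf ?expr1n//.
have [|n N Nn|F [Fl Fb FP]] := @weak_limit R alpha Phi K Phil.
- move=> k l; exists 1 => n; rewrite /Phi normcM normcV normc_nat.
  rewrite ler_pdivrMl ?ltr0n// mulr1; apply: (le_trans (normc_sum _ _ _)).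
  under eq_bigr do rewrite mono1.
  by rewrite sumr_const card_ord.
- rewrite boxsumE exchange_big; apply: le_trans (KP N); apply: ler_sum => l _.
  apply: (@le_trans _ _ (\sum_(k < N) normc (Phi n (mono R k l)) ^+ 2 * (weight alpha l)^-1)).
    apply: ler_sum => k _; rewrite ler_wpM2l ?sqr_ge0//.
    by apply: weight_anti; [rewrite ltW// (lt_trans ltr01)|rewrite leq_addl].
  rewrite -mulr_suml ler_piMl ?invr_ge0 ?weight_ge0// -(row n l).
  rewrite -(big_mkord xpredT (fun k => normc (Phi n (mono R k l)) ^+ 2)).
  rewrite -(big_mkord xpredT (fun k => normc (Phi n (mono R k l)) ^+ 2)).
  rewrite [leRHS](@big_cat_nat _ _ _ N) //= ?lerDl; last exact: leqW.
  by apply: sumr_ge0 => k _; rewrite sqr_ge0.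
have limE q (c : C) : (forall n, Phi n q = c) -> F q = c.
  move=> qc; apply/eqP; rewrite eq_sym -subr_eq0; apply/eqP/(@eq0_normc R)/le_anti.
  rewrite normc_ge0 andbT; apply/ler_addgt0Pr => e e0; rewrite add0r.
  have [n [_ nP]] := FP [:: q] e 0%N e0.
  by rewrite -(qc n); apply: nP; rewrite inE.
exists F; split; last first.
  rewrite (limE _ 1) ?oner_neq0// => n; rewrite /Phi.
  rewrite (eq_bigr (fun=> 1)); last by move=> j _; rewrite /peval -polyC1 !hornerC.
  by rewrite sumr_const card_ord mulVf// pnatr_eq0.
split=> // q; apply: limE => n; rewrite /Phi big1 ?mulr0// => j _.
by rewrite pevalM (etaP _ (z1 n j)).2 mul0r.
Qed.

Lemma swapXY_mono k l : swapXY (mono R k l) = mono R l k.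
Proof.
apply: poly2P => i j; rewrite /coef2 coef_swapXY -/(coef2 _ _ _) -/(coef2 _ _ _).
by rewrite !coef2_mono andbC.
Qed.

Lemma annihilates_swap alpha p F : annihilates alpha (swapXY p) F ->
  annihilates alpha p (fun q => F (swapXY q)).
Proof.
move=> [Fl [K FK] Fp]; split; last by move=> q; rewrite rmorphM Fp.
  split=> [q r|c q]; first by rewrite rmorphD Fl.1.
  by rewrite rmorphM /= swapXY_polyC map_polyC Fl.2.
exists K => n; apply: le_trans (FK n); rewrite !boxsumE exchange_big /=.
apply: ler_sum => k _; apply: ler_sum => l _.
by rewrite swapXY_mono addnC.
Qed.

End BoundedFunctionals.

(** * Duality on polynomials *)

Section Duality.
Variable R : realType.
Variable alpha : R.
Local Notation C := R[i].
Local Notation P2 := {poly {poly C}}.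
Implicit Types (p q g h e : P2).
Local Notation w k l := (weight alpha (k + l)).

Definition norm2 q : R :=
  boxsum (bidim q) (fun k l => w k l * normc (coef2 q k l) ^+ 2).

(** The sum runs over a box adapted to e only, which makes linearity in q
    immediate. *)
Definition ip q e : C :=
  boxsum (bidim e) (fun k l => (w k l)%:C * (coef2 q k l * (coef2 e k l)^*%C)).

Lemma norm2_box q n : (bidim q <= n)%N ->
  boxsum n (fun k l => w k l * normc (coef2 q k l) ^+ 2) = norm2 q.
Proof.
by move=> qn; apply: boxsum_stable => // k l kl; rewrite coef2_bidim// normc0 expr0n mulr0.
Qed.

Lemma boxsum_le_norm2 q n :
  boxsum n (fun k l => w k l * normc (coef2 q k l) ^+ 2) <= norm2 q.
Proof.
rewrite -(norm2_box (leq_maxr n (bidim q))); apply: boxsum_mono (leq_maxl _ _).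
by move=> k l; rewrite mulr_ge0 ?weight_ge0 ?sqr_ge0.
Qed.

Lemma norm2_ge0 q : 0 <= norm2 q.
Proof.
by apply: boxsum_ge0 => k l; rewrite mulr_ge0 ?weight_ge0 ?sqr_ge0.
Qed.

Lemma ip_box q e n : (bidim e <= n)%N ->
  boxsum n (fun k l => (w k l)%:C * (coef2 q k l * (coef2 e k l)^*%C)) = ip q e.
Proof.
by move=> en; apply: boxsum_stable => // k l kl; rewrite (coef2_bidim kl) conjc0 !mulr0.
Qed.

Lemma lin2_ip e : lin2 (fun q => ip q e).
Proof.
split=> [q r|c q]; rewrite /ip.
  by rewrite -boxsumD; apply: eq_boxsum => k l _ _; rewrite coef2D mulrDl mulrDr.
by rewrite -boxsumZ; apply: eq_boxsum => k l _ _; rewrite coef2Z; ring.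
Qed.

Lemma ip_norm2 e : ip e e = (norm2 e)%:C.
Proof.
rewrite /ip /norm2 /boxsum rmorph_sum; apply: eq_bigr => i _.
by rewrite rmorphM /= -sqr_normc_conj.
Qed.

Lemma ip_conj q e : ip q e = (ip e q)^*%C.
Proof.
pose n := maxn (bidim q) (bidim e).
rewrite -(ip_box q (leq_maxr _ _ : bidim e <= n)%N) -(ip_box e (leq_maxl _ _ : bidim q <= n)%N).
rewrite /boxsum rmorph_sum; apply: eq_bigr => i _.
by rewrite !rmorphM /= conjcK oppr0 [X in _ = _ * X]mulrC.
Qed.

Lemma ip_mono k l e : ip (mono R k l) e = (w k l)%:C * (coef2 e k l)^*%C.
Proof.
pose n := maxn (maxn k l).+1 (bidim e).
rewrite -(ip_box _ (leq_maxr _ _ : bidim e <= n)%N).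
have kn : (k < n)%N by rewrite /n; lia.
have ln : (l < n)%N by rewrite /n; lia.
rewrite /boxsum (bigD1 (Ordinal kn, Ordinal ln)) //= coef2_mono !eqxx mul1r.
rewrite big1 ?addr0// => -[a b] /= ab; rewrite coef2_mono.
case: eqP => [ak|_]; last by rewrite mul0r mulr0.
case: eqP => [bl|_]; last by rewrite mul0r mulr0.
by case/eqP: ab; congr (_, _); apply: val_inj.
Qed.

Lemma ipBl q r e : ip (q - r) e = ip q e - ip r e.
Proof. by rewrite (lin2_ip e).1 (@lin2N _ (fun q => ip q e) _ (lin2_ip e)). Qed.

Lemma ipZl c q e : ip (c%:P%:P * q) e = c * ip q e.
Proof. exact: (lin2_ip e).2. Qed.

Lemma ipBr q r e : ip e (q - r) = ip e q - ip e r.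
Proof. by rewrite [LHS]ip_conj ipBl rmorphB /= -!ip_conj. Qed.

Lemma ipZr c q e : ip e (c%:P%:P * q) = c^*%C * ip e q.
Proof. by rewrite [LHS]ip_conj ipZl rmorphM /= -ip_conj. Qed.

Lemma norm2_sub_proj e h (s : R) :
  norm2 (e - (s%:C * ip e h)%:P%:P * h) =
  norm2 e - 2 * s * normc (ip e h) ^+ 2 + s ^+ 2 * normc (ip e h) ^+ 2 * norm2 h.
Proof.
set I := ip e h; set c := s%:C * I.
have cs : c^*%C = s%:C * I^*%C by rewrite rmorphM /= oppr0.
apply: (@complexI R); rewrite -ip_norm2 ipBl !ipBr !ipZl !ipZr (ip_conj h e) -/I.
have -> : (norm2 e - 2 * s * normc I ^+ 2 + s ^+ 2 * normc I ^+ 2 * norm2 h)%:C =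
    (norm2 e)%:C - 2 * s%:C * (normc I ^+ 2)%:C +
    s%:C ^+ 2 * (normc I ^+ 2)%:C * (norm2 h)%:C.
  by rewrite rmorphD rmorphB !rmorphM rmorph_nat.
by rewrite !sqr_normc_conj -!ip_norm2 cs /c; ring.
Qed.

(** Replacing e by e - s <e, h> h, with s = 1 / (|h|^2 + 1), decreases its squared
    norm by at least s |<e, h>|^2. *)
Lemma ip_near_min e h (d delta : R) : norm2 e <= d + delta ->
    (forall c : C, d <= norm2 (e - c%:P%:P * h)) ->
  normc (ip e h) ^+ 2 <= (norm2 h + 1) * delta.
Proof.
move=> ed dmin; have H0 := norm2_ge0 h; set H := norm2 h in H0 *.
have H1 : 0 < H + 1 by rewrite ltr_wpDl.
set s := (H + 1)^-1; have := dmin (s%:C * ip e h); rewrite norm2_sub_proj -/H.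
have sH : s * (H + 1) = 1 by rewrite mulVf// gt_eqF.
have s0 : 0 < s by rewrite invr_gt0.
set t := normc _ ^+ 2; have t0 : 0 <= t by exact: sqr_ge0.
move=> D; have : s * t <= delta.
  have E : 2 * s * t - s ^+ 2 * t * H = s * t + s ^+ 2 * t.
    by rewrite expr2 (_ : s * s * t * H = s * t * (s * (H + 1)) - s * s * t); [rewrite sH; ring|ring].
  have : 0 <= s ^+ 2 * t by rewrite mulr_ge0 ?sqr_ge0.
  move: D E ed; move: (s ^+ 2 * t * H) (s ^+ 2 * t) (s * t) => u v x.
  rewrite -mulrA; move: (s * t) => y; lra.
by rewrite -ler_pdivrMl// -/s.
Qed.

Lemma norm2_triangle q r : norm2 (q - r) <= 2 * norm2 q + 2 * norm2 r.
Proof.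
pose n := maxn (bidim (q - r)) (maxn (bidim q) (bidim r)).
rewrite -(norm2_box (_ : bidim (q - r) <= n)%N) ?leq_maxl//.
rewrite -(norm2_box (_ : bidim q <= n)%N) -?(norm2_box (_ : bidim r <= n)%N);
  try by rewrite /n; lia.
rewrite -!boxsumZ -boxsumD; apply: le_boxsum => k l _ _; rewrite coef2B.
rewrite !(mulrCA 2) -mulrDr ler_wpM2l ?weight_ge0//.
have := normc_triangle (coef2 q k l) (- coef2 r k l); rewrite normc_opp.
have := normc_ge0 (coef2 q k l - coef2 r k l).
move: (normc _) (normc (coef2 q k l)) (normc (coef2 r k l)) => x y z x0 xyz.
have x2 : x ^+ 2 <= (y + z) ^+ 2 by rewrite lerXn2r ?nnegrE// (le_trans x0).
apply: (le_trans x2); rewrite -subr_ge0; have := sqr_ge0 (y - z).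
by congr (0 <= _); ring.
Qed.

(** If q0 is not a limit of multiples of p, the normalised near-minimal
    residuals have a weak limit that annihilates p but not q0. *)
Lemma approximable_of_annihilators p q0 :
    (forall F, annihilates alpha p F -> F q0 = 0) ->
  forall eps : R, 0 < eps -> exists g, norm2 (q0 - p * g) < eps.
Proof.
move=> H eps eps0; apply: contrapT => no.
have {}no g : eps <= norm2 (q0 - p * g).
  by rewrite leNgt; apply/negP => lt; apply: no; exists g.
pose E := [set norm2 (q0 - p * g) | g in [set: P2]].
have infE : has_inf E.
  by split; [exists (norm2 (q0 - p * 0)), 0 | exists eps => _ [g _ <-]].
pose d := inf E.
have dlow g : d <= norm2 (q0 - p * g).
  by apply: inf_lbound; [case: infE | exists g].
have epsd : eps <= d.
  by apply: lb_le_inf; [case: infE | move=> _ [g _ <-]].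
have /choice[g gP] : forall n : nat, exists g,
    norm2 (q0 - p * g) <= d + n.+1%:R^-1.
  move=> n; have n0 : 0 < n.+1%:R^-1 :> R by rewrite invr_gt0.
  by have [_ [g _ <-] lt] := inf_adherent n0 infE; exists g; exact: ltW.
pose r n := q0 - p * g n.
pose K := d + 1.
have rK n : norm2 (r n) <= K.
  by apply: le_trans (gP n) _; rewrite lerD2l invf_le1// ler1n.
have orth n h : normc (ip (r n) (p * h)) ^+ 2 <= (norm2 (p * h) + 1) / n.+1%:R.
  apply: ip_near_min (gP n) _ => c.
  by rewrite mulrCA -addrA -opprD -mulrDr; exact: dlow.
pose Phi n q := ip q (r n).
have PhiE n k l : normc (Phi n (mono R k l)) ^+ 2 / w k l =
    w k l * normc (coef2 (r n) k l) ^+ 2.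
  rewrite /Phi ip_mono normcM normc_real normc_conj ger0_norm ?weight_ge0//.
  by rewrite exprMn mulrAC expr2 mulfK// gt_eqF// weight_gt0.
have box n N : boxsum N (fun k l => normc (Phi n (mono R k l)) ^+ 2 / w k l) <= K.
  apply: le_trans (rK n); apply: le_trans (boxsum_le_norm2 _ N).
  by apply: le_boxsum => k l _ _; rewrite PhiE.
have [k l|n N _|F [Fl Fb FP]] := @weak_limit R alpha Phi K (fun n => lin2_ip (r n)).
- exists (1 + K * w k l) => n.
  have : normc (Phi n (mono R k l)) ^+ 2 <= K * w k l.
    rewrite -ler_pdivrMr ?weight_gt0//; apply: le_trans (box n (maxn k l).+1).
    apply: (@term_le_boxsum _ _ _ _ (fun k l => normc (Phi n (mono R k l)) ^+ 2 / w k l)).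
    - by move=> i j; rewrite divr_ge0 ?sqr_ge0 ?weight_ge0.
    - lia.
    - lia.
  have := normc_ge0 (Phi n (mono R k l)).
  by move: (normc _) (K * _) => x y x0 xy; have := sqr_ge0 (x - 1); lra.
- exact: box.
have small (A eta : R) : 0 <= A -> 0 < eta -> exists N : nat, forall n (x : R), (N <= n)%N ->
    0 <= x -> x ^+ 2 <= A / n.+1%:R -> x <= eta.
  move=> A0 eta0; exists (Num.truncn (A / eta ^+ 2)) => n x Nn x0 xA.
  rewrite -(@ler_pXn2r _ 2) ?nnegrE ?(ltW eta0)//; apply: (le_trans xA).
  rewrite ler_pdivrMr ?ltr0n// mulrC -ler_pdivrMr ?exprn_gt0//.
  apply: le_trans (ltW (truncnS_gt _)) _.
  by rewrite ler_nat ltnS.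
have Fp h : F (p * h) = 0.
  apply: (@eq0_normc R); apply/le_anti; rewrite normc_ge0 andbT.
  apply/ler_addgt0Pr => e e0; rewrite add0r (splitr e).
  have e2 : 0 < e / 2 by rewrite divr_gt0.
  have [|N NP] := small (norm2 (p * h) + 1) _ _ e2; first by rewrite addr_ge0 ?norm2_ge0.
  have [n [Nn nP]] := FP [:: p * h] _ N e2.
  rewrite -[F _](subrK (Phi n (p * h))); apply: (le_trans (normc_triangle _ _)).
  apply: lerD; first by rewrite normc_subr nP// inE.
  apply: NP Nn _ _; first exact: normc_ge0.
  by rewrite /Phi ip_conj normc_conj; exact: orth.
have Fq0 := H F (And3 Fl Fb Fp).
have e4 : 0 < eps / 4%:R by rewrite divr_gt0.
pose A := 2 * norm2 q0 + 2 * K + 1.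
have d0 : 0 <= d by apply: le_trans epsd; exact: ltW.
have A0 : 0 <= A by rewrite /A /K !addr_ge0 ?mulr_ge0 ?addr_ge0 ?norm2_ge0.
have [N NP] := small A _ A0 e4.
have [n [Nn nP]] := FP [:: q0] _ N e4.
have := nP q0; rewrite inE eqxx Fq0 subr0 => /(_ isT).
have Phiq : Phi n q0 = (norm2 (r n))%:C + Phi n (p * g n).
  by rewrite -ip_norm2 -(lin2_ip (r n)).1 /r subrK.
have pg : normc (Phi n (p * g n)) <= eps / 4%:R.
  apply: NP Nn _ _; first exact: normc_ge0.
  rewrite /Phi ip_conj normc_conj; apply: (le_trans (orth n (g n))).
  rewrite ler_wpM2r ?invr_ge0// /A lerD2r.
  have -> : p * g n = q0 - r n by rewrite /r opprB addrC subrK.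
  by apply: le_trans (norm2_triangle _ _) _; rewrite lerD2l ler_wpM2l.
have low : eps <= norm2 (r n) by exact: no.
have : norm2 (r n) <= normc (Phi n q0) + normc (Phi n (p * g n)).
  have <- : normc ((norm2 (r n))%:C) = norm2 (r n) by rewrite normc_real ger0_norm ?norm2_ge0.
  rewrite -[X in normc X <= _](addrK (Phi n (p * g n))) -Phiq.
  by apply: (le_trans (normc_triangle _ _)); rewrite normc_opp.
by move: pg low; move: (normc _) (normc _) (norm2 _) => x y z; lra.
Qed.

End Duality.

(** * Infinite sums over pairs of natural numbers *)

Section EsumBox.
Variable R : realType.

Let box n := [seq (k, l) | k <- iota 0 n, l <- iota 0 n].

Let boxsum_seq (V : nmodType) n (F : nat -> nat -> V) :
  boxsum n F = \sum_(x <- box n) F x.1 x.2.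
Proof.
rewrite boxsumE /box big_allpairs /= -[in RHS](subn0 n) -/(index_iota 0 n) big_mkord.
by apply: eq_bigr => k _; rewrite big_mkord.
Qed.

Let uniq_box n : uniq (box n).
Proof.
by apply: allpairs_uniq; rewrite ?iota_uniq// => -[a b] [c d] _ _ [-> ->].
Qed.

Lemma boxsum_fsum n (a : nat * nat -> R) :
  (boxsum n (fun k l => a (k, l)))%:E = (\sum_(x \in [set` box n]) (a x)%:E)%E.
Proof.
rewrite -fsbig_seq ?uniq_box// sumEFin boxsum_seq; congr _%:E.
by apply: eq_bigr => -[].
Qed.

Lemma boxsum_le_esum n (a : nat * nat -> R) : (forall x, 0 <= a x) ->
  ((boxsum n (fun k l => a (k, l)))%:E <= \esum_(x in [set: nat * nat]) (a x)%:E)%E.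
Proof.
move=> a0; rewrite boxsum_fsum; apply: ereal_sup_ubound; exists [set` box n] => //.
by split=> //; exact: finite_seq.
Qed.

(** Every finite set of pairs lies in a box. *)
Lemma esum_le_boxsum K (a : nat * nat -> R) : (forall x, 0 <= a x) ->
    (forall n, boxsum n (fun k l => a (k, l)) <= K) ->
  (\esum_(x in [set: nat * nat]) (a x)%:E <= K%:E)%E.
Proof.
move=> a0 aK; apply: ge_ereal_sup => _ [A [finA _] <-].
have /finite_seqP[s As] := finA.
pose n := (\max_(x <- s) maxn x.1 x.2).+1.
apply: (@le_trans _ _ (boxsum n (fun k l => a (k, l)))%:E); last by rewrite lee_fin.
rewrite boxsum_fsum; apply: (lee_fsum_nneg_subset finA (finite_seq _)) => //.
  move=> -[k l]; rewrite !inE As /= => xs.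
  have : (maxn k l <= \max_(x <- s) maxn x.1 x.2)%N.
    by rewrite (big_rem (k, l)) //= leq_maxl.
  rewrite geq_max => /andP[kn ln].
  by apply/allpairsP; exists (k, l); split; rewrite ?mem_iota ?add0n ?ltnS.
by move=> x _; rewrite lee_fin.
Qed.

End EsumBox.

(** * From polynomials to the Dirichlet-type spaces *)

Section TaylorCoefficients.
Variable R : realType.
Local Notation C := R[i].
Local Notation P2 := {poly {poly C}}.
Implicit Types (f g : C * C -> C) (a b : nat * nat -> C) (p q : P2).

Lemma boxsum_cvg0 (u : nat -> C) : (u : nat -> C^o) @ \oo --> (0 : C^o) ->
  forall e : R, 0 < e -> exists N, forall n, (N <= n)%N -> normc (u n) <= e.
Proof.
move=> /cvgrPdist_le u0 e e0; have e0' : 0 < e%:C :> C by rewrite ltcR.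
have [N _ NP] := u0 _ e0'; exists N => n Nn.
have := NP n Nn; rewrite /= sub0r normrN normE; by rewrite lecR.
Qed.

Lemma taylor_absE a f z : taylor_expansion a f -> bidisk z -> exists K, forall n,
  boxsum n (fun k l => normc (a (k, l) * monomial (k, l) z)) <= K.
Proof.
move=> af /af[fin _]; move: fin.
set E := esum _ _ => fin.
have E0 n : ((boxsum n (fun k l => normc (a (k, l) * monomial (k, l) z)))%:E <= E)%E.
  apply: (@boxsum_le_esum _ n (fun x => normc (a x * monomial x z))).
  by move=> x; exact: normc_ge0.
have Efin : E \is a fin_num.
  by rewrite ge0_fin_numE// (le_trans _ (E0 0%N))// lee_fin boxsum_ge0// => *; exact: normc_ge0.
by exists (fine E) => n; rewrite -lee_fin fineK.
Qed.

Lemma taylorB a b f g : taylor_expansion a f -> taylor_expansion b g ->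
  taylor_expansion (fun x => a x - b x) (f \- g).
Proof.
move=> af bg z zD; split.
  have [K KP] := taylor_absE af zD; have [L LP] := taylor_absE bg zD.
  apply: (@le_lt_trans _ _ (K + L)%:E); last exact: ltry.
  apply: esum_le_boxsum => [x|n]; first exact: normc_ge0.
  apply: le_trans (lerD (KP n) (LP n)); rewrite -boxsumD; apply: le_boxsum => k l _ _.
  by rewrite mulrBl -(normc_opp (b _ * _)) normc_triangle.
pose U (c : nat * nat -> C) : nat -> C^o := fun n =>
  \sum_(k < n) \sum_(l < n) c (k : nat, l : nat) * monomial (k : nat, l : nat) z.
suff : U (fun x => a x - b x) @ \oo --> ((f z - g z) : C^o) by [].
have -> : U (fun x => a x - b x) = (fun n => U a n - U b n).
  apply/funext => n; rewrite /U -sumrB; apply: eq_bigr => k _.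
  by rewrite -sumrB; apply: eq_bigr => l _; rewrite mulrBl.
exact: cvgB (af z zD).2 (bg z zD).2.
Qed.

Lemma coef2_boxpoly n a k l :
  coef2 (boxsum n (fun k l => (a (k, l))%:P%:P * mono R k l)) k l =
  if (k < n)%N && (l < n)%N then a (k, l) else 0.
Proof.
rewrite coef2_sum; case: ifP => [/andP[kn ln]|kl].
  rewrite (bigD1 (Ordinal kn, Ordinal ln)) //= coef2Z coef2_mono !eqxx mulr1.
  rewrite big1 ?addr0// => -[x y] /= xy; rewrite coef2Z coef2_mono.
  case: eqP => [kx|_]; last by rewrite mulr0.
  case: eqP => [ly|_]; last by rewrite mulr0.
  by case/eqP: xy; congr (_, _); apply: val_inj.
rewrite big1// => -[[x xn] [y yn]] _ /=; rewrite coef2Z coef2_mono.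
case: eqP => [kx|_]; last by rewrite mulr0.
case: eqP => [ly|_]; last by rewrite mulr0.
by rewrite kx ly xn yn in kl.
Qed.

(** The partial sums of the difference over large boxes are uniformly small on
    the torus of radius 1/2, since the series converges absolutely there to 0.
    Cauchy's estimates then make every coefficient small. *)
Lemma taylor_unique a b f : taylor_expansion a f -> taylor_expansion b f -> a = b.
Proof.
move=> af bf; pose d x := a x - b x.
have d0 : taylor_expansion d (f \- f) by exact: taylorB.
suff dE x : d x = 0.
  by apply/funext => x; apply/eqP; rewrite -subr_eq0; apply/eqP/dE.
pose h : C := 2^-1.
have h1 : normc h = 2^-1 by rewrite normcV normc_nat.
have h0 : 0 < normc h by rewrite h1 invr_gt0.
have hD (u v : C) : normc u = 1 -> normc v = 1 -> bidisk (h * u, h * v).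
  by move=> u1 v1; split; rewrite normc_lt1 /= normcM ?u1 ?v1 mulr1 h1 invf_lt1// ltr1n.
pose t k l : R := normc (d (k, l)) * normc h ^+ (k + l).
have t0 k l : 0 <= t k l by rewrite mulr_ge0 ?exprn_ge0 ?normc_ge0.
have termE u v k l : normc u = 1 -> normc v = 1 ->
    normc (d (k, l) * monomial (k, l) (h * u, h * v)) = t k l.
  move=> u1 v1; rewrite /monomial /= !normcM !normcX !normcM u1 v1 !mulr1.
  by rewrite -exprD.
have [K KP] := taylor_absE d0 (hD 1 1 (@normc1 R) (@normc1 R)).
have tK n : boxsum n t <= K.
  apply: le_trans (KP n); apply: le_boxsum => k l _ _.
  by rewrite termE ?normc1.
case: x => i j; apply: (@eq0_normc R); apply/le_anti; rewrite normc_ge0 andbT.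
rewrite -(pmulr_lle0 _ (_ : 0 < normc h ^+ (i + j))) ?exprn_gt0//.
apply/ler_addgt0Pr => e e0; rewrite add0r.
have e2 : 0 < e / 2 by rewrite divr_gt0.
have [N0 NP] := bounded_mono_tail (fun n m => @boxsum_mono R n m t t0) tK e2.
pose N := maxn N0 (maxn i j).+1.
pose S n u v := boxsum n (fun k l => d (k, l) * monomial (k, l) (h * u, h * v)).
have SN u v : normc u = 1 -> normc v = 1 -> normc (S N u v) <= e.
  move=> u1 v1; have := (d0 _ (hD u v u1 v1)).2; rewrite /= subrr.
  move=> /boxsum_cvg0/(_ _ e2)[M MP]; pose m := maxn M N.
  have Nm : (N <= m)%N by rewrite leq_maxr.
  have Sm : normc (S m u v) <= e / 2 by rewrite /S boxsumE; exact: MP (leq_maxl _ _).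
  have -> : S N u v = S m u v - boxsum m (fun k l => if (k < N)%N && (l < N)%N then 0
      else d (k, l) * monomial (k, l) (h * u, h * v)).
    rewrite /S (boxsum_widen _ Nm) /boxsum -sumrB; apply: eq_bigr => x _.
    by case: ifP => _; rewrite ?subr0 ?subrr.
  apply: (le_trans (normc_triangle _ _)); rewrite (splitr e) lerD// normc_opp.
  have := NP N m (leq_maxl _ _); rewrite -lerBlDl; apply: le_trans.
  rewrite lerBrDr; apply: le_trans (lerD (normc_sum _ _ _) (lexx _)) _.
  rewrite (boxsum_widen t Nm) -big_split /=; apply: ler_sum => x _.
  by case: ifP => _; rewrite ?normc0 ?add0r// addr0 termE.
pose c (x : nat * nat) := d x * h ^+ (x.1 + x.2).
pose q : P2 := boxsum N (fun k l => (c (k, l))%:P%:P * mono R k l).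
have qE k l : (k < N)%N -> (l < N)%N -> coef2 q k l = d (k, l) * h ^+ (k + l).
  by move=> kN lN; rewrite coef2_boxpoly kN lN.
have peval_q u v : peval q (u, v) = S N u v.
  rewrite peval_sum; apply: eq_bigr => x _; rewrite pevalM pevalC peval_mono.
  by rewrite /c /monomial /= !exprMn exprD; ring.
have iN : (i < N)%N by rewrite /N; lia.
have jN : (j < N)%N by rewrite /N; lia.
have -> : normc (d (i, j)) * normc h ^+ (i + j) = normc (coef2 q i j).
  by rewrite qE// normcM normcX.
rewrite /coef2; apply: coef_le_sup => u u1.
have -> : (q`_j).[u] = (fix1 q u)`_j by rewrite /fix1 coef_map_id0 ?horner0.
by apply: coef_le_sup => v v1; rewrite horner_fix1 peval_q SN.
Qed.

Lemma taylor_coefE a f : taylor_expansion a f -> taylor_coef f = a.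
Proof. by move=> af; apply: xget_unique => // b bf; exact: taylor_unique bf af. Qed.

Lemma taylor_peval q : taylor_expansion (fun x => coef2 q x.1 x.2) (peval q).
Proof.
move=> z zD; split.
  pose t k l := normc (coef2 q k l * monomial (k, l) z).
  have t0 k l : 0 <= t k l by exact: normc_ge0.
  apply: (@le_lt_trans _ _ (boxsum (bidim q) t)%:E); last exact: ltry.
  apply: (@esum_le_boxsum _ _ (fun x => normc (coef2 q x.1 x.2 * monomial x z))).
    by move=> x; exact: normc_ge0.
  move=> n; apply: (@le_trans _ _ (boxsum (maxn n (bidim q)) t)).
    exact: (boxsum_mono t0 (leq_maxl _ _)).
  rewrite (boxsum_stable (leq_maxr _ _)) // => k l kl.
  by rewrite /t coef2_bidim// mul0r normc0.
apply: cvg_near_cst; exists (bidim q) => // n /= qn.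
by rewrite (peval_box z qn) boxsumE.
Qed.

Lemma dirichlet_norm2E alpha a f : taylor_expansion a f ->
  dirichlet_norm2 alpha f = \esum_(x in [set: nat * nat])
    (weight alpha (x.1 + x.2) * normc (a x) ^+ 2)%:E.
Proof.
move=> af; rewrite /dirichlet_norm2 (taylor_coefE af); apply: eq_esum => x _.
by rewrite /weight addn1.
Qed.

Lemma dirichlet_norm2_le alpha a f K : taylor_expansion a f ->
    (forall n, boxsum n (fun k l => weight alpha (k + l) * normc (a (k, l)) ^+ 2) <= K) ->
  (dirichlet_norm2 alpha f <= K%:E)%E.
Proof.
move=> af aK; rewrite (dirichlet_norm2E alpha af).
apply: (@esum_le_boxsum _ _ (fun x => weight alpha (x.1 + x.2) * normc (a x) ^+ 2)) => //.
by move=> x; rewrite mulr_ge0 ?weight_ge0 ?sqr_ge0.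
Qed.

Lemma boxsum_le_dirichlet_norm2 alpha a f n : taylor_expansion a f ->
  ((boxsum n (fun k l => weight alpha (k + l) * normc (a (k, l)) ^+ 2))%:E <=
   dirichlet_norm2 alpha f)%E.
Proof.
move=> af; rewrite (dirichlet_norm2E alpha af).
apply: (@boxsum_le_esum _ n (fun x => weight alpha (x.1 + x.2) * normc (a x) ^+ 2)).
by move=> x; rewrite mulr_ge0 ?weight_ge0 ?sqr_ge0.
Qed.

Lemma dirichlet_norm2_ge0 alpha f : (0 <= dirichlet_norm2 alpha f)%E.
Proof.
apply: esum_ge0 => x _; rewrite lee_fin mulr_ge0 ?sqr_ge0//; exact: powR_ge0.
Qed.

Lemma dirichlet_space_peval alpha q : dirichlet_space alpha (peval q).
Proof.
split; first by exists (fun x => coef2 q x.1 x.2); exact: taylor_peval.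
apply: (@le_lt_trans _ _ (norm2 alpha q)%:E); last exact: ltry.
apply: dirichlet_norm2_le (taylor_peval q) _ => n; exact: boxsum_le_norm2.
Qed.

Lemma span_multiples p h : linear_span (monomial_multiples (peval p)) h <->
  exists g : P2, h = peval (p * g).
Proof.
split=> [[n [c [s [sP ->]]]]|[g ->]].
  have /choice[kl klP] : forall i : 'I_n, exists kl : nat * nat,
      s i = (fun z => monomial kl z * peval p z) by move=> i; exact: sP.
  exists (\sum_(i < n) (c i)%:P%:P * mono R (kl i).1 (kl i).2).
  apply/funext => z; rewrite pevalM peval_sum mulr_sumr; apply: eq_bigr => i _.
  rewrite klP pevalM pevalC peval_mono -surjective_pairing; ring.
pose N := bidim g; pose I : finType := ('I_N * 'I_N)%type.
pose ev : 'I_#|{: I}| -> I := @enum_val I predT.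
exists #|{: I}|, (fun i => coef2 g (ev i).1 (ev i).2),
  (fun i z => monomial ((ev i).1 : nat, (ev i).2 : nat) z * peval p z).
split=> [i|]; first by exists ((ev i).1 : nat, (ev i).2 : nat).
apply/funext => z; rewrite pevalM (peval_box z (leqnn N)) mulrC mulr_suml.
rewrite /boxsum (reindex ev); last exact/onW_bij/enum_val_bij.
by apply: eq_bigr => i _; rewrite mulrA.
Qed.

Lemma dirichlet_norm_lt alpha f (e : R) : 0 < e ->
  (dirichlet_norm alpha f < e%:E)%E <-> (dirichlet_norm2 alpha f < (e ^+ 2)%:E)%E.
Proof.
move=> e0; have E : e%:E = sqrte (e ^+ 2)%:E :> \bar R.
  by rewrite /= sqrtr_sqr gtr0_norm.
by rewrite /dirichlet_norm E !ltNge lee_sqrt ?dirichlet_norm2_ge0.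
Qed.

(** Any f in the space is approximated by a polynomial, a truncation to a box,
    and this polynomial by multiples of p. *)
Lemma cyclic_of_annihilators alpha p :
    (forall F, annihilates alpha p F -> forall q, F q = 0) ->
  cyclic_in_dirichlet alpha (peval p).
Proof.
move=> H; split; first exact: dirichlet_space_peval.
apply/seteqP; split=> [f []//|f fD]; split => // e e0.
have [[a af] fin] := fD.
pose t k l := weight alpha (k + l) * normc (a (k, l)) ^+ 2.
have t0 k l : 0 <= t k l by rewrite mulr_ge0 ?weight_ge0 ?sqr_ge0.
have Nfin : dirichlet_norm2 alpha f \is a fin_num.
  by rewrite ge0_fin_numE// dirichlet_norm2_ge0.
have tK n : boxsum n t <= fine (dirichlet_norm2 alpha f).
  by rewrite -lee_fin fineK//; exact: boxsum_le_dirichlet_norm2.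
pose d := e ^+ 2 / 8%:R; have d0 : 0 < d by rewrite divr_gt0// exprn_gt0.
have [N NP] := bounded_mono_tail (fun n m => @boxsum_mono R n m t t0) tK d0.
pose q0 : P2 := boxsum N (fun k l => (a (k, l))%:P%:P * mono R k l).
have [g gP] := approximable_of_annihilators (fun F FP => H F FP q0) d0.
exists (peval (p * g)); split; [|exact: dirichlet_space_peval|].
  by apply/span_multiples; exists g.
apply/(dirichlet_norm_lt _ _ e0).
apply: (@le_lt_trans _ _ (2 * d + 2 * d)%:E); last first.
  rewrite lte_fin /d; have : 0 < e ^+ 2 by rewrite exprn_gt0.
  by move: (e ^+ 2) => x; lra.
apply: dirichlet_norm2_le (taylorB af (taylor_peval (p * g))) _ => n /=.
pose t1 k l := if (k < N)%N && (l < N)%N then 0 else t k l.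
have t1d : boxsum n t1 <= d.
  have t10 k l : 0 <= t1 k l by rewrite /t1; case: ifP.
  apply: le_trans (boxsum_mono t10 (leq_maxl n N)) _.
  have := NP N (maxn n N) (leqnn _); rewrite -lerBlDl; apply: le_trans.
  rewrite lerBrDr (boxsum_widen t (leq_maxr n N)) -boxsumD; apply: le_boxsum => k l _ _.
  by rewrite /t1; case: ifP => _; rewrite ?add0r ?addr0.
apply: (@le_trans _ _ (2 * boxsum n t1 + 2 * boxsum n (fun k l =>
    weight alpha (k + l) * normc (coef2 (q0 - p * g) k l) ^+ 2))); last first.
  rewrite lerD// ler_wpM2l//; apply: le_trans (boxsum_le_norm2 _ _ _) (ltW gP).
rewrite -!boxsumZ -boxsumD; apply: le_boxsum => k l _ _.
rewrite coef2B coef2_boxpoly /t1 /t; set c := coef2 _ _ _; set W := weight _ _.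
have W0 : 0 <= W by exact: weight_ge0.
case: ifP => _.
  by rewrite mulr0 add0r; apply: ler_peMl; rewrite ?ler1n// mulr_ge0 ?sqr_ge0.
rewrite sub0r normc_opp !(mulrCA 2) -mulrDr ler_wpM2l//.
have := normc_triangle (a (k, l)) (- c); rewrite normc_opp.
have := normc_ge0 (a (k, l) - c).
move: (normc (a _ - _)) (normc (a (k, l))) (normc c) => x y z x0 xyz.
have x2 : x ^+ 2 <= (y + z) ^+ 2 by rewrite lerXn2r ?nnegrE// (le_trans x0).
apply: (le_trans x2); rewrite -subr_ge0; have := sqr_ge0 (y - z).
by congr (0 <= _); ring.
Qed.

(** F is bounded and kills the multiples of p, so a polynomial q with F(q) <> 0 is
    not a limit of such multiples. *)
Lemma not_cyclic_of_annihilator alpha p F q : annihilates alpha p F -> F q != 0 ->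
  ~ cyclic_in_dirichlet alpha (peval p).
Proof.
move=> [Fl [K FK] Fp] Fq [_ cyc].
have K0 : 0 <= K by apply: le_trans (FK 0%N); apply: boxsum_ge0 => k l;
  rewrite divr_ge0 ?sqr_ge0 ?weight_ge0.
have x0 : 0 < normc (F q) by rewrite normc_gt0.
set x := normc (F q) in x0; pose e := x / (K + 1).
have K1 : 0 < K + 1 by rewrite ltr_wpDl.
have e0 : 0 < e by rewrite divr_gt0.
have : dirichlet_space alpha (peval q) by exact: dirichlet_space_peval.
rewrite -cyc => -[_ /(_ e e0)[h [/span_multiples[g ->] _]]].
move=> /(dirichlet_norm_lt _ _ e0) hN.
have box n : boxsum n (fun k l =>
    weight alpha (k + l) * normc (coef2 (q - p * g) k l) ^+ 2) <= e ^+ 2.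
  rewrite -lee_fin; apply: le_trans (ltW hN).
  apply: le_trans (boxsum_le_dirichlet_norm2 _ n (taylorB (taylor_peval q) (taylor_peval (p * g)))).
  by rewrite lee_fin; apply: le_boxsum => k l _ _; rewrite coef2B.
pose r := q - p * g.
have Fr : F q = F r by rewrite /r Fl.1 (lin2N _ Fl) Fp subr0.
have : x ^+ 2 <= e ^+ 2 * K.
  pose y k l := normc (F (mono R k l)); pose c k l := normc (coef2 r k l).
  have W0 k l : 0 < weight alpha (k + l) by exact: weight_gt0.
  apply: (@le_trans _ _ (boxsum (bidim r) (fun k l => c k l * y k l) ^+ 2)).
    rewrite lerXn2r ?nnegrE ?(ltW x0)//.
      by apply: boxsum_ge0 => k l; rewrite mulr_ge0 ?normc_ge0.
    rewrite /x Fr {1}(lin2_box Fl (leqnn (bidim r))); apply: (le_trans (normc_sum _ _ _)).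
    by apply: ler_sum => i _; rewrite normcM.
  apply: (le_trans (boxsum_cs _ _ _ W0)); apply: ler_pM; rewrite ?box ?FK//.
    by apply: boxsum_ge0 => k l; rewrite mulr_ge0 ?weight_ge0 ?sqr_ge0.
  by apply: boxsum_ge0 => k l; rewrite divr_ge0 ?weight_ge0 ?sqr_ge0.
rewrite /e expr_div_n mulrAC ler_pdivlMr ?exprn_gt0// ler_pM2l ?exprn_gt0//.
nra.
Qed.

End TaylorCoefficients.

(** * Cyclic polynomials *)

Theorem theorem1p3 (R : realType) (alpha : R) (p : {poly {poly R[i]}})
    (irr_p : irreducible2 p)
    (p_neq0 : forall z : R[i] * R[i], bidisk z -> peval p z <> 0) :
  (alpha <= 1 -> cyclic_in_dirichlet alpha (peval p)) /\
  (1 < alpha <= 2 ->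
     (cyclic_in_dirichlet alpha (peval p) <->
      zero_set p `&` torus2 = set0 \/ finite_set (zero_set p `&` torus2))) /\
  (2 < alpha ->
     (cyclic_in_dirichlet alpha (peval p) <-> zero_set p `&` torus2 = set0)).
Proof.
have p0 := irr_p.1.
have szp : size p = (size p).-1.+1 by rewrite prednK// size_poly_gt0.
have szYp : sizeY p = (sizeY p).-1.+1 by rewrite prednK// lt0n sizeY_eq0.
have szp' : (size p <= (size p).-1.+1)%N by rewrite -szp.
have szYp' : (sizeY p <= (sizeY p).-1.+1)%N by rewrite -szYp.
have trichotomy := transversal_or_torus_over irr_p szp szYp p_neq0.
have torus_not_cyclic : 1 < alpha -> torus_over p \/ torus_over (swapXY p) ->
    ~ cyclic_in_dirichlet alpha (peval p).
  move=> a1 [pT|pT].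
    have [F [Fann F1]] := torus_over_functional a1 pT.
    exact: not_cyclic_of_annihilator Fann F1.
  have [F [Fann F1]] := torus_over_functional a1 pT.
  apply: (not_cyclic_of_annihilator (q := 1) (annihilates_swap Fann)).
  by rewrite rmorph1.
have torus_infinite : torus_over p \/ torus_over (swapXY p) ->
    infinite_set (zero_set p `&` torus2).
  by case; [exact: torus_over_infinite | exact: torus_over_swap_infinite].
split; [|split].
- move=> a1; apply: cyclic_of_annihilators => F Fann q.
  have := annihilates_one szp' szYp' p_neq0 a1 (annihilates_mul q Fann).
  by rewrite mulr1.
- move=> /andP[a1 a2]; have [pt|pT] := trichotomy.
    split=> _; first by right; exact: transversal_finite szp' szYp' pt.
    apply: cyclic_of_annihilators => F.
    exact: (transversal_cyclic szp' szYp' p_neq0 pt (or_introl a2)).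
  split=> [/(torus_not_cyclic a1 pT)//|fin]; case: (torus_infinite pT).
  by case: fin => // ->; exact: finite_set0.
move=> a2; split=> [cyc|Z0].
  rewrite -subset0 => z [pz zT].
  apply: (not_cyclic_of_annihilator (q := 1) (annihilates_peval a2 zT pz)) cyc.
  by rewrite /peval -polyC1 !hornerC oner_neq0.
have [pt|/torus_infinite] := trichotomy; last first.
  by rewrite Z0 => /(_ (finite_set0 _)).
apply: cyclic_of_annihilators => F.
exact: (transversal_cyclic szp' szYp' p_neq0 pt (or_intror Z0)).
Qed.
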